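(* Consider the stochastic energy exchange model $\mathbf{E}_t$ on $\mathbb{R}^N_+$ with transition kernel $P^t$ described in the context. For any $\gamma>0$ there exists $\eta>0$ such that for any probability measures $\mu,\nu\in\mathcal{M}_\eta$, $$\lim_{t\to\infty} t^{2-\gamma}\,\|\mu P^t-\nu P^t\|_{TV}=0,$$ where $\|\cdot\|_{TV}$ is the total variation norm.
   Context: Fix an integer $N\ge1$, bath temperatures $T_L,T_R>0$ and a sufficiently large constant $K$ ($K\gg T_L,T_R$). Let $R(a,b)=\min\{K,\sqrt{\min(a,b)}\}$. The stochastic energy exchange model is the Markov jump process $\mathbf{E}_t=(E_1(t),\dots,E_N(t))$ on $\mathbb{R}^N_+$ defined as follows: for each $i=1,\dots,N-1$ an exponential clock with rate $R(E_i,E_{i+1})$ is attached to sites $i,i+1$; when it rings, $(E_i,E_{i+1})$ is replaced by $(p(E_i+E_{i+1}),(1-p)(E_i+E_{i+1}))$ with $p$ uniform on $(0,1)$. A clock of rate $R(T_L,E_1)$ (resp. $R(E_N,T_R)$) is attached to site $1$ and the left bath (resp. site $N$ and the right bath); when it rings, $E_1$ is replaced by $p(E_1+X_L)$ (resp. $E_N$ by $p(E_N+X_R)$), with $p$ uniform on $(0,1)$ and $X_L$ (resp. $X_R$) exponential with mean $T_L$ (resp. $T_R$). All clocks and random variables are independent. $P^t(\mathbf{E},\cdot)$ is its transition kernel and $(\mu P^t)(B)=\int P^t(\mathbf{E},B)\,\mu(d\mathbf{E})$. Let $W(\mathbf{E})=\sum_{i=1}^N E_i$, $a_m=1-\frac{2^{m-1}-1}{2^N-1}$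 for $m=1,\dots,N$, and for $0<\eta\ll1$ let $V_\eta(\mathbf{E})=\sum_{m=1}^N\sum_{i=1}^{N-m+1}\big(\sum_{j=0}^{m-1}E_{i+j}\big)^{a_m\eta-1}$. $\mathcal{M}_\eta$ is the set of probability measures $\mu$ on $\mathbb{R}^N_+$ with $\int (W+V_\eta)\,d\mu<\infty$. *)

(* Defs.v *)
From HB Require Import structures.
From mathcomp Require Import all_boot all_order all_algebra.
From mathcomp Require Import all_classical all_reals all_analysis.
Set Implicit Arguments. Unset Strict Implicit. Unset Printing Implicit Defensive.
Import Order.TTheory GRing.Theory Num.Theory.
Import numFieldNormedType.Exports.
Local Open Scope classical_set_scope.
Local Open Scope ring_scope.

Section SEM.
Context (R : realType) (N : nat) (TL TR K : R).

(* states: N.-tuple R, coordinate E_{k+1} of the paper is E x k (0-based) *)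
Definition E (x : N.-tuple R) (k : nat) : R := nth 0 x k.

Definition upd1 (x : N.-tuple R) (k : nat) (a : R) : N.-tuple R :=
  [tuple (if (j : nat) == k then a else tnth x j) | j < N].

Definition upd2 (x : N.-tuple R) (k : nat) (a b : R) : N.-tuple R :=
  [tuple (if (j : nat) == k then a else if (j : nat) == k.+1 then b else tnth x j)
   | j < N].

Definition rate (a b : R) : R := Num.min K (Num.sqrt (Num.min a b)).

Definition Eunif (g : R -> \bar R) : \bar R :=
  (\int[lebesgue_measure]_(p in `[0%R, 1%R]) g p)%E.

Definition Eexp (T : R) (g : R -> \bar R) : \bar R :=
  (\int[lebesgue_measure]_(y in `[0%R, +oo[) ((T^-1 * expR (- (y / T)))%:E * g y))%E.

Definition total_rate (x : N.-tuple R) : R :=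
  \sum_(k < N.-1) rate (E x k) (E x k.+1) + rate TL (E x 0) + rate (E x N.-1) TR.

(* uniformization constant: an upper bound of the total rate *)
Definition lam : R := N.+1%:R * K.

(* one-step kernel Q = I + G / lam of the uniformized chain, acting on
   nonnegative (extended-real) functions; G is the generator of the
   jump process described in the paper *)
Definition Qop (f : N.-tuple R -> \bar R) (x : N.-tuple R) : \bar R :=
  ((1 - total_rate x / lam)%:E * f x
   + \sum_(k < N.-1)
       ((rate (E x k) (E x k.+1) / lam)%:E *
        Eunif (fun p => f (upd2 x k (p * (E x k + E x k.+1))
                                    ((1 - p) * (E x k + E x k.+1)))))
   + (rate TL (E x 0) / lam)%:E *
       Eunif (fun p => Eexp TL (fun y => f (upd1 x 0 (p * (E x 0 + y)))))
   + (rate (E x N.-1) TR / lam)%:E *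
       Eunif (fun p => Eexp TR (fun y => f (upd1 x N.-1 (p * (E x N.-1 + y))))))%E.

(* transition semigroup P^t f = e^{tG} f = sum_n e^{-lam t} (lam t)^n/n! Q^n f *)
Definition Pt (t : R) (f : N.-tuple R -> \bar R) (x : N.-tuple R) : \bar R :=
  (\sum_(n <oo) ((expR (- (lam * t)) * (lam * t) ^+ n / (n`!)%:R)%:E
                  * iter n Qop f x))%E.

Definition muPt (mu : probability (N.-tuple R) R) (t : R) (B : set (N.-tuple R))
  : \bar R :=
  (\int[mu]_x Pt t (fun y => (\1_B y)%:E) x)%E.

Definition TVdist (mu nu : probability (N.-tuple R) R) (t : R) : R :=
  fine (ereal_sup [set `|(muPt mu t B - muPt nu t B)%E|%E | B in measurable]).

Definition Wfun (x : N.-tuple R) : R := \sum_(i < N) tnth x i.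

Definition a_m (m : nat) : R :=
  1 - ((2 ^ m.-1)%:R - 1) / ((2 ^ N)%:R - 1).

Definition negpow (s e : R) : \bar R := if 0 < s then (s `^ e)%:E else +oo%E.

Definition Vfun (eta : R) (x : N.-tuple R) : \bar R :=
  (\sum_(1 <= m < N.+1) \sum_(0 <= i < N - m + 1)
      negpow (\sum_(0 <= j < m) E x (i + j)) (a_m m * eta - 1))%E.

Definition Rplus_orthant : set (N.-tuple R) := [set x | forall i, 0 <= tnth x i].

Definition M_eta (eta : R) (mu : probability (N.-tuple R) R) : Prop :=
  mu (~` Rplus_orthant) = 0%E /\
  (\int[mu]_x ((Wfun x)%:E + Vfun eta x) < +oo)%E.

End SEM.

(* Main.v *)
(* Since [P^t] is a Poisson mixture of the powers of the Markov operator [Q], it suffices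
   to bound the oscillation of [Q^n f], [0 <= f <= 1], by [n^(-q)] with [q > 2 - gamma],
   locally uniformly with a weight integrable under the measures of [M_eta].

   Low energies.  Give a block of neighbouring sites of total energy [s] the cost
   [s^(th - 1)], and let [v] be a weighted sum over all blocks, long blocks having by far
   the largest weights.  The block that is smallest relative to its weight has a
   neighbour with much more energy, and exchanges with it at a rate of order [s^(1/2)];
   hence [Q v <= v - c v^alpha + b] with [alpha = (1/2 - th) / (1 - th)].

   High energies.  Where [v] is bounded, all rates are bounded below; moving energy site
   by site to the right bath then contracts the total energy [W] under [P = Q^N], and
   moving it so as to refresh every site gives a minorization.  Where [v] is large, [W]
   need not decrease, but [W (1 - (1 + v)^(-th))] does, by a multiple of
   [W v^(alpha - 1 - th)].  Altogether [V = v + W + kap W (1 - (1 + v)^(-th))] satisfies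
   [P V <= V - c V^beta + b] with [beta = alpha / (1 + th)].

   Subgeometric rate.  If [g x - g y <= s (A + V x + V y)] for all [x], [y], then the drift
   and the minorization give [P g x - P g y <= s (w - eps w^beta)] with [w = A + V x + V y].
   Iterating, and using that the oscillation never exceeds 1, yields the rate
   [n^(- 1 / (1 - beta))], and [1 / (1 - beta) > 2 - 4 th]. *)
Require Import Defs.
From HB Require Import structures.
From mathcomp Require Import all_boot all_order all_algebra.
From mathcomp Require Import all_classical all_reals all_analysis.
From mathcomp Require Import measurable_realfun.
From mathcomp Require Import ring lra zify.
Set Implicit Arguments. Unset Strict Implicit. Unset Printing Implicit Defensive.
Import Order.TTheory GRing.Theory Num.Theory.
Import numFieldNormedType.Exports.
Local Open Scope classical_set_scope.
Local Open Scope ring_scope.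

(** * Positive functionals and Markov operators *)

Section markov_operators.
Context {d : measure_display} {X : measurableType d} {R : realType}.
Implicit Types (D : set X) (f g : X -> \bar R).

(** The limiting exponent 2 comes from the low energies alone. A site that exchanges with a much
    richer neighbour gets a uniform share [p] of a large sum, and [p^(th - 1)] is integrable only
    for [th > 0]; it waits for this at a rate of order [s^(1/2)]. As [th] tends to 0, [alpha] and
    [beta] tend to 1/2 and [1 / (1 - beta)] to 2.

    Costs of single sites would not do: a poor site may sit beside an equally poor one, and their
    exchanges gain nothing. The total of a block is unchanged by exchanges inside it, so it moves
    only through its two boundary edges, and enlarging a block ends at a bath, whose energy is
    fixed.

    Nor can [W] be treated apart from [v]: a poor block delays the transport of energy to the bath
    without bound. The factor [1 - (1 + v)^(-th)] is bounded and concave in [v], so the drift of [v]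
    passes to it through its tangent, and the product stays below [W]. The value of [beta] makes
    [(v + W)^beta] match [v^alpha + W v^(alpha - 1 - th)] at the crossover [W = v^(1 + th)]. *)

Definition nnmf f := measurable_fun setT f /\ forall x, (0 <= f x)%E.

(* Integration against a probability measure carried by [D]; finite iteration of such
   integrals is only needed on nonnegative functions, so no measure is ever built. *)
Record posfun D (L : (X -> \bar R) -> \bar R) : Prop := PosFun {
  posfun_ge0 : forall f, nnmf f -> (0 <= L f)%E ;
  posfunD : forall f g, nnmf f -> nnmf g -> L (fun x => f x + g x)%E = (L f + L g)%E ;
  posfunZ : forall k f, 0 <= k -> nnmf f -> L (fun x => k%:E * f x)%E = (k%:E * L f)%E ;
  posfun1 : L (fun=> 1%:E) = 1%:E ;
  posfun_le : forall f g, nnmf f -> nnmf g -> (forall x, D x -> (f x <= g x)%E) ->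
    (L f <= L g)%E }.

(* [D] is an invariant set outside of which the operator is only known to be an average
   over the whole space. *)
Record markov_op D (P : (X -> \bar R) -> X -> \bar R) : Prop := MarkovOp {
  markov_nn : forall f, nnmf f -> nnmf (P f) ;
  markov_on : forall x, D x -> posfun D (P ^~ x) ;
  markov_T : forall x, posfun setT (P ^~ x) }.

Lemma nnmfD f g : nnmf f -> nnmf g -> nnmf (fun x => f x + g x)%E.
Proof.
move=> [mf f0] [mg g0]; split; first exact: emeasurable_funD.
by move=> x; rewrite adde_ge0 ?f0 ?g0.
Qed.

Lemma nnmfZ (k : R) f : 0 <= k -> nnmf f -> nnmf (fun x => k%:E * f x)%E.
Proof.
move=> k0 [mf f0]; split; first exact: measurable_funeM.
by move=> x; rewrite mule_ge0 ?lee_fin ?f0.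
Qed.

Lemma nnmf_cst (k : R) : 0 <= k -> nnmf (fun=> k%:E).
Proof. by move=> k0; split. Qed.

Lemma nnmf_EFin (u : X -> R) : measurable_fun setT u -> (forall x, 0 <= u x) ->
  nnmf (EFin \o u).
Proof. by move=> mu u0; split; [exact/measurable_EFinP|move=> x; rewrite lee_fin]. Qed.

Lemma posfun_comp E L (P : (X -> \bar R) -> X -> \bar R) :
  (forall f, nnmf f -> nnmf (P f)) -> (forall x, posfun setT (P ^~ x)) ->
  (forall x, E x -> posfun E (P ^~ x)) -> posfun E L -> posfun E (fun f => L (P f)).
Proof.
move=> Pn PT PE HL; split => [f hf|f g hf hg|k f k0 hf||f g hf hg fg].
- exact: (posfun_ge0 HL (Pn _ hf)).
- rewrite -(posfunD HL (Pn _ hf) (Pn _ hg)); congr L; apply/funext => y.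
  exact: (posfunD (PT y)).
- rewrite -(posfunZ HL k0 (Pn _ hf)); congr L; apply/funext => y.
  exact: (posfunZ (PT y)).
- by rewrite -[RHS](posfun1 HL); congr L; apply/funext => y; exact: (posfun1 (PT y)).
- apply: (posfun_le HL (Pn _ hf) (Pn _ hg)) => y Ey.
  exact: (posfun_le (PE y Ey)).
Qed.

Lemma markov_iter D P n : markov_op D P -> markov_op D (iter n P).
Proof.
move=> [Pn PD PT]; elim: n => [|n [In ID IT]].
  have id_pos E x : E x -> posfun E (iter 0 P ^~ x).
    by move=> Ex; split => //= [f [_ f0]|f g _ _ fg]; [exact: f0|exact: fg].
  by split => // x; exact: id_pos.
split => [f hf|x Dx|x] /=; first exact/Pn/In.
- exact: (@posfun_comp D (P ^~ x) (iter n P) In IT ID (PD x Dx)).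
- exact: (@posfun_comp setT (P ^~ x) (iter n P) In IT (fun x _ => IT x) (PT x)).
Qed.

Section posfun_real.
Variables (D : set X) (L : (X -> \bar R) -> \bar R).
Hypothesis HL : posfun D L.

Lemma posfun_cst (k : R) : 0 <= k -> L (fun=> k%:E) = k%:E.
Proof.
move=> k0; have := posfunZ HL k0 (nnmf_cst (ler01 : 0 <= 1 :> R)).
by under eq_fun do rewrite -EFinM mulr1; rewrite (posfun1 HL) -EFinM mulr1.
Qed.

Lemma posfun_eq f g : nnmf f -> nnmf g -> (forall x, D x -> f x = g x) -> L f = L g.
Proof.
by move=> hf hg fg; apply/eqP; rewrite eq_le; apply/andP; split;
  apply: (posfun_le HL) => // x Dx; rewrite fg.
Qed.

Lemma posfun_le_cst f (k : R) : nnmf f -> 0 <= k ->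
  (forall x, D x -> (f x <= k%:E)%E) -> (L f <= k%:E)%E.
Proof. by move=> hf k0 fk; rewrite -(posfun_cst k0); apply: (posfun_le HL) => //; exact: nnmf_cst. Qed.

Lemma posfun_fin f (k : R) : nnmf f -> (L f <= k%:E)%E -> L f \is a fin_num.
Proof.
move=> hf fk; rewrite ge0_fin_numE; last exact: (posfun_ge0 HL).
by rewrite (le_lt_trans fk)// ltry.
Qed.

End posfun_real.

(* Integrating the inequality in both variables against the residual functionals
   [L1 - delta rho] and [L2 - delta rho] removes the common part from the additive
   constant; they are kept as differences of real numbers. *)
Lemma posfun_overlap D (L1 L2 rho : (X -> \bar R) -> \bar R) (delta A a1 a2 : R)
    (g V : X -> R) :
  posfun D L1 -> posfun D L2 -> posfun D rho -> 0 <= delta < 1 -> 0 <= A ->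
  (rho (EFin \o V) < +oo)%E ->
  (forall f, nnmf f -> (delta%:E * rho f <= L1 f)%E) ->
  (forall f, nnmf f -> (delta%:E * rho f <= L2 f)%E) ->
  measurable_fun setT g -> (forall x, 0 <= g x <= 1) ->
  measurable_fun setT V -> (forall x, 0 <= V x) ->
  (L1 (EFin \o V) <= a1%:E)%E -> (L2 (EFin \o V) <= a2%:E)%E ->
  (forall x y, D x -> D y -> g x <= g y + A + V x + V y) ->
  fine (L1 (EFin \o g)) <= fine (L2 (EFin \o g)) + (1 - delta) * A + a1 + a2.
Proof.
move=> H1 H2 Hr /andP[d0 d1] A0 rV m1 m2 mg g01 mV V0 La1 La2 osc.
have g0 x : 0 <= g x by case/andP: (g01 x).
have ng : nnmf (EFin \o g) by exact: nnmf_EFin.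
have nV : nnmf (EFin \o V) by exact: nnmf_EFin.
have gb L : posfun D L -> L (EFin \o g) \is a fin_num.
  move=> HL; apply: (posfun_fin HL (k := 1)) => //.
  by apply: (posfun_le_cst HL) => // x _; rewrite lee_fin; case/andP: (g01 x).
have V1f := posfun_fin H1 nV La1; have V2f := posfun_fin H2 nV La2.
have Vrf : rho (EFin \o V) \is a fin_num by rewrite ge0_fin_numE// (posfun_ge0 Hr).
have [[g1f g2f] grf] := (gb _ H1, gb _ H2, gb _ Hr).
move: La1 La2.
rewrite -(fineK V1f) -(fineK V2f) !lee_fin.
set l1 := fine (L1 (EFin \o V)); set l2 := fine (L2 (EFin \o V)) => la1 la2.
set G1 := fine (L1 (EFin \o g)); set G2 := fine (L2 (EFin \o g)).
pose Gr := fine (rho (EFin \o g)); pose lr := fine (rho (EFin \o V)).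
have step1 y : D y -> G1 - delta * Gr <= (1 - delta) * (g y + A + V y) + l1 - delta * lr.
  move=> Dy; pose c := g y + A + V y.
  have c0 : 0 <= c by rewrite /c !addr_ge0.
  (* The functionals are known only on functions that are nonnegative everywhere, hence the
     truncation; on [D] it does nothing, by [osc]. *)
  pose h x := Num.max 0 (c + V x - g x).
  have mh : measurable_fun setT h.
    apply: measurable_maxr; first exact: measurable_cst.
    by apply: measurable_funB => //; apply: measurable_funD => //; exact: measurable_cst.
  have nh : nnmf (EFin \o h) by apply: nnmf_EFin => // x; rewrite /h le_max lexx.
  have key L : posfun D L ->
      (L (EFin \o h) + L (EFin \o g) = c%:E + L (EFin \o V))%E.
    move=> HL; rewrite -(posfunD HL nh ng) -(posfun_cst HL c0).
    rewrite -(posfunD HL (nnmf_cst c0) nV).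
    apply: (posfun_eq HL); [exact: nnmfD|exact: (nnmfD (nnmf_cst c0))|].
    move=> x Dx; rewrite /= -!EFinD; congr EFin; rewrite /h max_r ?subrK//.
    by have := osc x y Dx Dy; rewrite /c subr_ge0; lra.
  have hf L : posfun D L -> L (EFin \o V) \is a fin_num -> L (EFin \o h) \is a fin_num.
    move=> HL VL; have := key _ HL.
    rewrite -(fineK (gb _ HL)) -(fineK VL) -EFinD => E.
    apply: (posfun_fin HL (k := c + fine (L (EFin \o V)))) => //.
    by rewrite -E leeDl// lee_fin fine_ge0// (posfun_ge0 HL).
  have := m1 _ nh; have := key _ H1; have := key _ Hr.
  rewrite -(fineK (hf _ H1 V1f)) -(fineK (hf _ Hr Vrf)) -(fineK g1f) -(fineK grf).
  rewrite -(fineK V1f) -(fineK Vrf) -!EFinD -EFinM lee_fin => -[E1] -[E2].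
  rewrite -/G1 -/Gr -/l1 -/lr in E1 E2 *.
  have -> : fine (rho (EFin \o h)) = c + lr - Gr by rewrite -E1 addrK.
  have -> : fine (L1 (EFin \o h)) = c + l1 - G1 by rewrite -E2 addrK.
  by rewrite -/c; lra.
pose a := G1 - delta * Gr - (1 - delta) * A - l1 + delta * lr.
suff : a <= G2 + l2 - delta * Gr - delta * lr.
  have lr0 : 0 <= delta * lr by rewrite mulr_ge0// fine_ge0// (posfun_ge0 Hr).
  by rewrite /a; lra.
have step2 y : D y -> a <= (1 - delta) * (g y + V y).
  by move=> Dy; have := step1 y Dy; rewrite /a; lra.
(* A constant [a <= 0] cannot be integrated as a nonnegative function, but then the minorization of
   [L2], taken at [g] and at [V], already gives the bound. *)
have [a0|a0] := leP a 0.
  apply: (le_trans a0); rewrite -/l2 -/G2.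
  have := m2 _ ng; have := m2 _ nV.
  rewrite -(fineK V2f) -(fineK g2f) -(fineK Vrf) -(fineK grf) -!EFinM !lee_fin.
  rewrite -/lr -/l2 -/Gr -/G2; lra.
pose h y := Num.max 0 ((1 - delta) * (g y + V y) - a).
have mh : measurable_fun setT h.
  apply: measurable_maxr; first exact: measurable_cst.
  apply: measurable_funB => //.
  by apply: measurable_funM => //; exact: measurable_funD.
have nh : nnmf (EFin \o h) by apply: nnmf_EFin => // x; rewrite /h le_max lexx.
have d1' : 0 <= 1 - delta by lra.
have key L : posfun D L ->
    (L (EFin \o h) + a%:E = (1 - delta)%:E * (L (EFin \o g) + L (EFin \o V)))%E.
  move=> HL; have ngV := nnmfD ng nV.
  rewrite -(posfunD HL ng nV) -(posfunZ HL d1' ngV).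
  have na := nnmf_cst (ltW a0).
  rewrite -(posfun_cst HL (ltW a0)) -(posfunD HL nh na).
  apply: (posfun_eq HL).
  - exact: nnmfD.
  - exact: nnmfZ.
  - move=> x Dx; rewrite /= -!EFinD -EFinM; congr EFin; rewrite /h max_r ?subrK//.
    by rewrite subr_ge0 step2.
have hE L : posfun D L -> L (EFin \o V) \is a fin_num ->
  L (EFin \o h) = ((1 - delta) * (fine (L (EFin \o g)) + fine (L (EFin \o V))) - a)%:E.
  move=> HL VL; have := key _ HL.
  rewrite -(fineK (gb _ HL)) -(fineK VL) -EFinD -EFinM => E.
  by rewrite EFinB -E addeK.
have := m2 _ nh; rewrite (hE _ H2 V2f) (hE _ Hr Vrf) -EFinM lee_fin.
rewrite -/G2 -/Gr -/l2 -/lr => E.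
have {}E : (1 - delta) * a <= (1 - delta) * (G2 + l2 - delta * Gr - delta * lr) by nra.
by move: E; rewrite ler_pM2l//; lra.
Qed.

End markov_operators.

(** * Subgeometric rates from a drift condition *)

Section subgeometric.
Context {d : measure_display} {X : measurableType d} {R : realType}.
Variables (D : set X) (P : (X -> \bar R) -> X -> \bar R) (V : X -> R) (c b beta : R).
Hypotheses (HP : markov_op D P) (mV : measurable_fun setT V) (V0 : forall x, 0 <= V x).
Hypotheses (c0 : 0 < c) (b0 : 0 <= b) (beta01 : 0 < beta < 1).
Hypothesis drift : forall x, D x -> (P (EFin \o V) x <= (V x - c * V x `^ beta + b)%:E)%E.
Hypothesis small : forall r : R, exists delta, exists2 rho : (X -> \bar R) -> \bar R,
  0 < delta < 1 /\ posfun D rho &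
  forall x, D x -> V x <= r -> forall f, nnmf f -> (delta%:E * rho f <= P f x)%E.

Let bge0 : 0 <= beta. Proof. by case/andP: beta01 => /ltW. Qed.
Let ble1 : beta <= 1. Proof. by case/andP: beta01 => _ /ltW. Qed.

Lemma powR_le_base1 (A u : R) : 1 <= A -> 0 <= u -> (A * u) `^ beta <= A * u `^ beta.
Proof.
move=> A1 u0; have A0 : 0 <= A by apply: le_trans A1.
rewrite powRM// ler_wpM2r ?powR_ge0//.
by rewrite -[leRHS](powRr1 A0) ler_powR.
Qed.

Lemma powR_addr_le (u v : R) : 0 <= u -> 0 <= v ->
  (u + v) `^ beta <= 2 * (u `^ beta + v `^ beta).
Proof.
wlog le_vu : u v / v <= u.
  move=> H u0 v0; have [h|/ltW h] := leP v u; first exact: H.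
  by rewrite addrC [X in _ <= 2 * X]addrC; exact: H.
move=> u0 v0; apply: (@le_trans _ _ ((2 * u) `^ beta)).
  by apply: ge0_ler_powR; rewrite ?nnegrE//; lra.
apply: (le_trans (powR_le_base1 _ u0)); first lra.
by rewrite ler_pM2l// lerDl powR_ge0.
Qed.

(** The constant [A] is what the minorization acts on: where [V x + V y <= r], the common part
    [delta rho] takes [delta * A] off it, more than the [2 * b] that the drift may lose; elsewhere
    the drift alone pays. Hence the order of choice: [r] from the drift, [delta] from [r], [A] from
    [delta], and [eps] last. *)
Lemma drift_contraction : exists A eps, [/\ 1 <= A, 0 < eps &
  forall (s : R) (g : X -> R), 0 <= s -> measurable_fun setT g ->
  (forall x, 0 <= g x <= 1) ->
  (forall x y, D x -> D y -> g x <= g y + s * (A + V x + V y)) ->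
  forall x y, D x -> D y ->
  fine (P (EFin \o g) x) <= fine (P (EFin \o g) y) +
    s * (A + V x + V y - eps * (A + V x + V y) `^ beta)].
Proof.
have [cp bp] := (c0, b0).
(* Beyond [r], [c * u^beta >= 8 * b]. Splitting [u = V x + V y] costs a factor 2 ([powR_addr_le]),
   so the drift at the two points is worth [c / 2 * u^beta]: one half of this pays [2 * b], the
   other half covers the [eps] term. *)
pose r := (8 * b / c) `^ (beta^-1) + 1.
have r1 : 1 <= r by rewrite /r lerDr powR_ge0.
have cr u : r <= u -> 8 * b <= c * u `^ beta.
  move=> ru; rewrite [leRHS]mulrC -ler_pdivrMr//.
  have bn0 : beta != 0 by case/andP: beta01 => /lt0r_neq0.
  have -> : 8 * b / c = ((8 * b / c) `^ beta^-1) `^ beta.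
    by rewrite -powRrM mulVf// powRr1// divr_ge0 ?mulr_ge0// ltW.
  apply: ge0_ler_powR; rewrite ?nnegrE ?powR_ge0//; first lra.
  by apply: le_trans ru; rewrite /r lerDl.
have [delta [rho [/andP[d0 d1] Hr] minor]] := small r.
have [A A1 dA] : exists2 A, 1 <= A & 2 * b + 1 <= delta * A.
  exists ((2 * b + 1) / delta + 1).
    by rewrite lerDr; apply: divr_ge0; [lra|exact: ltW].
  by rewrite mulrDr mulr1 mulrCA mulfV ?lt0r_neq0// mulr1 lerDl ltW.
have A0 : 0 <= A by lra.
(* One bound per regime: [(A + r)^-1] keeps the [eps] term below 1 when [u <= r], the other keeps it
   below [c / 4 * u^beta] when [u > r]. *)
pose eps := Num.min (c / (4 * (A + 1))) (A + r)^-1.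
have A10 : 0 < 4 * (A + 1) by lra.
have Ar0 : 0 < A + r by lra.
exists A, eps; split => //; first by rewrite /eps lt_min divr_gt0//= invr_gt0.
move=> s g s0 mg g01 osc x y Dx Dy.
have ng : nnmf (EFin \o g) by apply: nnmf_EFin => // z; case/andP: (g01 z).
have nV : nnmf (EFin \o V) by exact: nnmf_EFin.
have msV : measurable_fun setT (fun z => s * V z) by exact: measurable_funM.
have sV0 z : 0 <= s * V z by rewrite mulr_ge0.
have PsV z (Dz : D z) : (P (EFin \o (fun z => s * V z)%R) z <=
    (s * (V z - c * V z `^ beta + b))%:E)%E.
  have -> : EFin \o (fun z => s * V z) = (fun z => s%:E * (EFin \o V) z)%E.
    by apply/funext => u; rewrite /= EFinM.
  rewrite (posfunZ (markov_on HP Dz))// EFinM.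
  by apply: lee_wpmul2l; rewrite ?lee_fin// drift.
have osc' u v : D u -> D v -> g u <= g v + s * A + s * V u + s * V v.
  by move=> Du Dv; have := osc u v Du Dv; lra.
have sA0 : 0 <= s * A by rewrite mulr_ge0.
set u := V x + V y.
have u0 : 0 <= u by rewrite addr_ge0.
have wE : A + V x + V y = A + u by rewrite /u; lra.
rewrite wE.
have [ur|ur] := leP u r.
- have Vxr : V x <= r by apply: le_trans ur; rewrite lerDl.
  have Vyr : V y <= r by apply: le_trans ur; rewrite lerDr.
  have rV : (rho (EFin \o (fun z => s * V z)%R) < +oo)%E.
    have nsV := nnmf_EFin msV sV0.
    have h := le_trans (minor x Dx Vxr _ nsV) (PsV x Dx).
    have rge0 := posfun_ge0 Hr nsV; move: h rge0.
    by case: (rho _) => [q|//|//] //; rewrite ?ltry// mulry gtr0_sg// mul1e leye_eq.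
  apply: (le_trans (posfun_overlap (markov_on HP Dx) (markov_on HP Dy) Hr _ sA0 rV
    (minor x Dx Vxr) (minor y Dy Vyr) mg g01 msV sV0 (PsV x Dx) (PsV y Dy) osc')).
    by rewrite (ltW d0) d1.
  set G := fine (P _ y).
  have -> : G + (1 - delta) * (s * A) + s * (V x - c * V x `^ beta + b) +
     s * (V y - c * V y `^ beta + b) =
     G + s * ((1 - delta) * A + u + 2 * b - c * V x `^ beta - c * V y `^ beta).
    by rewrite /u; ring.
  rewrite lerD2l; apply: ler_wpM2l => //.
  have e1 : eps * (A + u) `^ beta <= 1.
    have : eps <= (A + r)^-1 by rewrite /eps ge_min lexx orbT.
    have : (A + u) `^ beta <= A + r.
      have Au1 : 1 <= A + u by lra.
      apply: (@le_trans _ _ ((A + u) `^ 1)); first exact: ler_powR.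
      by rewrite powRr1; lra.
    move=> h1 h2; apply: (@le_trans _ _ ((A + r)^-1 * (A + r))).
      apply: ler_pM => //; last exact: powR_ge0.
      by rewrite /eps le_min invr_ge0 (ltW Ar0) andbT divr_ge0// ltW.
    by rewrite mulVf ?lt0r_neq0.
  have := mulr_ge0 (ltW c0) (powR_ge0 (V x) beta).
  have := mulr_ge0 (ltW c0) (powR_ge0 (V y) beta).
  lra.
(* Large [u]: the same estimate with [delta = 0], where any functional integrating [V] can stand for
   [rho]. *)
- have Hx := markov_on HP Dx.
  have rV : (P (EFin \o (fun z => s * V z)%R) x < +oo)%E.
    by apply: (le_lt_trans (PsV x Dx)); rewrite ltry.
  have nn0 z f : D z -> nnmf f -> (0%:E * P (EFin \o (fun z => s * V z)%R) x <= 0)%E.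
    by rewrite mul0e.
  have m0 z (Dz : D z) f : nnmf f -> (0%:E * P f x <= P f z)%E.
    by move=> nf; rewrite mul0e; exact: (posfun_ge0 (markov_on HP Dz)).
  apply: (le_trans (posfun_overlap (delta := 0) Hx (markov_on HP Dy) Hx _ sA0 rV
    (m0 x Dx) (m0 y Dy) mg g01 msV sV0 (PsV x Dx) (PsV y Dy) osc')).
    by rewrite lexx ltr01.
  set G := fine (P _ y).
  have -> : G + (1 - 0) * (s * A) + s * (V x - c * V x `^ beta + b) +
     s * (V y - c * V y `^ beta + b) =
     G + s * (A + u + 2 * b - c * (V x `^ beta + V y `^ beta)).
    by rewrite /u; ring.
  rewrite lerD2l; apply: ler_wpM2l => //.
  have e1 : eps * (A + u) `^ beta <= c / 4 * u `^ beta.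
    have : (A + u) `^ beta <= (A + 1) * u `^ beta.
      apply: (@le_trans _ _ (((A + 1) * u) `^ beta)).
        by apply: ge0_ler_powR; rewrite ?nnegrE//; nra.
      by apply: powR_le_base1 => //; lra.
    move=> h1; apply: (@le_trans _ _ (c / (4 * (A + 1)) * ((A + 1) * u `^ beta))).
      apply: ler_pM => //; last by rewrite /eps ge_min lexx.
        by rewrite /eps le_min invr_ge0 (ltW Ar0) andbT divr_ge0// ltW.
      exact: powR_ge0.
    rewrite invfM mulrA -!mulrA (mulrA (A + 1)^-1) mulVf ?mul1r//.
    by rewrite lt0r_neq0//; lra.
  have e2 : u `^ beta <= 2 * (V x `^ beta + V y `^ beta) by exact: powR_addr_le.
  have := cr u (ltW ur); have := ler_wpM2l (ltW c0) e2.
  lra.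
Qed.

(** From [ln (1 + 1 / a) <= 1 / a]. With [a = n + 1], the ratio of consecutive rates [(n + 1)^(-q)]
    is at least [1 - q / (n + 1)], so a contraction by that factor keeps up with them. *)
Lemma powR_ratio_ge (q a : R) : 0 < a -> 0 <= q -> 1 - q / a <= (a / (a + 1)) `^ q.
Proof.
move=> a0 q0; have a10 : 0 < a + 1 by lra.
rewrite /powR gt_eqF ?divr_gt0//; apply: le_trans (expR_ge1Dx _).
have -> : a / (a + 1) = (1 + a^-1)^-1 by field; lra.
rewrite lnV ?posrE; last by rewrite addr_gt0// invr_gt0.
rewrite mulrN lerD2l lerN2 ler_wpM2l// le_ln1Dx//.
by apply: lt_trans (_ : 0 < _); rewrite ?invr_gt0// ltrN10.
Qed.

Lemma powRK (u q : R) : 0 <= u -> q != 0 -> (u `^ q) `^ q^-1 = u.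
Proof. by move=> u0 q0; rewrite -powRrM mulfV// powRr1. Qed.

(** Induction on [n] with the oscillation constant [s = C * (n + 1)^(-q)]. If
    [C * (n + 2)^(-q) * w >= 1], the next bound is trivial, all values being in [0, 1]. Otherwise
    [w] is small enough for [eps * w^beta] to be at least the fraction [q / (n + 1)] of [w] that the
    next rate requires. *)
Theorem subgeometric_osc : exists A C, [/\ 1 <= A, 0 < C &
  forall g : X -> R, measurable_fun setT g -> (forall x, 0 <= g x <= 1) ->
  forall n x y, D x -> D y ->
  fine (iter n P (EFin \o g) x) <= fine (iter n P (EFin \o g) y) +
    C * n.+1%:R `^ (- (1 - beta)^-1) * (A + V x + V y)].
Proof.
have [A [eps [A1 eps0 Hc]]] := drift_contraction.
have [bp b1] := andP beta01.
set q := (1 - beta)^-1.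
have q0 : 0 < q by rewrite invr_gt0; lra.
have qb : q^-1 = 1 - beta by rewrite invrK.
clearbody q.
(* This value makes [eps * C^(1/q) >= 2 * q]; the 2 absorbs [n + 2 <= 2 * (n + 1)]. *)
pose C := Num.max 1 ((2 * q / eps) `^ q).
have C1 : 1 <= C by rewrite le_max lexx.
have C0 : 0 < C by lra.
have epsC : 2 * q <= eps * C `^ q^-1.
  rewrite [leRHS]mulrC -ler_pdivrMr//.
  have h : 0 <= 2 * q / eps by rewrite divr_ge0 ?mulr_ge0 ?ltW.
  rewrite -[leLHS](powRK h (lt0r_neq0 q0)).
  apply: ge0_ler_powR; rewrite ?nnegrE ?powR_ge0 ?invr_ge0 ?(ltW q0) ?(ltW C0)//.
  by rewrite le_max lexx orbT.
exists A, C; split => // g mg g01.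
pose gn n x := fine (iter n P (EFin \o g) x).
have ng : nnmf (EFin \o g) by apply: nnmf_EFin => // z; case/andP: (g01 z).
have Pg1 n x : (iter n P (EFin \o g) x <= 1%:E)%E.
  apply: (posfun_le_cst (markov_T (markov_iter n HP) x)) => // z _.
  by rewrite lee_fin; case/andP: (g01 z).
have gnE n : EFin \o gn n = iter n P (EFin \o g).
  apply/funext => x; rewrite /= fineK//.
  exact: (posfun_fin (markov_T (markov_iter n HP) x) ng (Pg1 n x)).
have gn01 n x : 0 <= gn n x <= 1.
  rewrite -!lee_fin (_ : (gn n x)%:E = (EFin \o gn n) x)// gnE Pg1 andbT.
  exact: (posfun_ge0 (markov_T (markov_iter n HP) x)).
have mgn n : measurable_fun setT (gn n).
  by apply/measurable_EFinP; rewrite gnE; case: (markov_nn (markov_iter n HP) ng).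
move=> n; rewrite -/(gn n); elim: n => [|n IH] x y Dx Dy.
  have := gn01 0%N x; have := gn01 0%N y; have := V0 x; have := V0 y.
  rewrite powR1 mulr1 => Vy Vx gy gx.
  have : 1 <= C * (A + V x + V y) by apply: mulr_ege1 => //; lra.
  by move: gy gx => /andP[+ _] /andP[_ +]; rewrite /gn /=; lra.
set w := A + V x + V y.
have w1 : 1 <= w by have := V0 x; have := V0 y; rewrite /w; lra.
have w0 : 0 < w by lra.
have [triv|ntriv] := leP 1 (C * n.+2%:R `^ (- q) * w).
  have := gn01 n.+1 x; have := gn01 n.+1 y.
  by rewrite /gn => /andP[+ _] /andP[_ +]; lra.
have s0 : 0 <= C * n.+1%:R `^ (- q) by rewrite mulr_ge0 ?powR_ge0// ltW.
have := Hc _ _ s0 (mgn n) (gn01 n) IH x y Dx Dy.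
rewrite gnE -/w => /le_trans; apply; rewrite lerD2l.
have n10 : 0 < n.+1%:R :> R by rewrite ltr0n.
have n20 : 0 < n.+2%:R :> R by rewrite ltr0n.
(* [w < (n+2)^q / C] turns [w^beta = w / w^(1/q)] into a multiple of [w / (n+2)] *)
have wb : w `^ beta = w / w `^ q^-1.
  rewrite qb -[X in X / _]powRr1 ?ltW// -powRB; first by congr (_ `^ _); lra.
  by apply/implyP => _; rewrite gt_eqF.
have wq : w `^ q^-1 * C `^ q^-1 <= n.+2%:R.
  rewrite -powRM ?(ltW w0) ?(ltW C0)// -[leRHS](powRK (ltW n20) (lt0r_neq0 q0)).
  apply: ge0_ler_powR; rewrite ?nnegrE ?powR_ge0 ?invr_ge0 ?mulr_ge0 ?(ltW w0) ?(ltW C0) ?(ltW q0)//.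
  move: ntriv; rewrite powRN mulrAC ltr_pdivrMr ?powR_gt0// mul1r mulrC => /ltW.
  by [].
have h1 : 1 - eps / w `^ q^-1 <= 1 - q / n.+1%:R.
  rewrite lerD2l lerN2 ler_pdivrMr//  mulrAC ler_pdivlMr ?powR_gt0//.
  have : n.+2%:R <= 2 * n.+1%:R :> R.
    by have : 1 <= n.+1%:R :> R; [rewrite ler1n|rewrite -(natr1 n.+1); lra].
  have wp : 0 < w `^ q^-1 by rewrite powR_gt0.
  have Cp : 0 < C `^ q^-1 by rewrite powR_gt0.
  move=> h2; rewrite -(ler_pM2r Cp).
  apply: (@le_trans _ _ (q * n.+2%:R)); first by rewrite -mulrA ler_wpM2l// ltW.
  apply: (@le_trans _ _ (2 * q * n.+1%:R)); first by rewrite -[leRHS]mulrA mulrCA ler_pM2l.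
  by rewrite [leRHS]mulrAC ler_pM2r.
have h2 := powR_ratio_ge n10 (ltW q0).
rewrite natr1 powRM ?invr_ge0 ?(ltW n10) ?(ltW n20)// in h2.
have iE : n.+2%:R^-1 `^ q = n.+2%:R `^ (- q) :> R.
  by rewrite -powR_inv1 ?ltW// -powRrM mulN1r.
rewrite iE in h2.
have n1q : n.+1%:R `^ (- q) * n.+1%:R `^ q = 1 :> R.
  by rewrite powRN mulVf// gt_eqF// powR_gt0.
rewrite wb -!mulrA ler_pM2l//.
have -> : w - eps * (w / w `^ q^-1) = (1 - eps / w `^ q^-1) * w by ring.
rewrite mulrA ler_pM2r//.
apply: (@le_trans _ _ (n.+1%:R `^ (- q) * (n.+1%:R `^ q * n.+2%:R `^ (- q)))).
  by rewrite ler_pM2l ?powR_gt0//; exact: le_trans h2.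
by rewrite mulrA n1q mul1r.
Qed.

End subgeometric.

(** * The uniformized energy exchange chain *)

Section line_functionals.
Context {R : realType}.
Local Notation mR := (measurableTypeR R).
Local Notation leb := (@lebesgue_measure R).

Definition wint (D : set mR) (k : mR -> R) (g : mR -> \bar R) : \bar R :=
  (\int[leb]_(y in D) ((k y)%:E * g y))%E.

Section wint.
Variables (D D0 : set mR) (k : mR -> R).
Hypotheses (mD : measurable D) (mD0 : measurable D0) (mk : measurable_fun setT k)
  (k0 : forall y, 0 <= k y).
Hypothesis DD0 : forall g : mR -> \bar R, measurable_fun setT g ->
  (\int[leb]_(y in D) g y = \int[leb]_(y in D0) g y)%E.
Hypothesis k1 : (\int[leb]_(y in D) (k y)%:E = 1%:E)%E.

Let nnk (f : mR -> \bar R) : nnmf f -> nnmf (fun y => (k y)%:E * f y)%E.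
Proof.
move=> [mf f0]; split; first by apply: emeasurable_funM => //; exact/measurable_EFinP.
by move=> y; rewrite mule_ge0// lee_fin.
Qed.

(** In both uses [D0] is the interior of [D]: inequalities are then needed only at interior values
    of the share and of the bath energy, and these keep the state in the open orthant. *)
Lemma wint_posfun : posfun D0 (wint D k).
Proof.
split => [f nf|f g nf ng|a f a0 nf||f g nf ng fg].
- by apply: integral_ge0 => y _; case: (nnk nf).
- have [mf f0] := nnk nf; have [mg g0] := nnk ng.
  rewrite /wint -ge0_integralD//; try by apply: measurable_funTS.
  by apply: eq_integral => y _; rewrite ge0_muleDr//; [case: nf|case: ng].
- have [mf f0] := nnk nf.
  rewrite /wint -ge0_integralZl_EFin//; last exact: measurable_funTS.
  by apply: eq_integral => y _; rewrite muleCA.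
- by rewrite /wint; under eq_integral do rewrite -EFinM mulr1.
- have [mf f0] := nnk nf; have [mg g0] := nnk ng.
  rewrite /wint !DD0//; apply: ge0_le_integral => //; try exact: measurable_funTS.
  by move=> y Dy; rewrite lee_wpmul2l ?lee_fin ?fg.
Qed.

(** Tonelli on the whole line, after the domain of integration has been moved into the density. *)
Lemma wint_nnmf d (Z : measurableType d) (f : Z * mR -> \bar R) :
  nnmf f -> nnmf (fun z => wint D k (fun y => f (z, y))).
Proof.
move=> [mf f0]; split; last first.
  by move=> z; apply: integral_ge0 => y _; rewrite mule_ge0 ?lee_fin.
have -> : (fun z => wint D k (fun y => f (z, y))) =
    (fun z => \int[leb]_y (((k \_ D) y)%:E * f (z, y)))%E.
  apply/funext => z; rewrite /wint integral_mkcond; apply: eq_integral => y _.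
  by rewrite !patchE; case: ifP; rewrite ?mul0e.
apply: (measurable_fun_fubini_tonelli_F (m2 := leb)
  (fun zy => ((k \_ D) zy.2)%:E * f zy)%E).
  apply: emeasurable_funM => //; apply/measurable_EFinP.
  apply: measurableT_comp (measurable_snd) => //.
  by apply/measurable_restrict => //; exact: measurable_funTS.
by move=> [z y]; rewrite mule_ge0 ?lee_fin// patchE; case: ifP.
Qed.

End wint.

Lemma EunifE (g : R -> \bar R) : Eunif g = wint `[0%R, 1%R] (fun=> 1) g.
Proof. by apply: eq_integral => y _; rewrite mul1e. Qed.

Lemma Eunif_posfun : posfun (`]0, 1[ : set mR) (@Eunif R).
Proof.
have -> : @Eunif R = wint `[0%R, 1%R] (fun=> 1) by apply/funext => g; exact: EunifE.
apply: wint_posfun => //.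
  by move=> g mg; rewrite integral_itv_bndoo//; exact: measurable_funTS.
by rewrite integral_cst//= lebesgue_measure_itv/= lte_fin ltr01 oppr0 adde0 mule1.
Qed.

Lemma Eunif_nnmf d (Z : measurableType d) (f : Z * mR -> \bar R) :
  nnmf f -> nnmf (fun z => Eunif (fun y => f (z, y))).
Proof.
move=> nf; have -> : (fun z => Eunif (fun y => f (z, y))) =
  (fun z => wint `[0%R, 1%R] (fun=> 1) (fun y => f (z, y))).
  by apply/funext => z; exact: EunifE.
exact: wint_nnmf.
Qed.

Section Eexp.
Variable T : R.
Hypothesis T0 : 0 < T.

Definition expdens (y : mR) : R := T^-1 * expR (- (y / T)).

Lemma expdens_ge0 y : 0 <= expdens y.
Proof. by rewrite mulr_ge0 ?expR_ge0// invr_ge0 ltW. Qed.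

Lemma measurable_expdens : measurable_fun setT expdens.
Proof.
apply: measurable_funM => //; apply: measurableT_comp => //.
by apply: measurableT_comp => //; exact: measurable_funM.
Qed.

Lemma integral_expdens : (\int[leb]_(y in `[0%R, +oo[) (expdens y)%:E = 1%:E)%E.
Proof.
have T10 : 0 < T^-1 by rewrite invr_gt0.
rewrite -(integral_exponential_pdf T10) integral_mkcond.
apply: eq_integral => y _; rewrite /exponential_pdf !patchE.
by case: ifP => // _; rewrite /expdens mulNr (mulrC y).
Qed.

Lemma Eexp_posfun : posfun (`]0, +oo[ : set mR) (@Eexp R T).
Proof.
apply: (@wint_posfun `[0, +oo[ `]0, +oo[ expdens) => //.
- exact: measurable_expdens.
- exact: expdens_ge0.
- by move=> g mg; rewrite integral_itv_obnd_cbnd//; exact: measurable_funTS.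
- exact: integral_expdens.
Qed.

Lemma Eexp_nnmf d (Z : measurableType d) (f : Z * mR -> \bar R) :
  nnmf f -> nnmf (fun z => Eexp T (fun y => f (z, y))).
Proof. by apply: wint_nnmf => //; [exact: measurable_expdens|exact: expdens_ge0]. Qed.

End Eexp.

End line_functionals.

Section posfun_combinations.
Context {d : measure_display} {X : measurableType d} {R : realType}.
Variable D : set X.

Lemma posfun_map d' (Y : measurableType d') (E : set Y) (L : (Y -> \bar R) -> \bar R)
    (Phi : Y -> X) : measurable_fun setT Phi -> (forall y, E y -> D (Phi y)) ->
  posfun E L -> posfun D (fun f => L (f \o Phi)).
Proof.
move=> mPhi ED HL.
have nP (f : X -> \bar R) : nnmf f -> nnmf (f \o Phi).
  by move=> [mf f0]; split => [|y]; [exact: measurableT_comp|exact: f0].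
split => [f nf|f g nf ng|k f k0 nf||f g nf ng fg].
- exact: (posfun_ge0 HL (nP _ nf)).
- exact: (posfunD HL (nP _ nf) (nP _ ng)).
- exact: (posfunZ HL k0 (nP _ nf)).
- exact: (posfun1 HL).
- by apply: (posfun_le HL (nP _ nf) (nP _ ng)) => y Ey; apply: fg; exact: ED.
Qed.

Lemma posfun_mix (I : finType) (w : I -> R) (L : I -> (X -> \bar R) -> \bar R) :
  (forall i, 0 <= w i) -> \sum_i w i = 1 -> (forall i, posfun D (L i)) ->
  posfun D (fun f => \sum_i (w i)%:E * L i f)%E.
Proof.
move=> w0 w1 HL; split => [f nf|f g nf ng|k f k0 nf||f g nf ng fg].
- by apply: sume_ge0 => i _; rewrite mule_ge0 ?lee_fin// (posfun_ge0 (HL i)).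
- rewrite -big_split/=; apply: eq_bigr => i _.
  by rewrite (posfunD (HL i))// ge0_muleDr// (posfun_ge0 (HL i)).
- rewrite ge0_sume_distrr; last first.
    by move=> i _; rewrite mule_ge0 ?lee_fin// (posfun_ge0 (HL i)).
  by apply: eq_bigr => i _; rewrite (posfunZ (HL i))// muleCA.
- transitivity ((\sum_i w i)%:E); last by rewrite w1.
  rewrite -sumEFin; apply: eq_bigr => i _.
  by rewrite (posfun1 (HL i)) mule1.
- by apply: lee_sum => i _; rewrite lee_wpmul2l ?lee_fin// (posfun_le (HL i)).
Qed.

End posfun_combinations.

Lemma posfun_prod {d1 d2 : measure_display} {X1 : measurableType d1}
    {X2 : measurableType d2} {R : realType} (D1 : set X1) (D2 : set X2)
    (L1 : (X1 -> \bar R) -> \bar R) (L2 : (X2 -> \bar R) -> \bar R) :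
  posfun D1 L1 -> posfun D2 L2 ->
  (forall h : X1 * X2 -> \bar R, nnmf h -> nnmf (fun x => L2 (fun y => h (x, y)))) ->
  posfun (D1 `*` D2) (fun h : X1 * X2 -> \bar R => L1 (fun x => L2 (fun y => h (x, y)))).
Proof.
move=> H1 H2 nn.
have sec (h : X1 * X2 -> \bar R) x : nnmf h -> nnmf (fun y => h (x, y)).
  by move=> [mh h0]; split => //; apply: measurableT_comp mh _; exact: measurable_pair1.
split => [f nf|f g nf ng|k f k0 nf||f g nf ng fg].
- exact: (posfun_ge0 H1 (nn _ nf)).
- rewrite -(posfunD H1 (nn _ nf) (nn _ ng)); congr L1; apply/funext => x.
  exact: (posfunD H2 (sec _ x nf) (sec _ x ng)).
- rewrite -(posfunZ H1 k0 (nn _ nf)); congr L1; apply/funext => x.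
  exact: (posfunZ H2 k0 (sec _ x nf)).
- by rewrite -[RHS](posfun1 H1); congr L1; apply/funext => x; exact: (posfun1 H2).
- apply: (posfun_le H1 (nn _ nf) (nn _ ng)) => x Dx.
  by apply: (posfun_le H2 (sec _ x nf) (sec _ x ng)) => y Dy; exact: fg.
Qed.

(** * The chain as a mixture of moves, one per edge *)

Section energy_exchange.
Context {R : realType} {N : nat}.
Variables (TL TR K : R).
Hypotheses (N0 : (0 < N)%N) (TL0 : 0 < TL) (TR0 : 0 < TR) (K1 : 1 <= K).
Local Notation X := (N.-tuple R).
Local Notation mR := (measurableTypeR R).
Implicit Types (x : X) (f : X -> \bar R).

(** Open, unlike [Rplus_orthant]: every move keeps it almost surely, and the measures of [M_eta]
    charge nothing else ([M_eta_moment]). *)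
Definition orthant : set X := [set x | forall i, 0 < tnth x i].

Lemma E_tnth x (i : 'I_N) : E x i = tnth x i.
Proof. by rewrite /E (tnth_nth 0). Qed.

Lemma E_upd1 x k a j : (j < N)%N -> E (upd1 x k a) j = if j == k then a else E x j.
Proof. by move=> jN; rewrite (E_tnth _ (Ordinal jN)) tnth_mktuple -E_tnth. Qed.

Lemma E_upd2 x k a b j : (j < N)%N ->
  E (upd2 x k a b) j = if j == k then a else if j == k.+1 then b else E x j.
Proof. by move=> jN; rewrite (E_tnth _ (Ordinal jN)) tnth_mktuple -E_tnth. Qed.

Lemma orthantP x : orthant x <-> forall j, (j < N)%N -> 0 < E x j.
Proof.
split=> [Dx j jN|H i]; first by rewrite (E_tnth _ (Ordinal jN)).
by rewrite -E_tnth; exact: H.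
Qed.

(* The baths are extra sites [0] and [N.+1] of fixed energies [TL] and [TR], so that
   every clock sits on an edge [(k, k.+1)] with [k <= N]; site [k.+1] carries [E x k] *)
Definition site x k : R := if k == 0%N then TL else if (k <= N)%N then E x k.-1 else TR.

Definition erate x k : R := rate K (site x k) (site x k.+1).

Definition move k f x : \bar R :=
  if k == 0%N then
    Eunif (fun p => Eexp TL (fun y => f (upd1 x 0 (p * (E x 0 + y)))))
  else if k == N then
    Eunif (fun p => Eexp TR (fun y => f (upd1 x N.-1 (p * (E x N.-1 + y)))))
  else
    Eunif (fun p => f (upd2 x k.-1 (p * (E x k.-1 + E x k))
                                   ((1 - p) * (E x k.-1 + E x k)))).

Lemma lam_gt0 : 0 < lam N K.
Proof. by rewrite mulr_gt0// lt_neqAle; have : 1 <= K by []; lra. Qed.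

Lemma rate_ge0 (a b : R) : 0 <= rate K a b.
Proof. by rewrite /rate le_min sqrtr_ge0 andbT; have : 1 <= K by []; lra. Qed.

Lemma rate_leK (a b : R) : rate K a b <= K.
Proof. by rewrite /rate ge_min lexx. Qed.

Lemma sum_edges {V : nmodType} (F : nat -> V) :
  \sum_(k < N.+1) F k = \sum_(k < N.-1) F k.+1 + F 0%N + F N.
Proof.
case: N N0 => // n _ /=; rewrite big_ord_recr big_ord_recl /= (addrC (F 0%N)).
by [].
Qed.

Lemma sume_edges (F : nat -> \bar R) :
  (\sum_(k < N.+1) F k = \sum_(k < N.-1) F k.+1 + F 0%N + F N)%E.
Proof. exact: sum_edges. Qed.

Lemma site_in x k : (0 < k)%N -> (k <= N)%N -> site x k = E x k.-1.
Proof. by case: k => // k _ kN; rewrite /site kN. Qed.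

Lemma total_rateE x : total_rate TL TR K x = \sum_(k < N.+1) erate x k.
Proof.
rewrite sum_edges /total_rate; congr (_ + _ + _).
- apply: eq_bigr => k _; have kN := ltn_ord k.
  by rewrite /erate !site_in//; lia.
- by rewrite /erate [site x 1]site_in.
- by rewrite /erate site_in// /site ltnn.
Qed.

Lemma QopE f x : Qop TL TR K f x =
  ((1 - (\sum_(k < N.+1) erate x k) / lam N K)%:E * f x +
   \sum_(k < N.+1) (erate x k / lam N K)%:E * move k f x)%E.
Proof.
rewrite /Qop total_rateE (sume_edges (fun k => (erate x k / lam N K)%:E * move k f x)%E) !addeA.
have N1 : (0 < N)%N := N0.
congr (_ + _ + _ + _)%E.
- apply: eq_bigr => k _; have kN := ltn_ord k.
  rewrite /erate !site_in ?/move; [|lia..].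
  by have -> : (k.+1 == N) = false by lia.
- by rewrite /erate [site x 1]site_in.
- rewrite /erate site_in// [site x N.+1]/site ltnn/= /move.
  by rewrite (gtn_eqF N1) eqxx.
Qed.

Lemma erate_sum_le x : \sum_(k < N.+1) erate x k <= lam N K.
Proof.
rewrite /lam mulr_natl -[N.+1 in leRHS]card_ord -sumr_const.
by apply: ler_sum => k _; exact: rate_leK.
Qed.

Lemma measurable_E k : measurable_fun setT (fun x : X => E x k).
Proof.
have [kN|kN] := ltnP k N; last first.
  rewrite (_ : (fun x => _) = fun=> 0)//; apply/funext => x.
  by rewrite /E nth_default// size_tuple.
rewrite (_ : (fun x => _) = (fun x => tnth x (Ordinal kN))); first exact: measurable_tnth.
by apply/funext => x; rewrite -E_tnth.
Qed.

Lemma measurable_site k : measurable_fun setT (fun x : X => site x k).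
Proof.
rewrite /site; case: (k == _); first exact: measurable_cst.
by case: leqP => _; [exact: measurable_E|exact: measurable_cst].
Qed.

Lemma measurable_upd1 d (Z : measurableType d) (u : Z -> X) k (a : Z -> R) :
  measurable_fun setT u -> measurable_fun setT a ->
  measurable_fun setT (fun z => upd1 (u z) k (a z)).
Proof.
move=> mu ma; apply/measurable_fun_tnthP => i.
rewrite (_ : _ \o _ = fun z => if (i : nat) == k then a z else tnth (u z) i).
  case: (nat_of_ord i == k) => //.
  exact: (measurableT_comp (measurable_tnth i) mu).
by apply/funext => z; rewrite /= tnth_mktuple.
Qed.

Lemma measurable_upd2 d (Z : measurableType d) (u : Z -> X) k (a b : Z -> R) :
  measurable_fun setT u -> measurable_fun setT a -> measurable_fun setT b ->
  measurable_fun setT (fun z => upd2 (u z) k (a z) (b z)).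
Proof.
move=> mu ma mb; apply/measurable_fun_tnthP => i.
rewrite (_ : _ \o _ = fun z => if (i : nat) == k then a z else
   if (i : nat) == k.+1 then b z else tnth (u z) i).
  case: (nat_of_ord i == k) => //; case: (nat_of_ord i == k.+1) => //.
  exact: (measurableT_comp (measurable_tnth i) mu).
by apply/funext => z; rewrite /= tnth_mktuple.
Qed.

Let bath_map k : X * mR * mR -> X :=
  fun z => upd1 z.1.1 k (z.1.2 * (E z.1.1 k + z.2)).

Let exch_map k : X * mR -> X := fun z =>
  upd2 z.1 k.-1 (z.2 * (E z.1 k.-1 + E z.1 k)) ((1 - z.2) * (E z.1 k.-1 + E z.1 k)).

Let measurable_bath_map k : measurable_fun setT (bath_map k).
Proof.
have m11 : measurable_fun setT (fun z : X * mR * mR => z.1.1).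
  exact: measurableT_comp.
apply: measurable_upd1 => //; apply: measurable_funM; first exact: measurableT_comp.
by apply: measurable_funD => //; exact: (measurableT_comp (measurable_E k) m11).
Qed.

Let measurable_exch_map k : measurable_fun setT (exch_map k).
Proof.
have mS : measurable_fun setT (fun z : X * mR => E z.1 k.-1 + E z.1 k).
  by apply: measurable_funD; apply: (measurableT_comp (measurable_E _)).
apply: measurable_upd2 => //; apply: measurable_funM => //.
exact: measurable_funB.
Qed.

Lemma move_nnmf k f : nnmf f -> nnmf (move k f).
Proof.
move=> [mf f0].
have nb T j : 0 < T -> nnmf (fun x : X => Eunif (fun p => Eexp T (fun y =>
    f (upd1 x j (p * (E x j + y)))))).
  move=> T0; apply: (Eunif_nnmf (f := fun z : X * mR =>
    Eexp T (fun y => f (upd1 z.1 j (z.2 * (E z.1 j + y)))))).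
  apply: (Eexp_nnmf T0 (f := f \o bath_map j)); split => [|z]; last exact: f0.
  exact: measurableT_comp.
rewrite /move; case: (k == 0%N); first exact: nb.
case: (k == N); first exact: nb.
apply: (Eunif_nnmf (f := f \o exch_map k)); split => [|z]; last exact: f0.
exact: measurableT_comp.
Qed.

Lemma bath_posfun T j x (D : set X) : 0 < T ->
  (forall p y : R, 0 < p < 1 -> 0 < y -> D (upd1 x j (p * (E x j + y)))) ->
  posfun D (fun f => Eunif (fun p => Eexp T (fun y => f (upd1 x j (p * (E x j + y)))))).
Proof.
move=> T0 HD.
have HL := posfun_prod Eunif_posfun (Eexp_posfun T0)
  (fun h => @Eexp_nnmf R T T0 _ mR h).
have := @posfun_map _ X R D _ _ _ _ (fun z : mR * mR => upd1 x j (z.1 * (E x j + z.2)))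
  _ _ HL.
apply.
- by apply: measurable_upd1 => //; apply: measurable_funM => //; exact: measurable_funD.
- move=> [p y] [/= p01 y0]; apply: HD; first by move: p01; rewrite in_itv.
  by move: y0; rewrite in_itv/= andbT.
Qed.

Lemma exch_posfun k x (D : set X) :
  (forall p : R, 0 < p < 1 -> D (upd2 x k.-1 (p * (E x k.-1 + E x k))
                                   ((1 - p) * (E x k.-1 + E x k)))) ->
  posfun D (fun f => Eunif (fun p => f (upd2 x k.-1 (p * (E x k.-1 + E x k))
                                   ((1 - p) * (E x k.-1 + E x k))))).
Proof.
move=> HD; apply: (posfun_map (Phi := fun p : mR => upd2 x k.-1 (p * (E x k.-1 + E x k))
                                   ((1 - p) * (E x k.-1 + E x k))) _ _ Eunif_posfun).
- apply: measurable_upd2 => //; apply: measurable_funM => //.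
  exact: measurable_funB.
- by move=> p /= p01; apply: HD; move: p01; rewrite in_itv.
Qed.

Lemma orthant_upd1 x j a : orthant x -> 0 < a -> orthant (upd1 x j a).
Proof. by move=> /orthantP Dx a0; apply/orthantP => i iN; rewrite E_upd1//; case: ifP => // _; exact: Dx. Qed.

Lemma orthant_upd2 x j a b : orthant x -> 0 < a -> 0 < b -> orthant (upd2 x j a b).
Proof.
move=> /orthantP Dx a0 b0; apply/orthantP => i iN; rewrite E_upd2//.
by case: ifP => // _; case: ifP => // _; exact: Dx.
Qed.

Lemma move_posfun k x : (k <= N)%N -> orthant x -> posfun orthant (move k ^~ x).
Proof.
move=> kN Dx; have /orthantP Ex := Dx.
rewrite /move; case: (eqVneq k 0%N) => k0; [|case: (eqVneq k N) => kN'].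
- apply: (bath_posfun TL0) => p y /andP[p0 _] y0.
  by apply: orthant_upd1 => //; rewrite mulr_gt0// addr_gt0// Ex.
- apply: (bath_posfun TR0) => p y /andP[p0 _] y0.
  by apply: orthant_upd1 => //; rewrite mulr_gt0// addr_gt0// Ex// prednK.
- apply: exch_posfun => p /andP[p0 p1].
  have S0 : 0 < E x k.-1 + E x k by rewrite addr_gt0// Ex//; lia.
  by apply: orthant_upd2 => //; rewrite mulr_gt0// subr_gt0.
Qed.

Lemma move_posfunT k x : posfun setT (move k ^~ x).
Proof.
rewrite /move; case: (k == 0%N); [|case: (k == N)].
- exact: (bath_posfun TL0).
- exact: (bath_posfun TR0).
- exact: exch_posfun.
Qed.

(** A mixture of [N + 2] outcomes: the index [ord0] is for staying put, the others for the edges. *)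
Lemma Qop_posfun x (D : set X) : D x -> (forall k, (k <= N)%N -> posfun D (move k ^~ x)) ->
  posfun D (fun f => Qop TL TR K f x).
Proof.
move=> Dx HD.
pose w (i : 'I_N.+2) := if unlift ord0 i is Some k then erate x k / lam N K
  else 1 - (\sum_(k < N.+1) erate x k) / lam N K.
pose L (i : 'I_N.+2) f := if unlift ord0 i is Some k then move k f x else f x.
have -> : (fun f => Qop TL TR K f x) = (fun f => \sum_i (w i)%:E * L i f)%E.
  apply/funext => f; rewrite QopE [RHS]big_ord_recl /w /L unlift_none; congr (_ + _)%E.
  by apply: eq_bigr => k _; rewrite liftK.
have l0 := lam_gt0.
apply: posfun_mix => [i||i].
- rewrite /w; case: unliftP => [k _|_]; first by rewrite divr_ge0 ?rate_ge0// ltW.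
  by rewrite subr_ge0 ler_pdivrMr// mul1r erate_sum_le.
- rewrite [LHS]big_ord_recl /w unlift_none.
  apply: etrans (subrK ((\sum_(k < N.+1) erate x k) / lam N K) 1); congr (_ + _).
  by rewrite mulr_suml; apply: eq_bigr => k _; rewrite liftK.
- rewrite /L; case: unliftP => [k _|_]; first by apply: HD; rewrite -ltnS.
  by split => //= [f [_ f0]|f g _ _ fg]; [exact: f0|exact: fg].
Qed.

Lemma measurable_erate k : measurable_fun setT (erate ^~ k).
Proof.
have mmin : measurable_fun setT (fun x : X => Num.min (site x k) (site x k.+1)).
  exact: measurable_minr (measurable_site k) (measurable_site k.+1).
apply: (measurable_minr (f := fun=> K)) => //.
apply: (measurableT_comp (f := @Num.sqrt R)) mmin.
by apply: continuous_measurable_fun; exact: sqrt_continuous.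
Qed.

Lemma Qop_markov : markov_op orthant (Qop TL TR K).
Proof.
split=> [f nf|x Dx|x].
- split; last by move=> x; apply: (posfun_ge0 (Qop_posfun (D := setT) _ _)) => // k _; exact: move_posfunT.
  rewrite (_ : Qop _ _ _ _ = (fun x =>
  (1 - (\sum_(k < N.+1) erate x k) / lam N K)%:E * f x +
   \sum_(k < N.+1) (erate x k / lam N K)%:E * move k f x)%E); last first.
    by apply/funext => x; exact: QopE.
  apply: emeasurable_funD.
    apply: emeasurable_funM; last by case: nf.
    apply/measurable_EFinP; apply: measurable_funB => //; apply: measurable_funM => //.
    by apply: measurable_sum => k; exact: measurable_erate.
  apply: emeasurable_sum => k; apply: emeasurable_funM; last by case: (move_nnmf k nf).
  by apply/measurable_EFinP; apply: measurable_funM => //; exact: measurable_erate.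
- by apply: Qop_posfun => // k kN; exact: move_posfun.
- by apply: Qop_posfun => // k kN; exact: move_posfunT.
Qed.

End energy_exchange.

(** * Low energies *)

Section line_integrals.
Context {R : realType}.
Local Notation mR := (measurableTypeR R).
Local Notation leb := (@lebesgue_measure R).

(** The image of Lebesgue measure under [p -> 1 - p] agrees with it on half-open intervals, which
    determines it. Thus the two shares of an exchange have the same law. *)
Lemma Eunif_refl (f : mR -> \bar R) : nnmf f -> Eunif (fun p => f (1 - p)) = Eunif f.
Proof.
move=> [mf f0].
have mphi : measurable_fun setT (fun p : mR => (1 - p : mR)) by exact: measurable_funB.
have img : (fun p : mR => (1 - p : mR)) @^-1` `[0, 1] = `[0, 1]%classic :> set mR.
  by apply/seteqP; split => p /=; rewrite !in_itv/= => /andP[? ?]; apply/andP; split; lra.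
rewrite /Eunif -{1}img -(ge0_integral_pushforward (f := f) mphi leb)//; last first.
  exact: measurable_funTS.
apply: eq_measure_integral => //= A mA _.
apply/esym/lebesgue_measure_unique => //= _ [[a b]] _ <-.
rewrite /pushforward (_ : _ @^-1` _ = `[1 - b, 1 - a[%classic); last first.
  by apply/seteqP; split => p /=; rewrite !in_itv/= => /andP[? ?]; apply/andP; split; lra.
rewrite !lebesgue_measure_itv/= !lte_fin.
have -> : (1 - b < 1 - a) = (a < b) by apply/idP/idP; lra.
by case: ifP => // _; rewrite -!EFinD; congr EFin; ring.
Qed.

Lemma Eunif_scale (S : R) (f : mR -> \bar R) : 0 < S -> nnmf f ->
  Eunif (fun p => f (p * S)) = (S^-1%:E * \int[leb]_(z in `[0%R, S]) f z)%E.
Proof.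
move=> S0 [mf f0].
have mphi : measurable_fun setT (fun p : mR => (p * S : mR)) by exact: measurable_funM.
have img : (fun p : mR => (p * S : mR)) @^-1` `[0, S] = `[0, 1]%classic :> set mR.
  apply/seteqP; split => p /=; rewrite !in_itv/=.
    by rewrite pmulr_lge0// ger_pMl.
  by rewrite pmulr_lge0// ger_pMl.
rewrite /Eunif -{1}img -(ge0_integral_pushforward (f := f) mphi leb)//; last first.
  exact: measurable_funTS.
have Si0 : 0 <= S^-1 by rewrite invr_ge0 ltW.
rewrite -(ge0_integral_mscale leb _ (NngNum Si0))//; last exact: measurable_funTS.
have SS0 : 0 <= S by exact: ltW.
apply: eq_measure_integral => //= A mA _.
suff : leb A = (S%:E * pushforward leb (fun p : mR => (p * S)%R : mR) A)%E.
  rewrite /mscale/= => ->; rewrite muleA -EFinM mulVf ?gt_eqF// mul1e.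
  by [].
pose m := mscale (NngNum SS0) (pushforward leb (fun p : mR => (p * S : mR))).
rewrite (@lebesgue_measure_unique R (m mphi))// => _ [[a b]] _ <-.
have pre : (fun p : mR => (p * S : mR)) @^-1` `]a, b] = `]a / S, b / S]%classic.
  by apply/seteqP; split => p /=; rewrite !in_itv/= ltr_pdivrMr// ler_pdivlMr.
transitivity (S%:E * leb `](a / S)%R, (b / S)%R]%classic)%E; last by rewrite -pre.
rewrite !lebesgue_measure_itv/= !lte_fin ltr_pM2r ?invr_gt0//.
case: ifP => _; rewrite ?mule0// -!EFinD -EFinM; congr EFin.
by rewrite mulrBr !mulrA ![S * _]mulrC !mulfK// gt_eqF.
Qed.

Section power_integrals.
Variable th : R.
Hypothesis th01 : 0 < th < 1.

Lemma measurable_pow : measurable_fun setT (fun u : mR => u `^ (th - 1)).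
Proof. exact: measurable_powR. Qed.

Lemma pow_nnmf : nnmf (fun u : mR => (u `^ (th - 1))%:E).
Proof. by apply: (nnmf_EFin (u := fun u : mR => u `^ (th - 1))); [exact: measurable_pow|move=> u; rewrite powR_ge0]. Qed.

(** The singularity at 0 is approached by the intervals [[1 / (n + 2), 1]], where the fundamental
    theorem applies with antiderivative [u^th / th]; monotone convergence does the rest. *)
Lemma Eunif_pow_le : (Eunif (fun u : mR => (u `^ (th - 1))%:E) <= th^-1%:E)%E.
Proof.
have [t0 t1] := andP th01.
have [mp p0] := pow_nnmf.
pose F (n : nat) : set mR := `[n.+2%:R^-1, 1]%classic.
have FU : \bigcup_n F n = `]0, 1]%classic.
  apply/seteqP; split => [u [n _]|u]; rewrite /F /= !in_itv/=.
    by move=> /andP[nu ->]; rewrite andbT (lt_le_trans _ nu)// invr_gt0 ltr0n.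
  move=> /andP[u0 u1]; exists (Num.truncn u^-1) => //=; rewrite in_itv/= u1 andbT.
  rewrite invf_ple ?posrE ?ltr0n//; have := truncnS_gt u^-1 => /ltW/le_trans; apply.
  by rewrite ler_nat.
rewrite /Eunif -(integral_itv_obnd_cbnd (r := 0) (b := BRight 1)); last exact: measurable_funTS.
rewrite -FU.
have ndF : nondecreasing_seq F.
  move=> m n mn; apply/subsetPset => u; rewrite /F /= !in_itv/= => /andP[mu ->].
  by rewrite andbT (le_trans _ mu)// lef_pV2 ?posrE ?ltr0n// ler_nat; lia.
have mF i : measurable (F i) by exact: measurable_itv.
have mpF i : measurable_fun (F i) (fun u : mR => (u `^ (th - 1))%:E) by exact: measurable_funTS.
have cv := ge0_nondecreasing_set_cvg_integral (mu := leb) ndF mF mpF (fun i x _ => p0 x).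
rewrite -(cvg_lim _ cv)//.
apply: lime_le.
  apply: ereal_nondecreasing_is_cvgn.
  by move=> m k mk; apply: (ge0_nondecreasing_set_nondecreasing_integral leb ndF mF mpF).
apply: nearW => n; rewrite /F.
have n0 : 0 < n.+2%:R^-1 :> R by rewrite invr_gt0 ltr0n.
have n1 : n.+2%:R^-1 < 1 :> R by rewrite invf_lt1 ?ltr0n// ltr1n.
have cpow a (u : R) : 0 < u -> {for u, continuous (fun z : R => z `^ a)}.
  move=> u0; apply: differentiable_continuous; apply/derivable1_diffP.
  by apply: derivable_powR; rewrite in_itv/= u0.
have cF (u : R) : 0 < u -> {for u, continuous (fun z : R => th^-1 * z `^ th)}.
  by move=> u0; apply: continuousM; [exact: cst_continuous|exact: cpow].
have dF (u : R) : 0 < u -> is_derive u 1 (fun z : R => th^-1 * z `^ th) (u `^ (th - 1)).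
  move=> u0; have H := is_derive1_powR th u0.
  have := is_deriveZ th^-1 H; rewrite /GRing.scale/= => /is_derive_eq; apply.
  by rewrite mulrA mulVf ?mul1r// gt_eqF.
rewrite (@continuous_FTC2 R (fun u => u `^ (th - 1)) (fun u => th^-1 * u `^ th))//.
- rewrite powR1 -EFinB lee_fin mulr1 gerBl mulr_ge0 ?powR_ge0// invr_ge0.
  exact: ltW.
- apply: continuous_in_subspaceT => u; rewrite inE/= in_itv/= => /andP[nu _].
  by apply: cpow; exact: lt_le_trans nu.
- split.
  + move=> u; rewrite in_itv/= => /andP[nu _].
    by have [] := dF u (lt_trans n0 nu).
  + by apply: cvg_at_right_filter; exact: cF.
  + by apply: cvg_at_left_filter; exact: cF.
- move=> u; rewrite in_itv/= => /andP[nu _].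
  by rewrite derive1E; have [_ ->] := dF u (lt_trans n0 nu).
Qed.

Lemma Eunif_opow_le : (Eunif (fun u : mR => ((1 - u) `^ (th - 1))%:E) <= th^-1%:E)%E.
Proof.
by rewrite (Eunif_refl (f := fun u => (u `^ (th - 1))%:E)) ?Eunif_pow_le//; exact: pow_nnmf.
Qed.

(** Split at [y = T]. Above, the power is at most 1; below, the density is at most [1 / T], and
    rescaling turns the integral of the power into that of [u^(th - 1)] over the unit interval. *)
Lemma Eexp_pow_le (T : R) : 0 < T ->
  (Eexp T (fun y : mR => (1 + (y / T) `^ (th - 1))%:E) <= (2 + th^-1)%:E)%E.
Proof.
move=> T0.
have [t0 t1] := andP th01.
have T10 : 0 <= T^-1 by rewrite invr_ge0 ltW.
pose h (y : mR) : R := if y <= T then T^-1 * (y / T) `^ (th - 1) else 0.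
have mpT : measurable_fun setT (fun y : mR => (y / T) `^ (th - 1)).
  by apply: (measurableT_comp measurable_pow); exact: measurable_funM.
have mh : measurable_fun setT h.
  apply: measurable_fun_ifT => //; last exact: measurable_funM.
  exact: measurable_fun_ler.
have h0 y : 0 <= h y.
  by rewrite /h; case: ifP => // _; rewrite mulr_ge0 ?powR_ge0.
have me := measurable_expdens T.
have nu : nnmf (fun y : mR => (1 + (y / T) `^ (th - 1))%:E).
  apply: (nnmf_EFin (u := fun y : mR => 1 + (y / T) `^ (th - 1))).
    exact: measurable_funD.
  by move=> y; rewrite addr_ge0 ?powR_ge0.
rewrite /Eexp.
apply: (@le_trans _ _ (\int[leb]_(y in `]0%R, +oo[) (2%:E * (expdens T y)%:E + (h y)%:E))%E).
  rewrite -integral_itv_obnd_cbnd; last first.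
    apply: measurable_funTS; apply: emeasurable_funM; last by case: nu.
    exact/measurable_EFinP.
  apply: ge0_le_integral => //.
  - by move=> y _; rewrite mule_ge0// lee_fin ?expdens_ge0// addr_ge0 ?powR_ge0.
  - apply: measurable_funTS; apply: emeasurable_funM; last by case: nu.
    exact/measurable_EFinP.
  - apply: measurable_funTS; apply: emeasurable_funD; last exact/measurable_EFinP.
    by apply: measurable_funeM; exact/measurable_EFinP.
  move=> y; rewrite /= in_itv/= andbT => y0.
  have e0 := expdens_ge0 T0 y.
  have e1 : expdens T y <= T^-1.
    rewrite /expdens ger_pMr ?invr_gt0// -expR0 ler_expR oppr_le0 divr_ge0//; exact: ltW.
  rewrite -/(expdens T y) -!EFinM -EFinD lee_fin /h.
  have p0 := powR_ge0 (y / T) (th - 1).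
  case: ifPn => [_|]; first by nra.
  rewrite -ltNge => Ty; rewrite addr0 mulrC ler_wpM2r//.
  have : (y / T) `^ (th - 1) <= 1; last lra.
  rewrite -[leRHS](powRr0 (y / T)) ler_powR//; last lra.
  by rewrite ler_pdivlMr// mul1r ltW.
rewrite ge0_integralD//=; last 4 first.
- by move=> y _; rewrite mule_ge0// lee_fin expdens_ge0.
- by apply: measurable_funTS; apply: measurable_funeM; exact/measurable_EFinP.
- by move=> y _; rewrite lee_fin.
- by apply: measurable_funTS; exact/measurable_EFinP.
rewrite ge0_integralZl_EFin//; last 2 first.
- by move=> y _; rewrite lee_fin expdens_ge0.
- by apply: measurable_funTS; exact/measurable_EFinP.
rewrite integral_itv_obnd_cbnd; last by apply: measurable_funTS; exact/measurable_EFinP.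
rewrite integral_expdens// mule1 (EFinD 2 th^-1); apply: leeD2l.
apply: le_trans Eunif_pow_le.
have -> : Eunif (fun u : mR => (u `^ (th - 1))%:E) =
    Eunif (fun u => ((u * T / T) `^ (th - 1))%:E).
  by rewrite /Eunif; apply: eq_integral => u _; rewrite mulfK// gt_eqF.
have npT : nnmf (fun y : mR => ((y / T) `^ (th - 1))%:E).
  by apply: (nnmf_EFin (u := fun y : mR => (y / T) `^ (th - 1))) => // y; rewrite powR_ge0.
rewrite (Eunif_scale (f := fun y => ((y / T) `^ (th - 1))%:E) T0 npT).
rewrite -ge0_integralZl_EFin//; last 2 first.
- by move=> y _; case: npT.
- by apply: measurable_funTS; case: npT.
rewrite [leLHS]integral_mkcond [leRHS]integral_mkcond; apply: ge0_le_integral => //=.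
- by move=> y _; rewrite patchE; case: ifP; rewrite // lee_fin.
- by apply/(measurable_restrictT _ _).1 => //; apply: measurable_funTS; exact/measurable_EFinP.
- apply/(measurable_restrictT _ _).1 => //; apply: measurable_funTS.
  by apply: measurable_funeM; case: npT.
move=> y _; rewrite !patchE !mem_setE !in_itv/= andbT /h.
have nn (b : bool) : (0 <= if b then (T^-1)%:E * ((y / T) `^ (th - 1))%:E else 0)%E.
  by case: b; rewrite // mule_ge0// lee_fin// powR_ge0.
case: ifPn => y0 //; case: ifPn => y1 //.
by rewrite (ltW y0)/= EFinM.
Qed.

End power_integrals.
End line_integrals.

Lemma powR_anti (R : realType) (e a b : R) : e <= 0 -> 0 < a -> a <= b -> b `^ e <= a `^ e.
Proof.
move=> e0 a0 ab; have b0 : 0 < b by exact: lt_le_trans ab.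
rewrite -[e]opprK (powRN a) (powRN b) lef_pV2 ?posrE ?powR_gt0//.
by apply: ge0_ler_powR; rewrite ?nnegrE ?oppr_ge0 ?(ltW a0) ?(ltW b0).
Qed.

(** * Effect of one move on the cost of a block *)

Section blocks.
Context {R : realType} {N : nat}.
Variables (TL TR : R).
Hypotheses (N0 : (0 < N)%N) (TL0 : 0 < TL) (TR0 : 0 < TR).
Local Notation X := (N.-tuple R).
Local Notation mR := (measurableTypeR R).
Local Notation site := (@site R N TL TR).
Local Notation move := (@move R N TL TR).
Local Notation orthant := (@orthant R N).
Implicit Types (x : X).

Definition blk x i j : R := \sum_(i <= l < j) site x l.

Lemma siteS x l : site x l.+1 = if (l < N)%N then E x l else TR.
Proof. by []. Qed.

Lemma site_upd1 x j a l : (j < N)%N ->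
  site (upd1 x j a) l = if l == j.+1 then a else site x l.
Proof.
move=> jN; case: l => [//|l]; rewrite eqSS !siteS.
by case: ltnP => lN; [rewrite E_upd1|case: eqP => // E; lia].
Qed.

Lemma site_upd2 x j a b l : (j.+1 < N)%N -> site (upd2 x j a b) l =
  if l == j.+1 then a else if l == j.+2 then b else site x l.
Proof.
move=> jN; case: l => [//|l]; rewrite !eqSS !siteS.
case: ltnP => lN; first by rewrite E_upd2.
by case: eqP => [E|_]; [lia|case: eqP => // E; lia].
Qed.

Lemma site_gt0 x l : orthant x -> 0 < site x l.
Proof.
move=> /orthantP Dx; case: l => [//|l]; rewrite siteS.
by case: ltnP => // lN; exact: Dx.
Qed.

Lemma blk_eq x x' i j : (forall l, (i <= l < j)%N -> site x l = site x' l) ->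
  blk x i j = blk x' i j.
Proof. by move=> H; apply: eq_big_nat. Qed.

Lemma blk_recl x i j : (i < j)%N -> blk x i j = site x i + blk x i.+1 j.
Proof. by move=> ij; rewrite /blk big_ltn. Qed.

Lemma blk_recr x i j : (i <= j)%N -> blk x i j.+1 = blk x i j + site x j.
Proof. by move=> ij; rewrite /blk big_nat_recr. Qed.

Lemma blk_cat x i k j : (i <= k)%N -> (k <= j)%N -> blk x i j = blk x i k + blk x k j.
Proof. by move=> ik kj; rewrite /blk (big_cat_nat ik kj). Qed.

Lemma blk_ge0 x i j : orthant x -> 0 <= blk x i j.
Proof. by move=> Dx; apply: sumr_ge0 => l _; apply/ltW/site_gt0. Qed.

Lemma site_le_blk x i l j : orthant x -> (i <= l < j)%N -> site x l <= blk x i j.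
Proof.
move=> Dx /andP[il lj]; rewrite (blk_cat x il (ltnW lj)) (blk_recl x lj).
by have := blk_ge0 i l Dx; have := blk_ge0 l.+1 j Dx; lra.
Qed.

Lemma blk_gt0 x i j : orthant x -> (i < j)%N -> 0 < blk x i j.
Proof.
move=> Dx ij; apply: (lt_le_trans (site_gt0 i Dx)).
by apply: site_le_blk => //; rewrite leqnn.
Qed.

Lemma measurable_blk i j : measurable_fun setT (fun x : X => blk x i j).
Proof. by apply: measurable_sum => l; exact: measurable_site. Qed.

Lemma exch_sites x k p : (0 < k < N)%N -> forall l,
  site (upd2 x k.-1 (p * (E x k.-1 + E x k)) ((1 - p) * (E x k.-1 + E x k))) l =
  if l == k then p * (site x k + site x k.+1)
  else if l == k.+1 then (1 - p) * (site x k + site x k.+1) else site x l.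
Proof.
move=> /andP[k0 kN] l; rewrite site_upd2; last lia.
have kk : k.-1.+1 = k by lia.
by rewrite kk (site_in _ _ _ k0 (ltnW kN)) (@site_in _ _ _ _ _ k.+1).
Qed.

Variable th : R.
Hypothesis th01 : 0 < th < 1.

Definition blkpow i j : X -> \bar R := fun x => ((blk x i j) `^ (th - 1))%:E.

(** [1 / th] bounds the mean of [p^(th - 1)] for the uniform share, [2 + 1 / th] is the bound of
    [Eexp_pow_le] for a bath draw; a single constant serves exchanges and baths. *)
Definition Bmove : R := th^-1 * (2 + th^-1).

Let t0 : 0 < th. Proof. by case/andP: th01. Qed.
Let t1 : th < 1. Proof. by case/andP: th01. Qed.
Let e0 : th - 1 <= 0. Proof. by have := t1; lra. Qed.

Lemma blkpow_nnmf i j : nnmf (blkpow i j).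
Proof.
apply: (nnmf_EFin (u := fun x : X => (blk x i j) `^ (th - 1))).
  exact: (measurableT_comp (measurable_pow th) (measurable_blk i j)).
by move=> x; rewrite powR_ge0.
Qed.

(** An exchange inside the block preserves its total, and one outside does not touch it: only the
    edges [i.-1] and [j.-1] matter. *)
Lemma move_blkpow_id i j k x : (0 < i < j)%N -> (j <= N.+1)%N -> (k <= N)%N ->
  k.+1 != i -> k.+1 != j -> move k (blkpow i j) x = blkpow i j x.
Proof.
move=> /andP[i0 ij] jN kN ki kj.
have c0 : 0 <= (blk x i j) `^ (th - 1) by exact: powR_ge0.
rewrite /move; case: (eqVneq k 0%N) => k0; [|case: (eqVneq k N) => kN'].
- rewrite /Eunif /blkpow.
  transitivity (Eunif (fun p : R => Eexp TL (fun y : R => ((blk x i j) `^ (th - 1))%:E))).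
    apply: eq_integral => p _; apply: eq_integral => y _; congr (_ * (_ `^ _)%:E)%E.
    by apply: blk_eq => l /andP[il lj]; rewrite site_upd1//; case: eqP => // E; lia.
  rewrite (_ : (fun p : R => _) = fun=> ((blk x i j) `^ (th - 1))%:E).
    exact: (posfun_cst Eunif_posfun).
  by apply/funext => p; exact: (posfun_cst (Eexp_posfun TL0)).
- rewrite /Eunif /blkpow.
  transitivity (Eunif (fun p : R => Eexp TR (fun y : R => ((blk x i j) `^ (th - 1))%:E))).
    apply: eq_integral => p _; apply: eq_integral => y _; congr (_ * (_ `^ _)%:E)%E.
    apply: blk_eq => l /andP[il lj]; rewrite site_upd1; last lia.
    by case: eqP => // E; lia.
  rewrite (_ : (fun p : R => _) = fun=> ((blk x i j) `^ (th - 1))%:E).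
    exact: (posfun_cst Eunif_posfun).
  by apply/funext => p; exact: (posfun_cst (Eexp_posfun TR0)).
- transitivity (Eunif (fun p : R => ((blk x i j) `^ (th - 1))%:E)).
    apply: eq_integral => p _; rewrite /blkpow; congr (_ `^ _)%:E.
    have k0N : (0 < k < N)%N by lia.
    have [ik|ki'] := leqP i k; last first.
      by apply: blk_eq => l /andP[il lj]; rewrite exch_sites//;
        case: eqP => [E|_]; [lia|case: eqP => // E; lia].
    have [kj'|jk] := leqP k.+2 j; last first.
      by apply: blk_eq => l /andP[il lj]; rewrite exch_sites//;
        case: eqP => [E|_]; [lia|case: eqP => // E; lia].
    rewrite !(blk_cat _ ik (ltnW (ltnW kj'))) !(blk_recl _ (ltnW kj')) !(blk_recl _ kj').
    rewrite !exch_sites// !eqxx gtn_eqF//.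
    congr (_ + _).
      apply: blk_eq => l /andP[il lj]; rewrite exch_sites//.
      by case: eqP => [E|_]; [lia|case: eqP => // E; lia].
    rewrite !addrA; congr (_ + _); first by ring.
    apply: blk_eq => l /andP[il lj]; rewrite exch_sites//.
    by case: eqP => [E|_]; [lia|case: eqP => // E; lia].
  exact: (posfun_cst Eunif_posfun).
Qed.

Lemma Bmove_ge1 : 1 <= Bmove.
Proof.
have t1' : 1 <= th^-1 by rewrite invf_ge1 ?t0// ltW// t1.
by rewrite /Bmove -[1]mulr1; apply: ler_pM => //; lra.
Qed.

Lemma Eunif_block_le (g : mR -> \bar R) (u : mR -> R) (s : R) : 0 < s -> nnmf g ->
  nnmf (fun p => ((u p) `^ (th - 1))%:E) -> (forall p, 0 < p < 1 -> 0 < u p) ->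
  (Eunif (fun p => ((u p) `^ (th - 1))%:E) <= th^-1%:E)%E ->
  (forall p : R, 0 < p < 1 -> (g p <= ((u p * s) `^ (th - 1))%:E)%E) ->
  (Eunif g <= (Bmove * s `^ (th - 1))%:E)%E.
Proof.
move=> s0 ng nu u0 Hu gu.
have sp := powR_ge0 s (th - 1).
apply: (@le_trans _ _ (Eunif (fun p => (s `^ (th - 1))%:E * ((u p) `^ (th - 1))%:E))%E).
  apply: (posfun_le Eunif_posfun) => //; first exact: nnmfZ.
  move=> p; rewrite /= in_itv/= => p01; apply: (le_trans (gu p p01)).
  by rewrite powRM ?(ltW s0) ?(ltW (u0 p p01))// mulrC EFinM.
rewrite (posfunZ Eunif_posfun)// mulrC [leRHS]EFinM lee_wpmul2l ?lee_fin//.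
apply: (le_trans Hu); rewrite lee_fin /Bmove ler_peMr ?invr_ge0 ?(ltW t0)//.
have : 0 <= th^-1 by rewrite invr_ge0 ltW// t0.
lra.
Qed.

(** A bath enters the estimates as a neighbour of energy [T], although its draw [y] may be much
    smaller; the loss is a factor [1 + (y / T)^(th - 1)], which has finite mean. *)
Lemma bath_block_le (T : R) (g : mR * mR -> \bar R) (s : R) : 0 < T -> 0 <= s -> nnmf g ->
  (forall p y : R, 0 < p < 1 -> 0 < y -> (g (p, y) <= ((p * (s + y)) `^ (th - 1))%:E)%E) ->
  (Eunif (fun p => Eexp T (fun y => g (p, y))) <= (Bmove * (T + s) `^ (th - 1))%:E)%E.
Proof.
move=> T0 s0 ng Hg.
have Ts0 : 0 < T + s by lra.
have nE : nnmf (fun y : mR => (1 + (y / T) `^ (th - 1))%:E).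
  apply: (nnmf_EFin (u := fun y : mR => 1 + (y / T) `^ (th - 1))).
    apply: measurable_funD => //; apply: (measurableT_comp (measurable_pow th)).
    exact: measurable_funM.
  by move=> y; rewrite addr_ge0 ?powR_ge0.
pose c p := ((T + s) `^ (th - 1) * p `^ (th - 1)).
have c0 p : 0 <= c p by rewrite mulr_ge0 ?powR_ge0.
have inner p : 0 < p < 1 -> (Eexp T (fun y => g (p, y)) <= (c p * (2 + th^-1))%:E)%E.
  move=> p01; have [p0 p1] := andP p01.
  apply: (@le_trans _ _ (Eexp T (fun y => (c p)%:E * (1 + (y / T) `^ (th - 1))%:E))%E).
    apply: (posfun_le (Eexp_posfun T0)).
    - split; last by move=> y; case: ng.
      by apply: (measurableT_comp (proj1 ng)); exact: measurable_pair1.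
    - exact: nnmfZ.
    - move=> y; rewrite /= in_itv/= andbT => y0; apply: (le_trans (Hg p y p01 y0)).
      rewrite -EFinM lee_fin powRM ?(ltW p0)//; last lra.
      rewrite /c [X in _ <= X * _]mulrC -mulrA ler_wpM2l ?powR_ge0//.
      have yT0 : 0 < y / T by rewrite divr_gt0.
      have sp := powR_ge0 (T + s) (th - 1).
      have := powR_ge0 (y / T) (th - 1).
      (* [s + y >= (s + T) * min 1 (y / T)] *)
      have [Ty|yT] := leP T y.
        have : (s + y) `^ (th - 1) <= (T + s) `^ (th - 1) by apply: powR_anti => //; lra.
        by move=> h1 h2; rewrite mulrDr mulr1; nra.
      have : (s + y) `^ (th - 1) <= ((T + s) * (y / T)) `^ (th - 1).
        apply: powR_anti => //; first by rewrite mulr_gt0.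
        have -> : (T + s) * (y / T) = s * (y / T) + y by field; rewrite gt_eqF.
        by rewrite lerD2r; apply: ler_piMr => //; rewrite ler_pdivrMr// mul1r ltW.
      by rewrite powRM ?(ltW Ts0) ?(ltW yT0)// => h1 h2; nra.
  rewrite (posfunZ (Eexp_posfun T0))// [leRHS]EFinM lee_wpmul2l ?lee_fin//.
  exact: Eexp_pow_le.
have t2 : 0 <= 2 + th^-1 by rewrite addr_ge0// invr_ge0 ltW// t0.
have sp := powR_ge0 (T + s) (th - 1).
apply: (@le_trans _ _ (Eunif (fun p => ((T + s) `^ (th - 1) * (2 + th^-1))%:E * (p `^ (th - 1))%:E))%E).
  apply: (posfun_le Eunif_posfun).
  - exact: (Eexp_nnmf T0).
  - apply: nnmfZ; [exact: mulr_ge0|exact: pow_nnmf].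
  - move=> p; rewrite /= in_itv/= => p01; apply: (le_trans (inner p p01)).
    by rewrite -EFinM lee_fin /c mulrAC.
rewrite (posfunZ Eunif_posfun); [|exact: mulr_ge0|exact: pow_nnmf].
have -> : Bmove * (T + s) `^ (th - 1) = (T + s) `^ (th - 1) * (2 + th^-1) * th^-1.
  by rewrite /Bmove; ring.
by rewrite [leRHS]EFinM lee_wpmul2l ?lee_fin ?mulr_ge0// Eunif_pow_le.
Qed.

(** Across the edge [k] the block keeps its other sites in full and gets the share [1 - p] of the
    boundary pair, so its new total is at least [1 - p] times that of the block enlarged by site
    [k]. For [k = 0] the bath is the neighbour. *)
Lemma move_blkpow_left k j x : orthant x -> (k.+1 < j)%N -> (j <= N.+1)%N ->
  (move k (blkpow k.+1 j) x <= (Bmove * (blk x k j) `^ (th - 1))%:E)%E.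
Proof.
move=> Dx kj jN; have nb := blkpow_nnmf k.+1 j.
have Ex := (orthantP x).1 Dx.
rewrite /move; case: (eqVneq k 0%N) => k0.
  subst k; rewrite (blk_recl x (ltnW kj)) {1}/site eqxx.
  apply: (bath_block_le (g := fun z => blkpow 1 j (upd1 x 0 (z.1 * (E x 0 + z.2))))) => //.
  - exact: blk_ge0.
  - split; last by move=> z; case: nb.
    apply: (measurableT_comp (proj1 nb)); apply: measurable_upd1 => //.
    by apply: measurable_funM => //; exact: measurable_funD.
  - move=> p y /andP[p0 p1] y0; rewrite lee_fin; apply: powR_anti => //.
      by rewrite mulr_gt0// (lt_le_trans y0)// lerDr blk_ge0.
    rewrite !(blk_recl _ kj) site_upd1//= site_in//=.
    rewrite (@blk_eq (upd1 _ _ _) x) => [|l /andP[l1 lj]]; last first.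
      by rewrite site_upd1//; case: eqP => // E; lia.
    have := blk_ge0 2 j Dx; have := Ex 0%N N0; nra.
rewrite ifF; last by apply/eqP; lia.
have kN : (0 < k < N)%N by lia.
pose S := E x k.-1 + E x k.
apply: (Eunif_block_le (g := fun p => blkpow k.+1 j (upd2 x k.-1 (p * S) ((1 - p) * S)))
   (u := fun p => 1 - p)).
- by apply: blk_gt0 => //; exact: ltnW.
- split; last by move=> z; case: nb.
  apply: (measurableT_comp (proj1 nb)); apply: measurable_upd2 => //.
    exact: measurable_funM.
  by apply: measurable_funM => //; exact: measurable_funB.
- apply: (nnmf_EFin (u := fun p : mR => (1 - p) `^ (th - 1))).
    by apply: (measurableT_comp (measurable_pow th)); exact: measurable_funB.
  by move=> p; rewrite powR_ge0.
- by move=> p /andP[_ p1]; rewrite subr_gt0.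
- exact: Eunif_opow_le.
- move=> p /andP[p0 p1]; rewrite lee_fin; apply: powR_anti => //.
    by rewrite mulr_gt0 ?subr_gt0//; apply: blk_gt0 => //; exact: ltnW.
  rewrite (blk_recl _ kj) exch_sites// eqxx gtn_eqF//.
  rewrite (@blk_eq (upd2 _ _ _ _) x) => [|l /andP[l1 lj]]; last first.
    by rewrite exch_sites//; case: eqP => [E|_]; [lia|case: eqP => // E; lia].
  rewrite (blk_recl x (ltnW kj)) (blk_recl x kj) addrA mulrDr lerD2l.
  have := blk_ge0 k.+2 j Dx; nra.
Qed.

Lemma move_blkpow_right i k x : orthant x -> (0 < i <= k)%N -> (k <= N)%N ->
  (move k (blkpow i k.+1) x <= (Bmove * (blk x i k.+2) `^ (th - 1))%:E)%E.
Proof.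
move=> Dx /andP[i0 ik] kN; have nb := blkpow_nnmf i k.+1.
have Ex := (orthantP x).1 Dx.
rewrite /move ifF; last by apply/eqP; lia.
case: (eqVneq k N) => kN'.
  subst k; rewrite (blk_recr x (leqW ik)) {1}/site ltnn/= [X in X `^ _]addrC.
  apply: (bath_block_le (g := fun z => blkpow i N.+1 (upd1 x N.-1 (z.1 * (E x N.-1 + z.2))))) => //.
  - exact: blk_ge0.
  - split; last by move=> z; case: nb.
    apply: (measurableT_comp (proj1 nb)); apply: measurable_upd1 => //.
    by apply: measurable_funM => //; exact: measurable_funD.
  - move=> p y /andP[p0 p1] y0; rewrite lee_fin; apply: powR_anti => //.
      by rewrite mulr_gt0// (lt_le_trans y0)// lerDr blk_ge0.
    have N1 : (N.-1 < N)%N by lia.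
    rewrite !(blk_recr _ ik) site_upd1// prednK// eqxx site_in//.
    rewrite (@blk_eq (upd1 _ _ _) x) => [|l /andP[l1 lj]]; last first.
      by rewrite site_upd1//; case: eqP => // E; lia.
    rewrite [(p, y).1]/= [(p, y).2]/=.
    have := blk_ge0 i N Dx; have := Ex _ N1; nra.
have kN2 : (0 < k < N)%N by lia.
pose S := E x k.-1 + E x k.
apply: (Eunif_block_le (g := fun p => blkpow i k.+1 (upd2 x k.-1 (p * S) ((1 - p) * S)))
   (u := fun p => p)).
- by apply: blk_gt0 => //; lia.
- split; last by move=> z; case: nb.
  apply: (measurableT_comp (proj1 nb)); apply: measurable_upd2 => //.
    exact: measurable_funM.
  by apply: measurable_funM => //; exact: measurable_funB.
- exact: pow_nnmf.
- by move=> p /andP[].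
- exact: Eunif_pow_le.
- move=> p /andP[p0 p1]; rewrite lee_fin; apply: powR_anti => //.
    by rewrite mulr_gt0//; apply: blk_gt0 => //; lia.
  rewrite (blk_recr _ ik) exch_sites// eqxx.
  rewrite (@blk_eq (upd2 _ _ _ _) x) => [|l /andP[l1 lj]]; last first.
    by rewrite exch_sites//; case: eqP => [E|_]; [lia|case: eqP => // E; lia].
  rewrite (blk_recr x (leqW ik)) (blk_recr x ik) -addrA mulrDr lerD2r.
  have := blk_ge0 i k Dx; nra.
Qed.

End blocks.

Lemma posfun_sum {d : measure_display} {X : measurableType d} {R : realType}
    (D : set X) (L : (X -> \bar R) -> \bar R) (I : Type) (r : seq I) (P : pred I)
    (c : I -> R) (f : I -> X -> \bar R) :
  posfun D L -> (forall i, 0 <= c i) -> (forall i, nnmf (f i)) ->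
  nnmf (fun x => \sum_(i <- r | P i) (c i)%:E * f i x)%E /\
  (L (fun x => \sum_(i <- r | P i) (c i)%:E * f i x) =
   \sum_(i <- r | P i) (c i)%:E * L (f i))%E.
Proof.
move=> HL c0 nf; elim: r => [|a r [nr Lr]].
  split; first by under eq_fun do rewrite big_nil; exact: (nnmf_cst (lexx 0)).
  rewrite big_nil -[RHS](posfun_cst HL (lexx 0)).
  by congr L; apply/funext => x; rewrite big_nil.
have na := nnmfZ (c0 a) (nf a).
have [Pa|Pa] := boolP (P a); last first.
  by under eq_fun do rewrite big_cons (negbTE Pa); rewrite big_cons (negbTE Pa).
under eq_fun do rewrite big_cons Pa.
split; first exact: nnmfD.
by rewrite big_cons Pa -Lr -(posfunZ HL (c0 a) (nf a)) -(posfunD HL na nr).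
Qed.

(** * Weights of the blocks *)

Section low_energy.
Context {R : realType} {N : nat}.
Variables (TL TR K : R).
Hypotheses (N0 : (0 < N)%N) (TL0 : 0 < TL) (TR0 : 0 < TR) (K1 : 1 <= K).
Variable th : R.
Hypothesis th01 : 0 < th <= 1 / 4.
Local Notation X := (N.-tuple R).
Local Notation site := (@site R N TL TR).
Local Notation move := (@move R N TL TR).
Local Notation orthant := (@orthant R N).
Local Notation blk := (@blk R N TL TR).
Local Notation blkpow := (@blkpow R N TL TR th).
Local Notation erate := (@erate R N TL TR K).
Local Notation Q := (@Qop R N TL TR K).
Local Notation B := (@Bmove R th).
Implicit Types (x : X).

Let t0 : 0 < th. Proof. by case/andP: th01. Qed.
Let t4 : th <= 1 / 4. Proof. by case/andP: th01. Qed.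
Let th1 : 0 < th < 1. Proof. by have := t0; have := t4; move=> *; apply/andP; split; lra. Qed.

(** A bound for the generator, not yet divided by [lam]: edge [i.-1] enlarges the block to the left,
    edge [j.-1] to the right. *)
Definition block_gain x i j : R :=
  erate x i.-1 * (B * blk x i.-1 j `^ (th - 1) - blk x i j `^ (th - 1)) +
  erate x j.-1 * (B * blk x i j.+1 `^ (th - 1) - blk x i j `^ (th - 1)).

Lemma sum_ord_delta n m (F : nat -> R) (a : R) : (m < n)%N ->
  \sum_(k < n) F k * (if (k : nat) == m then a else 0) = F m * a.
Proof.
move=> mn; rewrite (bigD1 (Ordinal mn))//= eqxx big1 ?addr0// => k km.
by rewrite ifF ?mulr0//; apply: contraNF km => /eqP km; apply/eqP/val_inj.
Qed.

Lemma Q_blkpow_le x i j : orthant x -> (0 < i < j)%N -> (j <= N.+1)%N ->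
  (Q (blkpow i j) x <= (blk x i j `^ (th - 1) + block_gain x i j / lam N K)%:E)%E.
Proof.
move=> Dx /andP[i0 ij] jN; rewrite QopE//.
have l0 : 0 < lam N K by exact: lam_gt0.
set f := blk x i j `^ (th - 1).
pose a := B * blk x i.-1 j `^ (th - 1) - f.
pose b := B * blk x i j.+1 `^ (th - 1) - f.
pose m (k : nat) := f + ((if k == i.-1 then a else 0) + (if k == j.-1 then b else 0)).
have mk (k : 'I_N.+1) : (move k (blkpow i j) x <= (m k)%:E)%E.
  have kN : (k <= N)%N by rewrite -ltnS.
  rewrite /m; case: (eqVneq (k : nat) i.-1) => ki.
    rewrite ifF; last by apply/eqP; lia.
    have E : k.+1 = i by lia.
    rewrite addr0 addrC subrK -ki -{1}E.
    by apply: move_blkpow_left => //; rewrite E.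
  case: (eqVneq (k : nat) j.-1) => kj.
    have E : k.+1 = j by lia.
    rewrite add0r addrC subrK -{1}E -[in leRHS]E.
    by apply: move_blkpow_right => //; lia.
  by rewrite !addr0 move_blkpow_id//; lia.
apply: (@le_trans _ _ ((1 - (\sum_(k < N.+1) erate x k) / lam N K) * f +
   \sum_(k < N.+1) erate x k / lam N K * m k)%:E).
  rewrite [leRHS]EFinD (EFinM _ f); apply: leeD2l; rewrite -sumEFin.
  apply: lee_sum => k _; rewrite (EFinM _ (m k)); apply: lee_wpmul2l => //.
  by rewrite lee_fin divr_ge0 ?rate_ge0// ltW.
rewrite lee_fin.
have -> : \sum_(k < N.+1) erate x k / lam N K * m k =
    (\sum_(k < N.+1) erate x k) / lam N K * f +
    (erate x i.-1 * a + erate x j.-1 * b) / lam N K.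
  under eq_bigr do rewrite mulrDr mulrDr.
  rewrite !big_split/= -mulr_suml -mulr_suml; congr (_ + _).
  rewrite (sum_ord_delta (fun k => erate x k / lam N K)); last lia.
  rewrite (sum_ord_delta (fun k => erate x k / lam N K)); last lia.
  by ring.
by rewrite /block_gain -/f -/a -/b; lra.
Qed.

Definition Mpairs : R := #|{: 'I_N.+2 * 'I_N.+2}|%:R.
(** There are at most [Mpairs] blocks with two boundary edges each. Up to constants their
    contributions then add up to at most [2 * Mpairs / (8 * Mpairs) = 1 / 4] of the unit in which
    the smallest block gains [1 / 2]; [B] is the factor lost in a move. *)
Definition Gmu : R := 8 * Mpairs * B.

(* Longer blocks get much smaller weights: [mu] is chosen so that the positive
   contributions to blocks of length [l], which come from blocks of length [l.+1],
   are negligible *)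
Fixpoint mu (l : nat) : R := if l is l'.+1 then (mu l' / Gmu) ^+ 4 else 1.

Lemma Mpairs_ge1 : 1 <= Mpairs.
Proof. by rewrite /Mpairs ler1n card_prod !card_ord. Qed.

Lemma Gmu_ge8 : 8 * B <= Gmu.
Proof.
have B1 : 1 <= B := Bmove_ge1 th1; have M1 := Mpairs_ge1.
by rewrite /Gmu -mulrA ler_pM2l// ler_peMl//; lra.
Qed.

Lemma mu_bounds l : 0 < mu l <= 1.
Proof.
have B1 : 1 <= B := Bmove_ge1 th1; have G8 := Gmu_ge8.
have G0 : 0 < Gmu by lra.
elim: l => [|l /andP[m0 m1]] /=; first by rewrite ltr01 lexx.
rewrite exprn_gt0 ?divr_gt0//=; apply: exprn_ile1; first by rewrite divr_ge0// ltW.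
by rewrite ler_pdivrMr// mul1r; lra.
Qed.

Lemma mu_S l : mu l.+1 <= mu l.
Proof.
have B1 : 1 <= B := Bmove_ge1 th1; have G8 := Gmu_ge8.
have G1 : 1 <= Gmu by lra.
have /andP[m0 m1] := mu_bounds l.
have q1 : mu l / Gmu <= mu l by rewrite ler_pdivrMr ?ler_peMr//; lra.
have q0 : 0 <= mu l / Gmu by rewrite divr_ge0; lra.
by rewrite /= (le_trans _ q1)// exprS ler_piMr// exprn_ile1//; lra.
Qed.

Lemma mu_anti : {homo mu : l k / (l <= k)%N >-> k <= l}.
Proof.
move=> l k /subnK <-; elim: (k - l)%N => [//|n IH].
exact: le_trans (mu_S _) IH.
Qed.

(** The reason for the fourth power in [mu]: the estimates contain [mu l.+1] to the power
    [1 / 2 - th], which is at least [1 / 4] because [th <= 1 / 4]. *)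
Lemma mu_root l : mu l.+1 `^ (1 / 4) = mu l / Gmu.
Proof.
have B1 : 1 <= B := Bmove_ge1 th1; have G8 := Gmu_ge8.
have /andP[m0 m1] := mu_bounds l.
have q0 : 0 <= mu l / Gmu by rewrite divr_ge0//; lra.
by rewrite /= -powR_mulrn// -powRrM div1r mulfV// powRr1.
Qed.

(** Meant for the smallest block: one more site multiplies its total by at least [(2 * B)^2]. As
    [2 * (th - 1) <= -1], this divides the cost by at least [2 * B], which beats the factor [B] of a
    move. *)
Lemma mu_ratio l : (2 * B) ^+ 2 * mu l.+1 <= mu l.
Proof.
have B1 : 1 <= B := Bmove_ge1 th1; have G8 := Gmu_ge8.
have G0 : 0 < Gmu by lra.
have /andP[m0 m1] := mu_bounds l.
have r0 : 0 <= mu l / Gmu by rewrite divr_ge0//; lra.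
have r1 : 2 * B * (mu l / Gmu) <= mu l.
  by rewrite mulrCA ger_pMr// ler_pdivrMr// mul1r; lra.
have -> : (2 * B) ^+ 2 * mu l.+1 = (2 * B * (mu l / Gmu)) ^+ 2 * (mu l / Gmu) ^+ 2.
  by rewrite /=; ring.
have r2 : mu l / Gmu <= 1 by rewrite ler_pdivrMr// mul1r; lra.
apply: (@le_trans _ _ (mu l ^+ 2 * 1)).
  apply: ler_pM; rewrite ?exprn_ge0//; first by rewrite mulr_ge0//; lra.
    by rewrite ler_sqr ?nnegrE ?(ltW m0)// mulr_ge0//; lra.
  exact: exprn_ile1.
by rewrite mulr1 expr2 ger_pMr.
Qed.

End low_energy.

Lemma predn_sub2 a b : (a.+1 < b)%N -> (b - a).-1 = (b - a).-2.+1.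
Proof. by lia. Qed.

Lemma blk_len_le n a b : (0 < a)%N -> (b < n.+2)%N -> ((b - a).-1 <= n)%N.
Proof. by lia. Qed.

(** * Drift of the low-energy cost *)

Section low_energy_drift.
Context {R : realType} {N : nat}.
Variables (TL TR K : R).
Hypotheses (N0 : (0 < N)%N) (TL0 : 0 < TL) (TR0 : 0 < TR) (K1 : 1 <= K).
Variable th : R.
Hypothesis th01 : 0 < th <= 1 / 4.
Local Notation X := (N.-tuple R).
Local Notation site := (@site R N TL TR).
Local Notation orthant := (@orthant R N).
Local Notation blk := (@blk R N TL TR).
Local Notation blkpow := (@blkpow R N TL TR th).
Local Notation erate := (@erate R N TL TR K).
Local Notation Q := (@Qop R N TL TR K).
Local Notation B := (@Bmove R th).
Local Notation mu := (@mu R N th).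
Local Notation G := (@Gmu R N th).
Local Notation M := (@Mpairs R N).
Local Notation gain := (@block_gain R N TL TR K th).
Implicit Types (x : X).

Let t0 : 0 < th. Proof. by case/andP: th01. Qed.
Let t4 : th <= 1 / 4. Proof. by case/andP: th01. Qed.
Let th1 : 0 < th < 1. Proof. by have := t0; have := t4; move=> *; apply/andP; split; lra. Qed.

(* [I] stands for the block of sites [l] with [I.1 <= l < I.2]; the baths, i.e. the sites
   [0] and [N.+1], belong to no block. *)
Definition isblk (I : 'I_N.+2 * 'I_N.+2) := (0 < I.1 < I.2)%N.

(** In contrast to [Vfun], whose exponents depend on the block length, every block has the exponent
    [th - 1]; lengths are told apart by the weights instead. *)
Definition lenergy x : R := \sum_(I : 'I_N.+2 * 'I_N.+2 | isblk I)
  (mu (I.2 - I.1).-1)^-1 * blk x I.1 I.2 `^ (th - 1).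

Let Tm : R := Num.min TL TR.
(** The exponent of an exchange rate [s^(1/2)] times a cost [s^(th - 1)]. *)
Let hs : R := th - 1 / 2.

Lemma min_block x : exists i j, [/\ (0 < i < j)%N, (j <= N.+1)%N &
  forall a b, (0 < a < b)%N -> (b <= N.+1)%N ->
    mu (j - i).-1 * blk x i j <= mu (b - a).-1 * blk x a b].
Proof.
have i1 : (1 < N.+2)%N by lia.
have i2 : (2 < N.+2)%N by lia.
have I0 : isblk (Ordinal i1, Ordinal i2) by [].
have [[i j] /= Pij Hmin] := arg_minP (fun I : 'I_N.+2 * 'I_N.+2 =>
   mu (I.2 - I.1).-1 * blk x I.1 I.2) I0.
exists i, j; split => //; first by rewrite -ltnS.
move=> a b ab bN.
have aN' : (a < N.+2)%N by lia.
have bN' : (b < N.+2)%N by lia.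
exact: (Hmin (Ordinal aN', Ordinal bN')).
Qed.

Lemma sum_pairs_cst (z : R) : M * z = \sum_(I : 'I_N.+2 * 'I_N.+2) z.
Proof. by rewrite /Mpairs mulr_natl sumr_const. Qed.

Section fixed_state.
Variables (x : X) (i j : nat).
Hypotheses (Dx : orthant x) (i0 : (0 < i)%N) (ij : (i < j)%N) (jN : (j <= N.+1)%N).
Hypothesis Hmin : forall a b, (0 < a < b)%N -> (b <= N.+1)%N ->
    mu (j - i).-1 * blk x i j <= mu (b - a).-1 * blk x a b.
Local Notation s := (blk x i j).
Local Notation m := (mu (j - i).-1).
Local Notation q := (s `^ hs).

Let s0 : 0 < s. Proof. exact: blk_gt0. Qed.
Let m0 : 0 < m. Proof. by case/andP: (mu_bounds (N := N) th01 (j - i).-1). Qed.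
Let m1 : m <= 1. Proof. by case/andP: (mu_bounds (N := N) th01 (j - i).-1). Qed.
Let hs0 : hs <= 0. Proof. by have := t4; rewrite /hs; lra. Qed.
Let G8 : 8 * B <= G. Proof. exact: Gmu_ge8. Qed.
Let B1 : 1 <= B. Proof. exact: Bmove_ge1. Qed.

Let Tm0 : 0 < Tm. Proof. by rewrite /Tm lt_min TL0. Qed.

(** If the enlarged block contains a bath, its total is at least [Tm]. Otherwise it is itself a
    block, minimality gives it at least [m * s / mu (b - a).-1], and [mu_root] produces the small
    factor. Here [(b - a).-2] is the weight index of the block before it was enlarged by one
    site. *)
Lemma ext_block_le a b : (a.+1 < b)%N -> (b <= N.+2)%N ->
  blk x a b `^ hs <= Tm `^ hs + q * m `^ (- (1 / 2)) * (mu (b - a).-2 / G).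
Proof.
move=> ab bN.
have [G8' B1'] := (G8, B1).
have G0 : 0 < G by lra.
have /andP[mu0 mu1] := mu_bounds (N := N) th01 (b - a).-2.
have r0 : 0 <= q * m `^ (- (1 / 2)) * (mu (b - a).-2 / G).
  apply: mulr_ge0; first by apply: mulr_ge0; exact: powR_ge0.
  by apply: divr_ge0; exact: ltW.
have T0 := powR_ge0 Tm hs.
have [a0|a0] := posnP a.
  suff : blk x a b `^ hs <= Tm `^ hs by lra.
  apply: powR_anti => //; rewrite a0.
  apply: (@le_trans _ _ (site x 0)); first by rewrite /Tm ge_min lexx.
  by apply: site_le_blk => //; rewrite leqnn (ltn_trans _ ab).
have [bN'|bN'] := eqVneq b N.+2.
  suff : blk x a b `^ hs <= Tm `^ hs by lra.
  apply: powR_anti => //; rewrite bN'.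
  apply: (@le_trans _ _ (site x N.+1)); first by rewrite siteS ltnn /Tm ge_min lexx orbT.
  by apply: site_le_blk => //; rewrite ltnSn andbT; move: ab; rewrite bN'; exact: ltnW.
have ba := predn_sub2 ab.
have H : m * s <= mu (b - a).-1 * blk x a b by apply: Hmin; rewrite ?a0 ?(ltnW ab)// -ltnS ltn_neqAle bN' bN.
rewrite ba in H.
set l := (b - a).-2 in mu0 mu1 r0 ba H *.
have /andP[ml0 ml1] := mu_bounds (N := N) th01 l.+1.
have : blk x a b `^ hs <= (m * s / mu l.+1) `^ hs.
  apply: powR_anti => //; first by rewrite divr_gt0// mulr_gt0.
  by rewrite ler_pdivrMr// [leRHS]mulrC.
have -> : (m * s / mu l.+1) `^ hs = q * m `^ hs * mu l.+1 `^ (- hs).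
  have mi : 0 <= (mu l.+1)^-1 by rewrite invr_ge0 ltW.
  rewrite powRM ?mulr_ge0 ?(ltW m0) ?(ltW s0)// powRM ?(ltW m0) ?(ltW s0)//.
  by rewrite (mulrC (m `^ hs)) -[(mu l.+1)^-1]powR_inv1 ?(ltW ml0)// -powRrM mulN1r.
move=> h1; suff : q * m `^ hs * mu l.+1 `^ (- hs) <= q * m `^ (- (1 / 2)) * (mu l / G) by lra.
rewrite -!mulrA ler_wpM2l ?powR_ge0//.
apply: ler_pM; rewrite ?powR_ge0//.
  by apply: ger_powR; [rewrite m0 m1|rewrite /hs; have := t0; lra].
rewrite -(mu_root th01); apply: ger_powR; first by rewrite ml0 ml1.
by rewrite /hs; have := t4; lra.
Qed.

Lemma erate_le a k b : (a <= k)%N -> (k < b)%N -> erate x k <= blk x a b `^ (1 / 2).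
Proof.
move=> ak kb; have b0 : 0 < blk x a b by apply: blk_gt0 => //; exact: leq_ltn_trans kb.
rewrite div1r powR12_sqrt ?(ltW b0)// /erate /rate ge_min; apply/orP; right.
apply: ler_wsqrtr; rewrite ge_min; apply/orP; left.
by apply: site_le_blk => //; rewrite ak.
Qed.

Lemma side_gain_le a k b (f : R) : (a <= k)%N -> (k < b)%N -> 0 <= f ->
  erate x k * (B * blk x a b `^ (th - 1) - f) <= B * blk x a b `^ hs.
Proof.
move=> ak kb f0; have b0 : 0 < blk x a b by apply: blk_gt0 => //; exact: leq_ltn_trans kb.
have r0 := rate_ge0 K1 (site x k) (site x k.+1).
have p0 := powR_ge0 (blk x a b) (th - 1).
have B0 : 0 <= B by have := B1; lra.
apply: (@le_trans _ _ (erate x k * (B * blk x a b `^ (th - 1)))).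
  by rewrite ler_wpM2l//; lra.
rewrite mulrCA ler_wpM2l//.
have -> : blk x a b `^ hs = blk x a b `^ (1 / 2) * blk x a b `^ (th - 1).
  rewrite -powRD; first by congr (_ `^ _); rewrite /hs; lra.
  by apply/implyP => _; rewrite gt_eqF.
by rewrite ler_wpM2r// erate_le.
Qed.

(** Dividing by [mu l] cancels the [mu l] of [ext_block_le], and [Gmu] leaves [1 / (8 * M)]: the
    bound is the same for all blocks. *)
Lemma weighted_side_le a k b c l (f : R) : (a <= k)%N -> (k < b)%N -> 0 <= f ->
  (a.+1 < b)%N -> (b <= N.+2)%N -> (b - a).-2 = l -> c = mu l -> (l <= N)%N ->
  c^-1 * (erate x k * (B * blk x a b `^ (th - 1) - f)) <=
  B * Tm `^ hs / mu N + q * m `^ (- (1 / 2)) / (8 * M).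
Proof.
move=> ak kb f0 ab bN bal -> lN.
have /andP[ml0 ml1] := mu_bounds (N := N) th01 l.
have /andP[mN0 mN1] := mu_bounds (N := N) th01 N.
have B0 : 0 <= B by have := B1; lra.
have M1 := Mpairs_ge1 (R := R) (N := N).
apply: (@le_trans _ _ ((mu l)^-1 * (B * (Tm `^ hs + q * m `^ (- (1 / 2)) * (mu l / G))))).
  rewrite ler_wpM2l ?invr_ge0 ?(ltW ml0)//.
  apply: (le_trans (side_gain_le ak kb f0)); rewrite ler_wpM2l//.
  by have := ext_block_le ab bN; rewrite bal.
rewrite mulrDr mulrDr; apply: lerD.
  rewrite [leLHS]mulrC; apply: ler_wpM2l.
    by apply: mulr_ge0 => //; exact: powR_ge0.
  by rewrite lef_pV2 ?posrE//; exact: mu_anti.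
rewrite le_eqVlt; apply/orP; left; apply/eqP.
rewrite /Gmu; field.
by rewrite !gt_eqF//; have := B1; lra.
Qed.

(** Below this threshold a bath beside the smallest block is richer than it by the factor
    [(2 * B)^2], and [K >= 1] does not cut the lower bound [(m * s)^(1/2)] on the rate. *)
Definition small_sum : R := Num.min 1 (Tm / (2 * B) ^+ 2).

Lemma small_sum_gt0 : 0 < small_sum.
Proof.
have B1' := B1.
by rewrite /small_sum lt_min ltr01/= divr_gt0// exprn_gt0//; lra.
Qed.

Let small_sumT : s <= small_sum -> s <= Tm /\ (2 * B) ^+ 2 * s <= Tm.
Proof.
have B1' := B1.
have B2 : 1 <= (2 * B) ^+ 2 by rewrite exprn_ege1//; lra.
rewrite /small_sum le_min => /andP[_].
rewrite ler_pdivlMr; last lra.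
move=> h; have s0' := s0; split; last by rewrite mulrC.
by apply: le_trans h; rewrite ler_peMr// ltW.
Qed.

(** Both ends of the edge carry at least [m * s]: a single site is a block with [mu 0 = 1], to which
    minimality applies, and a bath has at least [s]. *)
Lemma erate_left_ge : s <= small_sum -> (m * s) `^ (1 / 2) <= erate x i.-1.
Proof.
move=> ssm; have [sT _] := small_sumT ssm.
have ms0 : 0 < m * s by rewrite mulr_gt0.
have mss : m * s <= s by rewrite ger_pMl.
have s1 : s <= 1 by move: ssm; rewrite /small_sum le_min => /andP[].
have Hsite l : (0 < l <= N)%N -> m * s <= site x l.
  move=> /andP[l0 lN]; have : m * s <= mu (l.+1 - l).-1 * blk x l l.+1.
    by apply: Hmin; rewrite ?l0 ?ltnSn.
  by rewrite subSnn/= mul1r /blk big_nat1.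
rewrite div1r powR12_sqrt ?(ltW ms0)// /erate /rate le_min; apply/andP; split.
  apply: le_trans K1; rewrite -(sqrtr1 R); apply: ler_wsqrtr; lra.
apply: ler_wsqrtr; rewrite le_min prednK//; apply/andP; split; last first.
  by apply: Hsite; rewrite i0 -ltnS (leq_trans ij).
have [i10|i10] := posnP i.-1.
  by rewrite i10 (le_trans mss)// (le_trans sT)// /Tm ge_min lexx.
by apply: Hsite; rewrite i10 (leq_trans (leq_pred _))// -ltnS (leq_trans ij).
Qed.

(** The left edge alone suffices. The enlarged block has at least [(2 * B)^2 * s], by minimality and
    [mu_ratio] or because of the bath, so an exchange at least halves the expected cost; this is
    multiplied by the rate [(m * s)^(1/2)] and the weight [1 / m]. *)
Lemma left_gain_le : s <= small_sum ->
  m^-1 * (erate x i.-1 * (B * blk x i.-1 j `^ (th - 1) - s `^ (th - 1))) <=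
  - (1 / 2 * (q * m `^ (- (1 / 2)))).
Proof.
move=> ssm; have [sT M0T] := small_sumT ssm.
have B1' := B1.
have B2 : 0 < (2 * B) ^+ 2 by rewrite exprn_gt0//; lra.
have i1 : i.-1.+1 = i by rewrite prednK.
have bl : (2 * B) ^+ 2 * s <= blk x i.-1 j.
  have [i10|i10] := posnP i.-1.
    apply: (le_trans M0T); rewrite i10.
    apply: (@le_trans _ _ (site x 0)); first by rewrite /Tm ge_min lexx.
    by apply: site_le_blk => //; rewrite leqnn (ltn_trans i0 ij).
  have H : m * s <= mu (j - i.-1).-1 * blk x i.-1 j.
    by apply: Hmin; rewrite ?i10 ?(leq_ltn_trans (leq_pred _) ij).
  have E : (j - i.-1).-1 = (j - i).-1.+1.
    by rewrite -[in RHS]i1 subnS; apply: predn_sub2; rewrite i1.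
  have /andP[l0 l1] := mu_bounds (N := N) th01 (j - i).-1.+1.
  rewrite E in H; rewrite -(ler_pM2l l0); apply: le_trans H.
  by rewrite mulrA ler_pM2r// mulrC mu_ratio.
have p0 : 0 < s `^ (th - 1) by exact: powR_gt0.
have hB : B * blk x i.-1 j `^ (th - 1) <= 1 / 2 * s `^ (th - 1).
  apply: (@le_trans _ _ (B * ((2 * B) ^+ 2 * s) `^ (th - 1))).
    rewrite ler_wpM2l//; first lra.
    by apply: powR_anti => //; [have := t4; lra|exact: mulr_gt0].
  rewrite powRM ?(ltW B2) ?(ltW s0)// mulrA ler_pM2r//.
  rewrite -powR_mulrn; last lra.
  rewrite -powRrM.
  apply: (@le_trans _ _ (B * (2 * B) `^ (-1))).
    rewrite ler_wpM2l//; first lra.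
    by apply: ler_powR; [lra|have := t4; lra].
  rewrite powR_inv1; last lra.
  by rewrite invfM mulrCA mulfV ?mulr1 ?div1r// gt_eqF//; lra.
have er := erate_left_ge ssm.
have mi0 : 0 < m^-1 by rewrite invr_gt0.
apply: (@le_trans _ _ (m^-1 * ((m * s) `^ (1 / 2) * - (1 / 2 * s `^ (th - 1))))).
  rewrite ler_pM2l//.
  apply: (@le_trans _ _ (erate x i.-1 * - (1 / 2 * s `^ (th - 1)))).
    by apply: ler_wpM2l; [exact: rate_ge0|lra].
  by rewrite !mulrN lerN2 ler_wpM2r// mulr_ge0 ?(ltW p0)//; lra.
have -> : q = s `^ (1 / 2) * s `^ (th - 1).
  rewrite -powRD; first by congr (_ `^ _); rewrite /hs; lra.
  by apply/implyP => _; rewrite gt_eqF.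
have -> : m `^ (- (1 / 2)) = m^-1 * m `^ (1 / 2).
  rewrite -[m^-1]powR_inv1 ?(ltW m0)// -powRD; first by congr (_ `^ _); lra.
  by apply/implyP => _; rewrite gt_eqF.
rewrite powRM ?(ltW m0) ?(ltW s0)//.
by rewrite le_eqVlt; apply/orP; left; apply/eqP; ring.
Qed.

Lemma minus_side_le I : isblk I ->
  (mu (I.2 - I.1).-1)^-1 *
    (erate x I.1.-1 * (B * blk x I.1.-1 I.2 `^ (th - 1) - blk x I.1 I.2 `^ (th - 1))) <=
  B * Tm `^ hs / mu N + q * m `^ (- (1 / 2)) / (8 * M).
Proof.
case: I => -[a aN] [b bN]; rewrite /isblk /= => /andP[a0 ab].
have a1 : a.-1.+1 = a by rewrite prednK.
apply: (@weighted_side_le a.-1 a.-1 b _ (b - a).-1) => //.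
- by rewrite (leq_ltn_trans _ ab) ?leq_pred.
- exact: powR_ge0.
- by rewrite a1.
- exact: ltnW.
- by rewrite -[in RHS]a1 subnS.
- exact: blk_len_le.
Qed.

Lemma plus_side_le I : isblk I ->
  (mu (I.2 - I.1).-1)^-1 *
    (erate x I.2.-1 * (B * blk x I.1 I.2.+1 `^ (th - 1) - blk x I.1 I.2 `^ (th - 1))) <=
  B * Tm `^ hs / mu N + q * m `^ (- (1 / 2)) / (8 * M).
Proof.
case: I => -[a aN] [b bN]; rewrite /isblk /= => /andP[a0 ab].
have b1 : b.-1.+1 = b by rewrite prednK// (ltn_trans a0).
apply: (@weighted_side_le a b.-1 b.+1 _ (b - a).-1) => //.
- by rewrite -ltnS b1.
- by rewrite b1.
- exact: powR_ge0.
- by rewrite subSn// ltnW.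
- exact: blk_len_le.
Qed.

Definition gain_cst : R :=
  2 * M * (B * Tm `^ hs / mu N) + small_sum `^ hs * mu N `^ (- (1 / 2)).

(** In the unit [w = q * m^(-1/2)], the left edge of the smallest block lowers the cost by [w / 2],
    while all other contributions add up to at most [w / 4] plus a constant; [m <= 1] gives
    [w >= q]. If [s] exceeds [small_sum], then [w] is bounded and [gain_cst] absorbs it. *)
Lemma total_gain_le :
  \sum_(I : 'I_N.+2 * 'I_N.+2 | isblk I) (mu (I.2 - I.1).-1)^-1 * gain x I.1 I.2 <=
  gain_cst - 1 / 4 * q.
Proof.
have iN : (i < N.+2)%N by rewrite (ltn_trans ij).
pose J := (Ordinal iN, Ordinal (jN : (j < N.+2)%N)).
have PJ : isblk J by rewrite /isblk /= i0.
set w := q * m `^ (- (1 / 2)).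
pose c1 := B * Tm `^ hs / mu N.
have M1 := Mpairs_ge1 (R := R) (N := N).
have /andP[mN0 mN1] := mu_bounds (N := N) th01 N.
have q0 := powR_ge0 s hs.
have w0 : 0 <= w by rewrite mulr_ge0 ?powR_ge0.
have z0 : 0 <= w / (8 * M) by rewrite divr_ge0//; lra.
have c10 : 0 <= c1.
  apply: divr_ge0; [apply: mulr_ge0|exact: ltW]; last exact: powR_ge0.
  by have := B1; lra.
pose c3 := small_sum `^ hs * mu N `^ (- (1 / 2)).
have c30 : 0 <= c3 by rewrite mulr_ge0 ?powR_ge0.
have leftJ : m^-1 * (erate x i.-1 * (B * blk x i.-1 j `^ (th - 1) - s `^ (th - 1))) <=
    c1 + w / (8 * M) + (c3 - 1 / 2 * w).
  have [ssm|ssm] := leP s small_sum.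
    by have := left_gain_le ssm; rewrite -/w; lra.
  apply: (le_trans (minus_side_le PJ)); rewrite -/w -/c1 lerDl.
  suff : w <= c3 by lra.
  apply: ler_pM; rewrite ?powR_ge0//.
    by apply: powR_anti => //; [exact: small_sum_gt0|exact: ltW].
  apply: powR_anti => //.
  by apply: mu_anti => //; exact: blk_len_le.
have genI I : isblk I -> (mu (I.2 - I.1).-1)^-1 * gain x I.1 I.2 <=
    2 * (c1 + w / (8 * M)) + (if I == J then c3 - 1 / 2 * w else 0).
  move=> PI; have hm := minus_side_le PI; have hp := plus_side_le PI.
  rewrite /block_gain mulrDr -/w -/c1 in hm hp *.
  by case: (eqVneq I J) hm hp => [->|_] /=; [move: leftJ; lra|lra].
apply: (@le_trans _ _ (\sum_(I : 'I_N.+2 * 'I_N.+2 | isblk I)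
    (2 * (c1 + w / (8 * M)) + (if I == J then c3 - 1 / 2 * w else 0)))).
  exact: ler_sum.
rewrite big_split/= -big_mkcondr/= [X in _ + X](big_pred1 J); last first.
  move=> I; rewrite [pred1 _ _]/=; have [->|_] := eqVneq I J; last by rewrite andbF.
  by rewrite PJ.
apply: (@le_trans _ _ (M * (2 * (c1 + w / (8 * M))) + (c3 - 1 / 2 * w))).
  rewrite lerD2r [leLHS]big_mkcond sum_pairs_cst.
  by apply: ler_sum => I _; case: ifP => // _; lra.
have -> : M * (2 * (c1 + w / (8 * M))) = 2 * M * c1 + 1 / 4 * w.
  by field; rewrite gt_eqF//; lra.
have : q <= w.
  rewrite /w ler_peMr//.
  rewrite -[leLHS](powRr0 m); apply: ger_powR; first by rewrite m0 m1.
  lra.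
by rewrite /gain_cst -/c1 -/c3; lra.
Qed.

Definition lenergy_cst : R := M * ((mu N)^-1 * mu N `^ (th - 1)).

(** By minimality every block has total at least [mu N * s], so one power of [s] controls the whole
    sum. This converts a gain in terms of [s] into one in terms of [lenergy]. *)
Lemma lenergy_le : lenergy x <= lenergy_cst * s `^ (th - 1).
Proof.
have /andP[mN0 mN1] := mu_bounds (N := N) th01 N.
have mle l : (l <= N)%N -> mu N <= mu l by exact: mu_anti.
have jiN : ((j - i).-1 <= N)%N.
  exact: blk_len_le.
have p0 := powR_ge0 s (th - 1); have pN := powR_ge0 (mu N) (th - 1).
rewrite /lenergy_cst -mulrA sum_pairs_cst /lenergy big_mkcond.
apply: ler_sum => -[[a aN] [b bN]] _; rewrite /isblk /=.
case: ifP => [/andP[a0 ab]|_]; last by rewrite !mulr_ge0// invr_ge0 ltW.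
have baN : ((b - a).-1 <= N)%N.
  exact: blk_len_le.
have /andP[mb0 mb1] := mu_bounds (N := N) th01 (b - a).-1.
rewrite -mulrA; apply: ler_pM; rewrite ?powR_ge0 ?invr_ge0 ?(ltW mb0)//.
  by rewrite lef_pV2 ?posrE// mle.
rewrite -powRM ?(ltW mN0) ?(ltW s0)//; apply: powR_anti; first by have := t4; lra.
  exact: mulr_gt0.
have H : m * s <= mu (b - a).-1 * blk x a b by apply: Hmin; rewrite ?a0.
have bab := blk_gt0 TL0 TR0 Dx ab.
apply: (@le_trans _ _ (m * s)); first by rewrite ler_pM2r// mle.
by apply: (le_trans H); rewrite ger_pMl.
Qed.

End fixed_state.

(** Solves [(s^(th - 1))^alpha = s^(th - 1 / 2)]. *)
Definition alpha : R := (1 / 2 - th) / (1 - th).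

Lemma measurable_lenergy : measurable_fun setT lenergy.
Proof.
rewrite /lenergy; under eq_fun do rewrite big_mkcond.
apply: measurable_sum => I; case: (isblk I) => //; apply: measurable_funM => //.
by apply: (measurableT_comp (measurable_pow th)); exact: measurable_blk.
Qed.

Lemma lenergy_ge0 x : 0 <= lenergy x.
Proof.
apply: sumr_ge0 => I _; rewrite mulr_ge0 ?powR_ge0// invr_ge0.
by case/andP: (mu_bounds (N := N) th01 (I.2 - I.1).-1) => /ltW.
Qed.

Theorem lenergy_drift : exists c b, [/\ 0 < c, 0 <= b &
  forall x, orthant x ->
    (Q (EFin \o lenergy) x <= (lenergy x - c * lenergy x `^ alpha + b)%:E)%E].
Proof.
have l0 : 0 < lam N K by exact: lam_gt0.
have /andP[mN0 mN1] := mu_bounds (N := N) th01 N.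
have M1 := Mpairs_ge1 (R := R) (N := N).
have C0 : 0 < lenergy_cst.
  by rewrite mulr_gt0// ?mulr_gt0 ?invr_gt0 ?powR_gt0//; lra.
have [t0' t4'] := (t0, t4).
have a0 : 0 <= alpha by rewrite divr_ge0; lra.
exists (1 / 4 * lenergy_cst `^ (- alpha) / lam N K), (gain_cst / lam N K).
have sm0 := small_sum_gt0.
have B1' := Bmove_ge1 th1.
split.
- by rewrite divr_gt0// mulr_gt0 ?powR_gt0//; lra.
- apply: divr_ge0; last exact: ltW.
  apply: addr_ge0; last by apply: mulr_ge0; exact: powR_ge0.
  apply: mulr_ge0; first lra.
  apply: divr_ge0; [apply: mulr_ge0; [lra|exact: powR_ge0]|exact: ltW].
move=> x Dx.
have [i [j [/andP[i0 ij] jN Hmin]]] := min_block x.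
have HL := markov_on (Qop_markov N0 TL0 TR0 K1) Dx.
have [nsum Lsum] := posfun_sum (index_enum _) isblk HL
  (c := fun I : 'I_N.+2 * 'I_N.+2 => (mu (I.2 - I.1).-1)^-1)
  (f := fun I => blkpow I.1 I.2)
  (fun I => ltac:(by rewrite invr_ge0; case/andP: (mu_bounds (N := N) th01 (I.2 - I.1).-1) => /ltW))
  (fun I => blkpow_nnmf TL TR th I.1 I.2).
rewrite (_ : EFin \o lenergy = (fun x => \sum_(I <- index_enum _ | isblk I)
    ((mu (I.2 - I.1).-1)^-1)%:E * blkpow I.1 I.2 x)%E); last first.
  by apply/funext => y; rewrite /= /lenergy -sumEFin; apply: eq_bigr => I _; rewrite EFinM.
rewrite Lsum.
apply: (@le_trans _ _ (lenergy x + (\sum_(I : 'I_N.+2 * 'I_N.+2 | isblk I)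
    (mu (I.2 - I.1).-1)^-1 * gain x I.1 I.2) / lam N K)%:E).
  rewrite /lenergy mulr_suml -big_split/= -sumEFin; apply: lee_sum => -[[a aN] [b bN]].
  rewrite /isblk /= => ab.
  have /andP[mb0 mb1] := mu_bounds (N := N) th01 (b - a).-1.
  rewrite -mulrA -mulrDr EFinM lee_wpmul2l ?lee_fin ?invr_ge0 ?(ltW mb0)//.
  exact: Q_blkpow_le.
rewrite lee_fin -addrA lerD2l.
have tg := total_gain_le Dx i0 ij jN Hmin.
have lle := lenergy_le Dx i0 ij jN Hmin.
have lx0 := lenergy_ge0 x.
have s0 := blk_gt0 TL0 TR0 Dx ij.
set s := blk x i j in tg lle s0 *.
have qle : lenergy_cst `^ (- alpha) * lenergy x `^ alpha <= s `^ hs.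
  rewrite powRN mulrC ler_pdivrMr ?powR_gt0//.
  have -> : s `^ hs = (s `^ (th - 1)) `^ alpha.
    by rewrite -powRrM /alpha /hs; congr (_ `^ _); field; lra.
  rewrite -powRM ?powR_ge0 ?(ltW C0)// [in leRHS]mulrC.
  apply: ge0_ler_powR => //; rewrite nnegrE //.
  by apply: mulr_ge0; [exact: ltW|exact: powR_ge0].
have -> : - (1 / 4 * lenergy_cst `^ (- alpha) / lam N K * lenergy x `^ alpha) + gain_cst / lam N K =
  (gain_cst - 1 / 4 * (lenergy_cst `^ (- alpha) * lenergy x `^ alpha)) / lam N K by ring.
by rewrite ler_pM2r ?invr_gt0//; lra.
Qed.

End low_energy_drift.

(** * Total energy *)

Section energy.
Context {R : realType} {N : nat}.
Variables (TL TR K : R).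
Hypotheses (N0 : (0 < N)%N) (TL0 : 0 < TL) (TR0 : 0 < TR) (K1 : 1 <= K).
Local Notation X := (N.-tuple R).
Local Notation mR := (measurableTypeR R).
Local Notation site := (@site R N TL TR).
Local Notation move := (@move R N TL TR).
Local Notation orthant := (@orthant R N).
Local Notation blk := (@blk R N TL TR).
Local Notation erate := (@erate R N TL TR K).
Local Notation Q := (@Qop R N TL TR K).
Implicit Types (x : X).

Definition Ebath (T : R) (h : mR * mR -> \bar R) : \bar R :=
  Eunif (fun p => Eexp T (fun y => h (p, y))).

Lemma Ebath_posfun T : 0 < T ->
  posfun ([set` `]0, 1[] `*` [set` `]0, +oo[] : set (mR * mR)) (Ebath T).
Proof.
move=> T0; exact: (posfun_prod Eunif_posfun (Eexp_posfun T0)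
  (fun h => @Eexp_nnmf R T T0 _ mR h)).
Qed.

Lemma nnmf_norm : nnmf (fun y : mR => (`|y|)%:E).
Proof. by apply: (nnmf_EFin (u := fun y : mR => `|y|)) => //; exact: normr_measurable. Qed.

(** By [y <= 2T exp (y / 2T)]; multiplying the density of mean [T] by [exp (y / 2T)] gives twice the
    density of mean [2T]. *)
Lemma Eexp_norm_le (T : R) : 0 < T -> (Eexp T (fun y : mR => (`|y|)%:E) <= (4 * T)%:E)%E.
Proof.
move=> T0; have T20 : 0 < 2 * T by lra.
have me (c : R) : measurable_fun setT (fun y : mR => expR (y / c)).
  by apply: measurableT_comp => //; exact: measurable_funM.
have ne : nnmf (fun y : mR => (expR (y / (2 * T)))%:E).
  by apply: (nnmf_EFin (u := fun y : mR => expR (y / (2 * T)))) => // y; exact: expR_ge0.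
apply: (@le_trans _ _ (Eexp T (fun y => (2 * T)%:E * (expR (y / (2 * T)))%:E))%E).
  apply: (posfun_le (Eexp_posfun T0)).
  - exact: nnmf_norm.
  - exact: (nnmfZ (ltW T20) ne).
  - move=> y; rewrite /= in_itv/= andbT => y0; rewrite -EFinM lee_fin ger0_norm ?(ltW y0)//.
    rewrite [leRHS]mulrC -ler_pdivrMr//.
    by apply: le_trans (expR_ge1Dx _); rewrite lerDr.
rewrite (posfunZ (Eexp_posfun T0) (ltW T20) ne).
have -> : 4 * T = 2 * T * 2 by ring.
rewrite [leRHS]EFinM; apply: lee_wpmul2l; first by rewrite lee_fin ltW.
have <- : (2%:E * 1%:E = 2%:E :> \bar R)%E by rewrite -EFinM mulr1.
rewrite -(integral_expdens T20) -ge0_integralZl_EFin//; last 2 first.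
- by move=> y _; rewrite lee_fin expdens_ge0.
- by apply: measurable_funTS; apply/measurable_EFinP; exact: measurable_expdens.
rewrite le_eqVlt; apply/orP; left; apply/eqP; apply: eq_integral => y _.
rewrite -!EFinM /expdens; congr EFin.
have -> : - (y / (2 * T)) = - (y / T) + y / (2 * T) by field; rewrite gt_eqF.
by rewrite expRD; field; rewrite gt_eqF.
Qed.

Lemma Ebath_norm_le (T : R) : 0 < T -> (Ebath T (fun z => (`|z.2|)%:E) <= (4 * T)%:E)%E.
Proof.
move=> T0; have T40 : 0 <= 4 * T by lra.
rewrite /Ebath -(posfun_cst Eunif_posfun T40).
apply: (posfun_le Eunif_posfun).
- split => [|p]; last exact: (posfun_ge0 (Eexp_posfun T0) nnmf_norm).
  exact: (measurable_cst (Eexp T (fun y : mR => (`|y|)%:E))).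
- exact: nnmf_cst.
- by move=> p _; exact: Eexp_norm_le.
Qed.

(* The absolute value only serves to make the total energy nonnegative off the orthant. *)
Definition energy x : R := `|blk x 1 N.+1|.

Lemma energyE x : orthant x -> energy x = blk x 1 N.+1.
Proof. by move=> Dx; rewrite /energy ger0_norm//; exact: blk_ge0. Qed.

Lemma measurable_energy : measurable_fun setT energy.
Proof. exact: (measurableT_comp (@normr_measurable R setT) (measurable_blk _ _ _ _)). Qed.

Lemma energy_ge0 x : 0 <= energy x. Proof. exact: normr_ge0. Qed.

Lemma E_le_energy x j : orthant x -> (j < N)%N -> E x j <= energy x.
Proof.
move=> Dx jN; rewrite energyE//.
have -> : E x j = site x j.+1 by rewrite siteS jN.
exact: site_le_blk.
Qed.

Lemma blk_upd1 x j a : (j < N)%N -> blk (upd1 x j a) 1 N.+1 = blk x 1 N.+1 - E x j + a.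
Proof.
move=> jN; have j1 : (1 <= j.+1)%N by [].
have j2 : (j.+1 < N.+1)%N by [].
rewrite !(blk_cat _ _ _ j1 (ltnW j2)) !(blk_recl _ _ _ j2) site_upd1// eqxx siteS jN.
rewrite (@blk_eq _ _ _ _ (upd1 x j a) x 1) => [|l /andP[l1 lj]]; last first.
  by rewrite site_upd1// ltn_eqF.
rewrite (@blk_eq _ _ _ _ (upd1 x j a) x j.+2) => [|l /andP[l1 lj]]; last first.
  by rewrite site_upd1// gtn_eqF.
by ring.
Qed.

Lemma energy_bath x j p y : orthant x -> (j < N)%N -> 0 < p < 1 -> 0 < y ->
  energy (upd1 x j (p * (E x j + y))) <= energy x - (1 - p) * E x j + y.
Proof.
move=> Dx jN /andP[p0 p1] y0; have Ej := (orthantP x).1 Dx j jN.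
rewrite !energyE//; last by apply: orthant_upd1 => //; rewrite mulr_gt0// addr_gt0.
by rewrite blk_upd1//; nra.
Qed.

Lemma energy_exch x k p : orthant x -> (0 < k < N)%N -> 0 < p < 1 ->
  energy (upd2 x k.-1 (p * (E x k.-1 + E x k)) ((1 - p) * (E x k.-1 + E x k))) = energy x.
Proof.
move=> Dx k0N /andP[p0 p1]; have /andP[k0 kN] := k0N.
have S0 : 0 < E x k.-1 + E x k.
  by have /orthantP Ex := Dx; rewrite addr_gt0 ?Ex// (leq_ltn_trans (leq_pred _)).
rewrite !energyE//; last by apply: orthant_upd2 => //; rewrite mulr_gt0// subr_gt0.
have k2 : (k.+1 < N.+1)%N by [].
have k1 : (k < N.+1)%N by exact: ltnW.
rewrite !(blk_cat _ _ _ k0 (ltnW k1)) !(blk_recl _ _ _ k1) !(blk_recl _ _ _ k2).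
rewrite !exch_sites// !eqxx gtn_eqF//; congr (_ + _).
  by apply: blk_eq => l /andP[l1 lk]; rewrite exch_sites// !ltn_eqF// ltnW.
rewrite !addrA; congr (_ + _); first by ring.
by apply: blk_eq => l /andP[l1 lk]; rewrite exch_sites// !gtn_eqF// ltnW.
Qed.

Definition Cbath : R := 4 * TL + 4 * TR.

Lemma Cbath_ge0 : 0 <= Cbath.
Proof. by have [a b] := (TL0, TR0); rewrite /Cbath; lra. Qed.

(** A bath draw raises the energy by at most [y]; as [f <= 1], the term [y * f] costs at most the
    mean of [y], whatever the dependence between the energy and [f]. The factor [f] prepares for the
    product of [energy] and [weight] in [lyap]. *)
Lemma bath_energy_mul_le T j x (f : X -> \bar R) : orthant x -> (j < N)%N -> 0 < T -> nnmf f ->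
  (forall x', (f x' <= 1%:E)%E) ->
  (Ebath T (fun z => (energy (upd1 x j (z.1 * (E x j + z.2))))%:E *
       f (upd1 x j (z.1 * (E x j + z.2)))) <=
   (energy x)%:E * Ebath T (fun z => f (upd1 x j (z.1 * (E x j + z.2)))) + (4 * T)%:E)%E.
Proof.
move=> Dx jN T0 nf f1; have HL := Ebath_posfun T0.
have mu : measurable_fun setT (fun z : mR * mR => upd1 x j (z.1 * (E x j + z.2))).
  by apply: measurable_upd1 => //; apply: measurable_funM => //; exact: measurable_funD.
have nfu : nnmf (fun z : mR * mR => f (upd1 x j (z.1 * (E x j + z.2)))).
  by split => [|z]; [exact: (measurableT_comp (proj1 nf) mu)|case: nf].
have nab : nnmf (fun z : mR * mR => (`|z.2|)%:E).
  apply: (nnmf_EFin (u := fun z : mR * mR => `|z.2|)) => //.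
  exact: (measurableT_comp (@normr_measurable R setT) (@measurable_snd _ _ mR mR)).
have e0 := energy_ge0 x.
apply: (@le_trans _ _ (Ebath T (fun z => (energy x)%:E *
    f (upd1 x j (z.1 * (E x j + z.2))) + (`|z.2|)%:E))%E).
  apply: (posfun_le HL).
  - split; last by move=> z; rewrite mule_ge0 ?lee_fin ?energy_ge0//; case: nf.
    apply: emeasurable_funM; last by case: nfu.
    by apply/measurable_EFinP; exact: (measurableT_comp measurable_energy mu).
  - by apply: nnmfD => //; exact: nnmfZ.
  - move=> [p y] [/=]; rewrite !in_itv/= andbT => p01 y0.
    have h := energy_bath Dx jN p01 y0.
    have /andP[p0 p1] := p01; have Ej := (orthantP x).1 Dx j jN.
    have {}h : energy (upd1 x j (p * (E x j + y))) <= energy x + y by nra.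
    have := f1 (upd1 x j (p * (E x j + y))); have := proj2 nf (upd1 x j (p * (E x j + y))).
    case: (f _) => [r|//|//]; rewrite !lee_fin => r0 r1.
    have eu := energy_ge0 (upd1 x j (p * (E x j + y))).
    by rewrite ger0_norm ?(ltW y0)//; nra.
rewrite (posfunD HL (nnmfZ e0 nfu) nab) (posfunZ HL e0 nfu); apply: leeD2l.
exact: Ebath_norm_le.
Qed.

Lemma move_energy_mul_le k x (f : X -> \bar R) : orthant x -> (k <= N)%N -> nnmf f ->
  (forall x', (f x' <= 1%:E)%E) ->
  (move k (fun x' => (energy x')%:E * f x') x <= (energy x)%:E * move k f x + Cbath%:E)%E.
Proof.
move=> Dx kN nf f1; have [TL0' TR0'] := (TL0, TR0).
rewrite /move; case: (eqVneq k 0%N) => k0; [|case: (eqVneq k N) => kN'].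
- apply: (le_trans (bath_energy_mul_le Dx N0 TL0 nf f1)); apply: leeD2l.
  by rewrite lee_fin /Cbath; lra.
- have N1 : (N.-1 < N)%N by rewrite prednK.
  apply: (le_trans (bath_energy_mul_le Dx N1 TR0 nf f1)); apply: leeD2l.
  by rewrite lee_fin /Cbath; lra.
- have k0N : (0 < k < N)%N by rewrite lt0n k0 ltn_neqAle kN'.
  pose S := E x k.-1 + E x k.
  have mu : measurable_fun setT (fun p : mR => upd2 x k.-1 (p * S) ((1 - p) * S)).
    apply: measurable_upd2 => //; apply: measurable_funM => //.
    exact: measurable_funB.
  have nfu : nnmf (fun p : mR => f (upd2 x k.-1 (p * S) ((1 - p) * S))).
    by split => [|z]; [exact: (measurableT_comp (proj1 nf) mu)|case: nf].
  rewrite -(posfunZ Eunif_posfun (energy_ge0 x) nfu).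
  apply: le_trans (leeDl _ _); last by rewrite lee_fin Cbath_ge0.
  apply: (posfun_le Eunif_posfun).
  + split; last by move=> z; rewrite mule_ge0 ?lee_fin ?energy_ge0//; case: nf.
    apply: emeasurable_funM; last by case: nfu.
    by apply/measurable_EFinP; exact: (measurableT_comp measurable_energy mu).
  + exact: (nnmfZ (energy_ge0 x)).
  + by move=> p; rewrite /= in_itv/= => p01; rewrite energy_exch.
Qed.

Lemma weight_ge0 x : 0 <= 1 - (\sum_(k < N.+1) erate x k) / lam N K.
Proof. by rewrite subr_ge0 ler_pdivrMr ?lam_gt0// mul1r erate_sum_le. Qed.

(** One edge beats the common bound [U] by [g], and it is chosen with probability at least
    [c / lam]. *)
Lemma Q_move_le x (F : X -> \bar R) (c U g : R) k : orthant x -> (k <= N)%N -> nnmf F ->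
  0 <= g -> 0 <= c <= erate x k -> (F x <= U%:E)%E ->
  (forall k', (k' <= N)%N -> (move k' F x <= U%:E)%E) ->
  (move k F x <= (U - g)%:E)%E -> (Q F x <= (U - c / lam N K * g)%:E)%E.
Proof.
move=> Dx kN nF g0 /andP[c0 cr] FU HU Hk; rewrite QopE//.
have l0 : 0 < lam N K by exact: lam_gt0.
pose m (k' : nat) := U + (if k' == k then - g else 0).
apply: (@le_trans _ _ ((1 - (\sum_(k < N.+1) erate x k) / lam N K) * U +
    \sum_(k < N.+1) erate x k / lam N K * m k)%:E).
  rewrite [leRHS]EFinD (EFinM _ U) -sumEFin; apply: leeD.
    by apply: lee_wpmul2l => //; rewrite lee_fin weight_ge0.
  apply: lee_sum => i _; rewrite (EFinM _ (m i)); apply: lee_wpmul2l.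
    by rewrite lee_fin divr_ge0 ?rate_ge0// ltW.
  rewrite /m; case: eqP => [->//|_]; rewrite addr0; apply: HU.
  by rewrite -ltnS.
rewrite lee_fin.
have -> : \sum_(k < N.+1) erate x k / lam N K * m k =
    (\sum_(k < N.+1) erate x k) / lam N K * U - erate x k / lam N K * g.
  under eq_bigr do rewrite mulrDr.
  rewrite big_split/= -mulr_suml -mulr_suml; congr (_ + _).
  by rewrite (sum_ord_delta (fun k => erate x k / lam N K)) ?mulrN.
have : c / lam N K * g <= erate x k / lam N K * g.
  by rewrite ler_wpM2r// ler_pM2r ?invr_gt0.
lra.
Qed.

Lemma Q_move_ge x (F : X -> \bar R) (c : R) k : orthant x -> (k <= N)%N -> nnmf F ->
  0 <= c <= erate x k -> ((c / lam N K)%:E * move k F x <= Q F x)%E.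
Proof.
move=> Dx kN nF /andP[c0 cr]; rewrite QopE//.
have l0 : 0 < lam N K by exact: lam_gt0.
have m0 k' : (0 <= move k' F x)%E by case: (move_nnmf TL0 TR0 k' nF).
have e0 k' : 0 <= erate x k' / lam N K by rewrite divr_ge0 ?rate_ge0// ltW.
have -> : (\sum_(k' < N.+1) (erate x k' / lam N K)%:E * move k' F x =
    (erate x k / lam N K)%:E * move k F x +
    \sum_(k' < N.+1 | k' != Ordinal (kN : (k < N.+1)%N)) (erate x k' / lam N K)%:E * move k' F x)%E.
  by rewrite (bigD1 (Ordinal (kN : (k < N.+1)%N))).
rewrite addeCA.
apply: le_trans (leeDl _ _); last first.
  apply: adde_ge0; first by rewrite mule_ge0 ?lee_fin ?weight_ge0//; case: nF.
  by apply: sume_ge0 => i _; rewrite mule_ge0// lee_fin.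
by rewrite lee_wpmul2r// lee_fin ler_pM2r ?invr_gt0.
Qed.

Lemma Q_energy_mul_le x (f : X -> \bar R) : orthant x -> nnmf f ->
  (forall x', (f x' <= 1%:E)%E) ->
  (Q (fun x' => (energy x')%:E * f x') x <= (energy x)%:E * Q f x + Cbath%:E)%E.
Proof.
move=> Dx nf f1; rewrite !QopE//.
have l0 : 0 < lam N K by exact: lam_gt0.
have C0 := Cbath_ge0.
have e0 := energy_ge0 x.
have w0 := weight_ge0 x.
have r0 k' : 0 <= erate x k' / lam N K by rewrite divr_ge0 ?rate_ge0// ltW.
have m0 k' : (0 <= move k' f x)%E by case: (move_nnmf TL0 TR0 k' nf).
have f0 : (0 <= f x)%E by case: nf.
rewrite ge0_muleDr; last 2 first.
- by rewrite mule_ge0// lee_fin.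
- by apply: sume_ge0 => i _; rewrite mule_ge0// lee_fin.
rewrite muleCA -addeA; apply: leeD2l.
rewrite ge0_sume_distrr; last by move=> i _; rewrite mule_ge0// lee_fin.
apply: (@le_trans _ _ (\sum_(k < N.+1) ((energy x)%:E * ((erate x k / lam N K)%:E * move k f x)
   + (erate x k / lam N K * Cbath)%:E))%E).
  apply: lee_sum => i _; set r := erate x i / lam N K.
  rewrite [X in (_ <= X + _)%E]muleCA (EFinM r) -ge0_muleDr ?mule_ge0 ?lee_fin//.
  apply: lee_wpmul2l; first by rewrite lee_fin; exact: r0.
  by apply: move_energy_mul_le => //; rewrite -ltnS.
rewrite big_split/=; apply: leeD2l; rewrite sumEFin lee_fin -mulr_suml -mulr_suml.
by rewrite ler_piMl// ler_pdivrMr// mul1r erate_sum_le.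
Qed.

Lemma iter_energy_mul_le n x (f : X -> \bar R) : orthant x -> nnmf f ->
  (forall x', (f x' <= 1%:E)%E) ->
  (iter n Q (fun x' => (energy x')%:E * f x') x <=
   (energy x)%:E * iter n Q f x + (n%:R * Cbath)%:E)%E.
Proof.
move=> + nf f1.
have HQ := Qop_markov N0 TL0 TR0 K1.
have C0 := Cbath_ge0.
have nen (g : X -> \bar R) : nnmf g -> nnmf (fun x => (energy x)%:E * g x)%E.
  move=> [mg g0]; split; last by move=> z; rewrite mule_ge0 ?lee_fin ?energy_ge0.
  by apply: emeasurable_funM => //; apply/measurable_EFinP; exact: measurable_energy.
elim: n x => [|n IH] x Dx /=; first by rewrite mul0r adde0.
have nn := markov_nn (markov_iter n HQ).
have HL := markov_on HQ Dx.
have nC : 0 <= n%:R * Cbath by rewrite mulr_ge0.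
apply: (@le_trans _ _ (Q (fun x' => (energy x')%:E * iter n Q f x' + (n%:R * Cbath)%:E) x)%E).
  apply: (posfun_le HL); [exact: nn (nen _ nf)| |exact: IH].
  by apply: nnmfD; [exact/nen/nn|exact: nnmf_cst].
rewrite (posfunD HL (nen _ (nn _ nf)) (nnmf_cst nC)) (posfun_cst HL nC).
have -> : (n.+1%:R * Cbath)%:E = (Cbath%:E + (n%:R * Cbath)%:E)%E.
  by rewrite -natr1 mulrDl mul1r addrC EFinD.
rewrite addeA; apply: leeD2r.
apply: Q_energy_mul_le => //; first exact: nn.
move=> x'; apply: (posfun_le_cst (markov_T (markov_iter n HQ) x')) => //.
Qed.

End energy.

(** * Bounds for the law of a uniform share *)

Section unit_interval_bounds.
Context {R : realType}.
Local Notation mR := (measurableTypeR R).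
Local Notation leb := (@lebesgue_measure R).

Lemma wint_setT (D : set mR) (k : mR -> R) (g : mR -> \bar R) :
  wint D k g = (\int[leb]_y (((k \_ D) y)%:E * g y))%E.
Proof.
rewrite /wint integral_mkcond; apply: eq_integral => y _.
by rewrite !patchE; case: ifP; rewrite ?mul0e.
Qed.

Lemma EexpE (T : R) (g : R -> \bar R) : Eexp T g = wint `[0%R, +oo[ (expdens T) g.
Proof. by []. Qed.

(** In [move] the share is the outer variable, while the minorization fixes the bath draw first and
    then rescales the share. *)
Lemma Eunif_Eexp_swap (T : R) (h : mR * mR -> \bar R) : 0 < T -> nnmf h ->
  Eunif (fun p => Eexp T (fun y => h (p, y))) = Eexp T (fun y => Eunif (fun p => h (p, y))).
Proof.
move=> T0 [mh h0].
pose k1 : mR -> R := (fun _ : mR => 1 : R) \_ (`[0, 1]%classic : set mR).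
pose k2 : mR -> R := expdens T \_ (`[0, +oo[%classic : set mR).
have mk1 : measurable_fun setT k1 by apply/measurable_restrict => //; exact: measurable_funTS.
have mk2 : measurable_fun setT k2.
  by apply/measurable_restrict => //; apply: measurable_funTS; exact: measurable_expdens.
have k10 p : 0 <= k1 p by rewrite /k1 patchE; case: ifP.
have k20 p : 0 <= k2 p by rewrite /k2 patchE; case: ifP => // _; exact: expdens_ge0.
have sec1 p : measurable_fun setT (fun y => h (p, y)).
  by apply: measurableT_comp mh _; exact: measurable_pair1.
have sec2 y : measurable_fun setT (fun p => h (p, y)).
  by apply: measurableT_comp mh _; exact: measurable_pair2.
pose f (z : mR * mR) := ((k1 z.1 * k2 z.2)%:E * h z)%E.
have mf : measurable_fun setT f.
  apply: emeasurable_funM => //; apply/measurable_EFinP; apply: measurable_funM.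
    by apply: measurableT_comp mk1 _.
  by apply: measurableT_comp mk2 _.
have f0 z : (0 <= f z)%E by rewrite mule_ge0// lee_fin mulr_ge0.
have fub : (\int[leb]_p \int[leb]_y f (p, y) = \int[leb]_y \int[leb]_p f (p, y))%E.
  exact: fubini_tonelli.
transitivity (\int[leb]_p \int[leb]_y f (p, y))%E.
  rewrite EunifE wint_setT; apply: eq_integral => p _.
  rewrite EexpE wint_setT.
  have g0 y : setT y -> (0 <= (k2 y)%:E * h (p, y))%E.
    by move=> _; apply: mule_ge0; [rewrite lee_fin; exact: k20|exact: h0].
  have mg : measurable_fun setT (fun y => (k2 y)%:E * h (p, y))%E.
    by apply: emeasurable_funM; [exact/measurable_EFinP|exact: sec1].
  apply: etrans (esym (@ge0_integralZl_EFin _ mR R leb setT measurableT _ g0 mg _ (k10 p))) _.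
  by apply: eq_integral => y _; rewrite /f muleA -EFinM.
rewrite fub.
apply: esym; rewrite EexpE wint_setT; apply: eq_integral => y _; rewrite EunifE wint_setT.
have g0 p : setT p -> (0 <= (k1 p)%:E * h (p, y))%E.
  by move=> _; apply: mule_ge0; [rewrite lee_fin; exact: k10|exact: h0].
have mg : measurable_fun setT (fun p => (k1 p)%:E * h (p, y))%E.
  by apply: emeasurable_funM; [exact/measurable_EFinP|exact: sec2].
apply: etrans (esym (@ge0_integralZl_EFin _ mR R leb setT measurableT _ g0 mg _ (k20 y))) _.
by apply: eq_integral => p _; rewrite /f /= mulrC EFinM muleA.
Qed.

Lemma Eunif_half : Eunif (fun p : mR => (if p <= 1 / 2 then 1 else 0)%:E) = (1 / 2)%:E.
Proof.
transitivity (\int[leb]_(p in `[0%R, (1 / 2)%R]) (cst 1%:E p))%E; last first.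
  rewrite integral_cst//= lebesgue_measure_itv/= lte_fin.
  by rewrite ifT ?divr_gt0// oppr0 adde0 mul1e.
rewrite /Eunif [LHS]integral_mkcond [RHS]integral_mkcond; apply: eq_integral => p _.
rewrite !patchE !mem_setE !in_itv/=.
case: (leP p (1 / 2)) => hp; last by rewrite andbF; case: ifP.
have -> : p <= 1 by lra.
by rewrite !andbT.
Qed.

Lemma Eunif_half_le (G : mR -> \bar R) (a h : R) : nnmf G -> 0 <= h ->
  (forall p, 0 < p < 1 -> (G p <= (a - (if p <= 1 / 2 then h else 0))%:E)%E) ->
  (Eunif G <= (a - h / 2)%:E)%E.
Proof.
move=> nG h0 HG.
(* Nonnegativity of [G] at the sample point [p = 1 / 4] gives [h <= a], which makes [u] below
   nonnegative. *)
have ah : 0 <= a - h.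
  have h14 : 0 < 1 / 4 :> R by lra.
  have h41 : 1 / 4 < 1 :> R by lra.
  have := HG (1 / 4); rewrite h14 h41 ifT; last lra.
  by move=> /(_ isT) H; rewrite -lee_fin; apply: le_trans H; case: nG.
pose hf (p : mR) : R := if p <= 1 / 2 then 1 else 0.
have mhf : measurable_fun setT hf.
  by apply: measurable_fun_ifT => //; exact: measurable_fun_ler.
have nhf : nnmf (fun p => (hf p)%:E).
  by apply: nnmf_EFin => // p; rewrite /hf; case: ifP.
pose u (p : mR) : R := a - h * hf p.
have nu : nnmf (fun p => (u p)%:E).
  apply: nnmf_EFin; first by apply: measurable_funB => //; exact: measurable_funM.
  by move=> p; rewrite /u /hf; case: ifP => _; lra.
have Hu : Eunif (fun p => (u p)%:E) = (a - h / 2)%:E.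
  have a0 : 0 <= a by lra.
  have := posfunD Eunif_posfun nu (nnmfZ h0 nhf).
  rewrite (posfunZ Eunif_posfun h0 nhf) Eunif_half.
  under eq_fun do rewrite -EFinM -EFinD /u subrK.
  rewrite (posfun_cst Eunif_posfun a0) -EFinM.
  have : Eunif (fun p => (u p)%:E) \is a fin_num.
    apply: (posfun_fin Eunif_posfun nu (k := a)).
    apply: (posfun_le_cst Eunif_posfun) => // p _.
    by rewrite lee_fin /u /hf; case: ifP => _; lra.
  case: (Eunif _) => // r _; rewrite -EFinD => -[->]; congr EFin; lra.
rewrite -Hu; apply: (posfun_le Eunif_posfun) => // p; rewrite /= in_itv/= => p01.
apply: (le_trans (HG p p01)); rewrite lee_fin /u /hf.
by case: ifP => _; lra.
Qed.

(** The law of [p * S] has density [1 / S] on [[0, a]], against [1 / a] for the uniform law there;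
    the ratio [a / S] is at least [a / w]. *)
Lemma Eunif_scale_ge (G h : mR -> \bar R) (a S w : R) : 0 < a -> a <= S -> S <= w ->
  nnmf G -> nnmf h ->
  (forall p, 0 < p < 1 -> p * S <= a -> (G (p * S)%R <= h p)%E) ->
  ((a / w)%:E * Eunif (fun u => G (u * a)%R) <= Eunif h)%E.
Proof.
move=> a0 aS Sw nG nh H.
have S0 : 0 < S by exact: lt_le_trans aS.
have w0 : 0 < w by exact: lt_le_trans Sw.
pose c1 (z : mR) : R := if z <= a then 1 else 0.
pose G1 (z : mR) : \bar R := ((c1 z)%:E * G z)%E.
have nG1 : nnmf G1.
  split; last by move=> z; rewrite mule_ge0//; [rewrite lee_fin /c1; case: ifP|case: nG].
  apply: emeasurable_funM; last by case: nG.
  apply/measurable_EFinP; apply: measurable_fun_ifT => //.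
  exact: measurable_fun_ler.
have I0 : (0 <= \int[leb]_(z in `[0%R, a]) G z)%E.
  by apply: integral_ge0 => z _; case: nG.
apply: (@le_trans _ _ (Eunif (fun p => G1 (p * S)))); last first.
  apply: (posfun_le Eunif_posfun) => //.
    split; last by move=> p; case: nG1.
    by apply: (measurableT_comp (proj1 nG1)); exact: measurable_funM.
  move=> p; rewrite /= in_itv/= => p01; rewrite /G1 /c1; case: ifP => pa.
    by rewrite mul1e; apply: H.
  by rewrite mul0e; case: nh.
rewrite (Eunif_scale S0 nG1) (Eunif_scale a0 nG).
have -> : (\int[leb]_(z in `[0%R, S]) G1 z = \int[leb]_(z in `[0%R, a]) G z)%E.
  rewrite [LHS]integral_mkcond [RHS]integral_mkcond; apply: eq_integral => z _.
  rewrite !patchE !mem_setE !in_itv/= /G1 /c1.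
  case: (leP z a) => za; last by rewrite mul0e andbF; case: ifP.
  by rewrite (le_trans za aS) !andbT mul1e.
rewrite muleA -EFinM; apply: lee_wpmul2r => //.
by rewrite lee_fin mulrAC mulfV ?gt_eqF// mul1r lef_pV2.
Qed.

End unit_interval_bounds.

(** * Transport of energy to the right bath *)

Section sweep.
Context {R : realType} {N : nat}.
Variables (TL TR K : R).
Hypotheses (N0 : (0 < N)%N) (TL0 : 0 < TL) (TR0 : 0 < TR) (K1 : 1 <= K).
Local Notation X := (N.-tuple R).
Local Notation mR := (measurableTypeR R).
Local Notation site := (@site R N TL TR).
Local Notation move := (@move R N TL TR).
Local Notation orthant := (@orthant R N).
Local Notation blk := (@blk R N TL TR).
Local Notation erate := (@erate R N TL TR K).
Local Notation Q := (@Qop R N TL TR K).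
Local Notation energy := (@energy R N TL TR).
Local Notation C := (@Cbath R TL TR).
Implicit Types (x : X).
Variable a : R.
Hypotheses (a0 : 0 < a) (aTR : a <= TR).

Definition r0 : R := Num.min K (Num.sqrt a).

Lemma r0_gt0 : 0 < r0.
Proof. by rewrite /r0 lt_min sqrtr_gt0 a0 andbT (lt_le_trans ltr01). Qed.

Lemma r0_le x k : a <= site x k -> a <= site x k.+1 -> r0 <= erate x k.
Proof.
move=> h1 h2; rewrite /r0 /erate /rate le_min !ge_min lexx /=.
by apply/orP; right; apply: ler_wsqrtr; rewrite le_min h1.
Qed.

(* The states met when energy is moved from the last [n] sites to the right bath: only
   the first of these sites may already have given energy away. *)
Definition ready n x := [/\ orthant x, a <= E x (N - n)%N &
  forall j, (N - n < j < N)%N -> 2 * a <= E x j].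

(** [E] counts sites from 0 and [site] from 1, so the edge [N - n] joins [E x (N - n).-1] and
    [E x (N - n)]. *)
Lemma ready_edge n x : (0 < n < N)%N -> ready n.+1 x ->
  r0 <= erate x (N - n)%N /\ a <= E x (N - n)%N.-1 /\ 2 * a <= E x (N - n)%N.
Proof.
move=> /andP[n0 nN] [Dx h1 h2].
have kN : (N - n < N)%N by rewrite ltn_subrL n0.
have k0 : (0 < N - n)%N by rewrite subn_gt0.
have kE : (N - n.+1)%N = (N - n)%N.-1 by rewrite subnS.
rewrite kE in h1 h2.
have h3 : 2 * a <= E x (N - n)%N by apply: h2; rewrite kN andbT prednK.
split => //; apply: r0_le; first by rewrite site_in// ltnW.
by rewrite siteS kN; have := a0; lra.
Qed.

(** The pair has at least [3 * a], so the condition on [p] holds both for [p <= 1 / 2], which pushes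
    energy to the right, and when the left share is at most [a], as in the minorization. *)
Lemma ready_exch n x p : (0 < n < N)%N -> ready n.+1 x -> 0 < p < 1 ->
  a <= (1 - p) * (E x (N - n)%N.-1 + E x (N - n)%N) ->
  ready n (upd2 x (N - n)%N.-1 (p * (E x (N - n)%N.-1 + E x (N - n)%N))
     ((1 - p) * (E x (N - n)%N.-1 + E x (N - n)%N))).
Proof.
move=> nN rx /andP[p0 p1] hp; have [_ [h1 h2]] := ready_edge nN rx.
have [Dx _ h3] := rx; have a0' := a0; have /andP[n0 nN'] := nN.
have kN : (N - n < N)%N by rewrite ltn_subrL n0.
have k0 : (0 < N - n)%N by rewrite subn_gt0.
have S0 : 0 < E x (N - n)%N.-1 + E x (N - n)%N by lra.
split.
- by apply: orthant_upd2 => //; rewrite mulr_gt0// subr_gt0.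
- by rewrite E_upd2// prednK// eqxx gtn_eqF// prednK.
- move=> j /andP[kj jN]; rewrite E_upd2// prednK// !gtn_eqF//.
    by apply: h3; rewrite jN andbT subnS (leq_ltn_trans (leq_pred _)).
  by rewrite (leq_ltn_trans (leq_pred _)).
Qed.

Lemma energy_nnmf : nnmf (EFin \o energy).
Proof. by apply: nnmf_EFin; [exact: measurable_energy|exact: energy_ge0]. Qed.

Lemma one_nnmf d (Y : measurableType d) : nnmf (fun _ : Y => 1%:E : \bar R).
Proof. exact: nnmf_cst. Qed.

Lemma energy1 : EFin \o energy = (fun x => (energy x)%:E * 1%:E)%E.
Proof. by apply/funext => x /=; rewrite mule1. Qed.

Lemma iter_energy_le n x : orthant x ->
  (iter n Q (EFin \o energy) x <= (energy x + n%:R * C)%:E)%E.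
Proof.
move=> Dx; rewrite {1}energy1; have HQ := Qop_markov N0 TL0 TR0 K1.
apply: (le_trans (iter_energy_mul_le N0 TL0 TR0 K1 n Dx (one_nnmf X) (fun=> lexx _))).
by rewrite (posfun1 (markov_on (markov_iter n HQ) Dx)) mule1 EFinD.
Qed.

Lemma move_iter_energy_le k n x : orthant x -> (k <= N)%N ->
  (move k (iter n Q (EFin \o energy)) x <= (energy x + n.+1%:R * C)%:E)%E.
Proof.
move=> Dx kN; have HQ := Qop_markov N0 TL0 TR0 K1.
have HM : posfun orthant (move k ^~ x) by exact: move_posfun.
have nC : 0 <= n%:R * C by rewrite mulr_ge0// Cbath_ge0.
have ne := energy_nnmf.
apply: (@le_trans _ _ (move k (fun x' => (EFin \o energy) x' + (n%:R * C)%:E) x)%E).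
  apply: (posfun_le HM); [exact: (markov_nn (markov_iter n HQ))| |].
    by apply: nnmfD => //; exact: nnmf_cst.
  by move=> x' Dx'; rewrite /= -EFinD; exact: iter_energy_le.
rewrite (posfunD HM ne (nnmf_cst nC)) (posfun_cst HM nC) {1}energy1.
have := move_energy_mul_le N0 TL0 TR0 Dx kN (one_nnmf X) (fun=> lexx _).
rewrite (posfun1 HM) mule1 => h.
apply: (le_trans (leeD2r _ h)).
by rewrite -!EFinD lee_fin -natr1; lra.
Qed.

(** With positive probability the edges from [N - n + 1] to [N] ring in this order. Each exchange
    with [p <= 1 / 2] passes at least half of the pair to the right, so a fixed fraction of the
    energy of the last [n] sites is lost to the right bath. *)
Lemma sweep_energy n : (0 < n <= N)%N -> exists2 c, 0 < c & forall x, ready n x ->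
  (iter n Q (EFin \o energy) x <=
    (energy x + n%:R * C - c * blk x (N - n)%N.+1 N.+1)%:E)%E.
Proof.
have l0 : 0 < lam N K by exact: lam_gt0.
have rp := r0_gt0.
have C0 : 0 <= C by exact: Cbath_ge0.
have HQ := Qop_markov N0 TL0 TR0 K1.
have [TL0' TR0'] := (TL0, TR0).
have a0' := a0.
elim: n => [//|[_ _|n IH /= nN]].
  (* The event [p <= 1 / 2] has probability [1 / 2], and on it at least half of the last energy is
     lost. *)
  exists (r0 / lam N K * (1 / 4)); first by rewrite mulr_gt0 ?divr_gt0.
  move=> x [Dx h1 _].
  have N1 : (N - 1 < N)%N by rewrite ltn_subrL N0.
  have sN : blk x (N - 1)%N.+1 N.+1 = E x (N - 1)%N.
    by rewrite subnSK// subn0 /blk big_nat1 site_in// subn1.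
  rewrite sN (mul1r C).
  have E0 : 0 < E x (N - 1)%N by lra.
  have -> : r0 / lam N K * (1 / 4) * E x (N - 1)%N = r0 / lam N K * (1 / 4 * E x (N - 1)%N) by ring.
  apply: (@Q_move_le _ _ _ _ _ N0 TL0 TR0 K1 x _ r0 _ _ N) => //.
  - exact: energy_nnmf.
  - by rewrite mulr_ge0// ltW.
  - rewrite (ltW rp)/=; apply: r0_le; first by rewrite site_in// -subn1.
    by rewrite siteS ltnn.
  - by rewrite lee_fin lerDl.
  - by move=> k' kN'; have := move_iter_energy_le 0 Dx kN'; rewrite (mul1r C).
  rewrite /move (gtn_eqF N0) eqxx subn1.
  have -> : energy x + C - 1 / 4 * E x N.-1 = energy x + C - (1 / 2 * E x N.-1) / 2 by lra.
  rewrite subn1 in E0 N1.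
  have nb : nnmf (fun z : mR * mR => (energy (upd1 x N.-1 (z.1 * (E x N.-1 + z.2))))%:E).
    apply: nnmf_EFin; last by move=> z; exact: energy_ge0.
    apply: (measurableT_comp (measurable_energy _ _)); apply: measurable_upd1 => //.
    by apply: measurable_funM => //; exact: measurable_funD.
  apply: Eunif_half_le.
  + exact: (Eexp_nnmf TR0 (f := fun z : mR * mR =>
      (energy (upd1 x N.-1 (z.1 * (E x N.-1 + z.2))))%:E)).
  + by rewrite mulr_ge0// ltW.
  move=> p p01; have /andP[p0 p1] := p01.
  have EN := E_le_energy TL0 TR0 Dx N1.
  have b0 : 0 <= energy x - (1 - p) * E x N.-1 by nra.
  apply: (@le_trans _ _ (Eexp TR (fun y => (energy x - (1 - p) * E x N.-1)%:E + (`|y|)%:E))%E).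
    apply: (posfun_le (Eexp_posfun TR0)).
    * split; last by move=> y; rewrite lee_fin energy_ge0.
      apply/measurable_EFinP; apply: (measurableT_comp (measurable_energy _ _)).
      apply: measurable_upd1 => //.
      by apply: measurable_funM => //; exact: measurable_funD.
    * by apply: nnmfD; [exact: nnmf_cst|exact: nnmf_norm].
    * move=> y; rewrite /= in_itv/= andbT => y0; rewrite -EFinD lee_fin ger0_norm ?(ltW y0)//.
      exact: energy_bath.
  rewrite (posfunD (Eexp_posfun TR0) (nnmf_cst b0) nnmf_norm) (posfun_cst (Eexp_posfun TR0) b0).
  apply: (le_trans (leeD2l _ (Eexp_norm_le TR0))).
  rewrite -EFinD lee_fin /Cbath; case: ifP => hp; nra.
have [|c c0 Hc] := IH; first exact: ltnW.
have nN' : (0 < n.+1 < N)%N by [].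
set m := n.+1 in IH Hc nN' nN *.
(* Again a factor [1 / 2] for the probability and [1 / 2] for the energy passed on. *)
exists (r0 / lam N K * (c / 4)); first by rewrite mulr_gt0 ?divr_gt0.
move=> x rx; have [re [h1 h2]] := ready_edge nN' rx.
have [Dx _ _] := rx.
have k0 : (0 < N - m)%N by rewrite subn_gt0.
have kN : (N - m < N)%N by rewrite ltn_subrL.
have kE : (N - m.+1)%N.+1 = (N - m)%N by rewrite subnS prednK.
rewrite kE; set k := (N - m)%N in kN k0 re h1 h2 Hc kE *.
have k0N : (0 < k < N)%N by rewrite k0.
have b0 := blk_ge0 TL0 TR0 k N.+1 Dx.
have -> : r0 / lam N K * (c / 4) * blk x k N.+1 = r0 / lam N K * (c / 4 * blk x k N.+1) by ring.
rewrite [iter _ _ _]/=.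
have nF : nnmf (iter m Q (EFin \o energy)).
  by apply: (markov_nn (markov_iter m HQ)); exact: energy_nnmf.
apply: (@Q_move_le _ _ _ _ _ N0 TL0 TR0 K1 x _ r0 _ _ k) => //.
- exact: ltnW.
- by rewrite mulr_ge0// divr_ge0// ltW.
- by rewrite (ltW rp).
- apply: (le_trans (iter_energy_le m Dx)); rewrite lee_fin -natr1; lra.
- by move=> k' kN'; exact: (move_iter_energy_le m Dx kN').
rewrite /move (gtn_eqF k0) (ltn_eqF kN).
have -> : energy x + m.+1%:R * C - c / 4 * blk x k N.+1 =
  energy x + m.+1%:R * C - (c / 2 * blk x k N.+1) / 2 by lra.
pose S := E x k.-1 + E x k.
apply: (Eunif_half_le (G := fun p => iter m Q (EFin \o energy) (upd2 x k.-1 (p * S) ((1 - p) * S)))).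
- split; last by move=> p; case: nF.
  apply: (measurableT_comp (proj1 nF)); apply: measurable_upd2 => //.
    exact: measurable_funM.
  by apply: measurable_funM => //; exact: measurable_funB.
- by rewrite mulr_ge0// divr_ge0// ltW.
move=> p p01; have /andP[p0 p1] := p01.
have S0 : 0 < S by rewrite /S; lra.
have Dx' : orthant (upd2 x k.-1 (p * S) ((1 - p) * S)).
  by apply: orthant_upd2 => //; rewrite mulr_gt0// subr_gt0.
have eE : energy (upd2 x k.-1 (p * S) ((1 - p) * S)) = energy x by exact: energy_exch.
case: ifP => hp; last first.
  by apply: (le_trans (iter_energy_le m Dx')); rewrite eE lee_fin -natr1; lra.
have rx' : ready m (upd2 x k.-1 (p * S) ((1 - p) * S)).
  by apply: ready_exch => //; rewrite -/k -/S; rewrite /S in S0 *; nra.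
apply: (le_trans (Hc _ rx')); rewrite eE lee_fin -natr1.
have k2 : (k.+1 < N.+1)%N by [].
have k1 : (k < N.+1)%N by exact: ltnW.
suff : 1 / 2 * blk x k N.+1 <= blk (upd2 x k.-1 (p * S) ((1 - p) * S)) k.+1 N.+1.
  by move=> h; nra.
rewrite (blk_recl _ _ x k1) (blk_recl _ _ x k2) (blk_recl _ _ (upd2 _ _ _ _) k2).
rewrite [X in _ <= X + _]exch_sites// eqxx gtn_eqF//.
rewrite (@blk_eq _ _ _ _ (upd2 _ _ _ _) x k.+2) => [|l /andP[l1 lj]]; last first.
  by rewrite exch_sites// !gtn_eqF// ltnW.
have := blk_ge0 TL0 TR0 k.+2 N.+1 Dx.
have := site_gt0 TL0 TR0 k Dx; have := site_gt0 TL0 TR0 k.+1 Dx.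
nra.
Qed.

End sweep.

(** * Minorization by independent uniform energies *)

Section minorization.
Context {R : realType} {N : nat}.
Variables (TL TR K : R).
Hypotheses (N0 : (0 < N)%N) (TL0 : 0 < TL) (TR0 : 0 < TR) (K1 : 1 <= K).
Local Notation X := (N.-tuple R).
Local Notation mR := (measurableTypeR R).
Local Notation move := (@move R N TL TR).
Local Notation orthant := (@orthant R N).
Local Notation Q := (@Qop R N TL TR K).
Local Notation energy := (@energy R N TL TR).
Implicit Types (x : X) (f : X -> \bar R).
Variable a : R.
Hypotheses (a0 : 0 < a) (aTR : a <= TR).
Local Notation ready := (@ready R N a).
Local Notation r0 := (@r0 R K a).

(* [resample n] replaces the energies of the last [n] sites by independent uniform
   variables on [(0, a)] *)
Definition resample1 j f x : \bar R := Eunif (fun u => f (upd1 x j (u * a))).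

Fixpoint resample n f : X -> \bar R :=
  if n is n'.+1 then resample1 (N - n'.+1)%N (resample n' f) else f.

Lemma measurable_resample1 j x : measurable_fun setT (fun u : mR => upd1 x j (u * a)).
Proof. by apply: measurable_upd1 => //; exact: measurable_funM. Qed.

Lemma resample1_nnmf j f : nnmf f -> nnmf (resample1 j f).
Proof.
move=> [mf f0]; apply: (Eunif_nnmf (f := fun z : X * mR => f (upd1 z.1 j (z.2 * a)))).
split => [|z]; last exact: f0.
apply: (measurableT_comp mf); apply: measurable_upd1 => //.
exact: measurable_funM.
Qed.

Lemma resample1_posfun (D : set X) j x :
  (forall p : R, 0 < p -> D (upd1 x j (p * a))) -> posfun D (resample1 j ^~ x).
Proof.
move=> HD.
apply: (@posfun_map _ _ _ _ _ _ _ _ (fun u : mR => upd1 x j (u * a)) _ _ Eunif_posfun).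
- exact: measurable_resample1.
- by move=> p /=; rewrite in_itv/= => /andP[p0 _]; exact: HD.
Qed.

Lemma resample_markov n : markov_op orthant (resample n).
Proof.
elim: n => [|n [In ID IT]].
  have id_pos E x : E x -> posfun E (resample 0 ^~ x).
    by move=> Ex; split => //= [f [_ f0]|f g _ _ fg]; [exact: f0|exact: fg].
  by split => // x; exact: id_pos.
set j := (N - n.+1)%N.
have PD x : orthant x -> posfun orthant (resample1 j ^~ x).
  by move=> Dx; apply: resample1_posfun => p p0; apply: orthant_upd1 => //; rewrite mulr_gt0.
have PT x : posfun setT (resample1 j ^~ x) by exact: resample1_posfun.
split => [f hf|x Dx|x]; first exact/resample1_nnmf/In.
- exact: (@posfun_comp _ _ _ orthant (resample1 j ^~ x) (resample n) In IT ID (PD x Dx)).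
- exact: (@posfun_comp _ _ _ setT (resample1 j ^~ x) (resample n) In IT (fun x _ => IT x) (PT x)).
Qed.

(** What is resampled is forgotten. For [n = N] nothing of the state is left, so [resample N], taken
    at any point, is the common part of the minorization. *)
Lemma resample_eq n f x y : (n <= N)%N ->
  (forall j, (j < N - n)%N -> E x j = E y j) -> resample n f x = resample n f y.
Proof.
elim: n x y => [|n IH] x y nN Exy /=.
  congr f; apply: eq_from_tnth => i; rewrite -!E_tnth; apply: Exy.
  by rewrite subn0.
apply: eq_integral => u _; apply: IH => [|j jn]; first exact: ltnW.
have jN : (j < N)%N by rewrite (leq_trans jn)// leq_subr.
rewrite !E_upd1//; case: eqVneq => // jne; apply: Exy.
by rewrite ltn_neqAle jne/= -ltnS subnSK.
Qed.

Lemma Eexp_cst_le1 (T : R) (J : \bar R) : 0 < T -> (0 <= J)%E ->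
  ((T^-1 * expR (- (1 / T)))%:E * J <=
     Eexp T (fun y : mR => ((if y <= 1 then 1 else 0) : R)%:E * J))%E.
Proof.
move=> T0 J0.
pose c1 (y : mR) : R := if y <= 1 then 1 else 0.
have mc1 : measurable_fun setT c1.
  by apply: measurable_fun_ifT => //; exact: measurable_fun_ler.
have c10 y : 0 <= c1 y by rewrite /c1; case: ifP.
have T10 : 0 <= T^-1 by rewrite invr_ge0 ltW.
have k0 : 0 <= T^-1 * expR (- (1 / T)) by rewrite mulr_ge0// expR_ge0.
have mkc : measurable_fun setT (fun y : mR => (expdens T y * c1 y)%:E).
  by apply/measurable_EFinP; apply: measurable_funM => //; exact: measurable_expdens.
have kc0 y : (0 <= (expdens T y * c1 y)%:E)%E.
  by rewrite lee_fin mulr_ge0// expdens_ge0.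
have -> : Eexp T (fun y : mR => (c1 y)%:E * J)%E =
    (\int[@lebesgue_measure R]_(y in `[0%R, +oo[) (expdens T y * c1 y)%:E * J)%E.
  rewrite -ge0_integralZr//; last exact: measurable_funTS.
  by apply: eq_integral => y _; rewrite muleA EFinM.
apply: lee_wpmul2r => //.
apply: (@le_trans _ _ (\int[@lebesgue_measure R]_(y in `[0%R, 1%R])
    cst (T^-1 * expR (- (1 / T)))%:E y)%E).
  by rewrite integral_cst//= lebesgue_measure_itv/= lte_fin ltr01 oppr0 adde0 mule1.
apply: (@le_trans _ _ (\int[@lebesgue_measure R]_(y in `[0%R, 1%R])
    (expdens T y * c1 y)%:E)%E).
  apply: ge0_le_integral => //; first exact: measurable_funTS.
  move=> y; rewrite /= in_itv/= => /andP[y0 y1]; rewrite lee_fin /c1 y1 mulr1.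
  rewrite /expdens; apply: ler_wpM2l => //.
  by rewrite ler_expR lerN2 ler_wpM2r.
apply: ge0_subset_integral => //; first exact: measurable_funTS.
by move=> y; rewrite /= !in_itv/= => /andP[-> _].
Qed.

(** Restrict to draws [y <= 1], whose density is bounded below; then the sum with the last energy
    lies between [a] and [|w| + 1], and [Eunif_scale_ge] applies. *)
Lemma bath_minor w : exists2 c, 0 < c & forall x, ready 1 x -> energy x <= w ->
  forall f, nnmf f -> (c%:E * resample 1 f x <= move N f x)%E.
Proof.
have [a0' TR0'] := (a0, TR0).
have w0 : 0 < `|w| + 1 by have := normr_ge0 w; lra.
exists (TR^-1 * expR (- (1 / TR)) * (a / (`|w| + 1))).
  by rewrite !mulr_gt0 ?invr_gt0 ?expR_gt0.
move=> x [Dx h1 _] ew f nf.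
have N1 : (N.-1 < N)%N by rewrite prednK.
rewrite subn1 in h1.
have EN := E_le_energy TL0 TR0 Dx N1.
have nh : nnmf (fun z : mR * mR => f (upd1 x N.-1 (z.1 * (E x N.-1 + z.2)))).
  split => [|z]; last by case: nf.
  apply: (measurableT_comp (proj1 nf)); apply: measurable_upd1 => //.
  by apply: measurable_funM => //; exact: measurable_funD.
rewrite /move (gtn_eqF N0) eqxx (Eunif_Eexp_swap TR0 nh) /= /resample1 subn1.
set J := Eunif _.
have nG : nnmf (fun z : mR => f (upd1 x N.-1 z)).
  split => [|z]; last by case: nf.
  by apply: (measurableT_comp (proj1 nf)); exact: measurable_upd1.
have nGa : nnmf (fun u : mR => f (upd1 x N.-1 (u * a))).
  split => [|z]; last by case: nf.
  by apply: (measurableT_comp (proj1 nf)); exact: measurable_resample1.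
have J0 : (0 <= J)%E by exact: (posfun_ge0 Eunif_posfun nGa).
have aw0 : 0 <= a / (`|w| + 1) by rewrite divr_ge0// ltW.
have aJ0 : (0 <= (a / (`|w| + 1))%:E * J)%E by rewrite mule_ge0// lee_fin.
rewrite EFinM -muleA; apply: (le_trans (Eexp_cst_le1 TR0 aJ0)).
apply: (posfun_le (Eexp_posfun TR0)).
- split; last by move=> y; rewrite mule_ge0// lee_fin; case: ifP.
  apply: emeasurable_funM => //; apply/measurable_EFinP.
  by apply: measurable_fun_ifT => //; exact: measurable_fun_ler.
- apply: (@Eunif_nnmf R _ mR (fun z : mR * mR => f (upd1 x N.-1 (z.2 * (E x N.-1 + z.1))))).
  split => [|z]; last by case: nf.
  apply: (measurableT_comp (proj1 nf)); apply: measurable_upd1 => //.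
  by apply: measurable_funM => //; exact: measurable_funD.
- move=> y; rewrite /= in_itv/= andbT => y0; case: ifP => y1; last first.
    rewrite mul0e; apply: (posfun_ge0 Eunif_posfun); split => [|p]; last by case: nf.
    exact: (measurableT_comp (proj1 nh) (measurable_pair2 y)).
  rewrite mul1e.
  apply: (@Eunif_scale_ge R (fun z => f (upd1 x N.-1 z)) _ a (E x N.-1 + y)) => //.
  + by lra.
  + by have := ler_norm w; lra.
  + split => [|p]; last by case: nf.
    exact: (measurableT_comp (proj1 nh) (measurable_pair2 y)).
Qed.

(** The exchange across the edge [N - n] makes its left site uniform on [(0, a)] with positive
    probability, and that site is then left alone; what happens to the right site is erased by
    [resample n]. The constant [2 * |w| + 1] bounds the sum of the two energies. *)
Lemma exch_minor w n c : (0 < n < N)%N -> 0 < c ->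
  (forall x, ready n x -> energy x <= w -> forall f, nnmf f ->
    (c%:E * resample n f x <= iter n Q f x)%E) ->
  forall x, ready n.+1 x -> energy x <= w -> forall f, nnmf f ->
    ((a / (2 * `|w| + 1) * c)%:E * resample n.+1 f x <= move (N - n)%N (iter n Q f) x)%E.
Proof.
move=> nN c0 Hc x rx ew f nf.
have [a0' [re [h1 h2]]] := (a0, ready_edge TL TR K N0 a0 nN rx).
have [Dx _ _] := rx; have /andP[n0 nN'] := nN.
have kE : (N - n.+1)%N = (N - n).-1 by rewrite subnS.
have k0 : (0 < N - n)%N by rewrite subn_gt0.
have kN : (N - n < N)%N by rewrite ltn_subrL n0.
rewrite /= kE /move; move: kE k0 kN h1 h2 re.
have HR := resample_eq (n := n) f.
have ready_x' p : 0 < p < 1 ->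
  a <= (1 - p) * (E x (N - n)%N.-1 + E x (N - n)%N) -> _ := ready_exch TL TR K N0 a0 nN rx.
move: HR ready_x'; set k := (N - n)%N => HR ready_x' kE k0 kN h1 h2 re.
rewrite (gtn_eqF k0) (ltn_eqF kN).
have w0 : 0 < 2 * `|w| + 1 by have := normr_ge0 w; lra.
have HQ := Qop_markov N0 TL0 TR0 K1.
have nF := markov_nn (markov_iter n HQ) nf.
have nJ := markov_nn (resample_markov n) nf.
have k1N : (k.-1 < N)%N by rewrite (leq_ltn_trans (leq_pred _)).
have e1 := E_le_energy TL0 TR0 Dx k1N; have e2 := E_le_energy TL0 TR0 Dx kN.
have nG : nnmf (fun z : mR => resample n f (upd1 x k.-1 z)).
  split => [|z]; last by case: nJ.
  by apply: (measurableT_comp (proj1 nJ)); exact: measurable_upd1.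
have nGa : nnmf (fun u : mR => resample n f (upd1 x k.-1 (u * a))).
  split => [|z]; last by case: nJ.
  by apply: (measurableT_comp (proj1 nJ)); exact: measurable_resample1.
rewrite EFinM -muleA /resample1 -(posfunZ Eunif_posfun (ltW c0) nGa).
apply: (@Eunif_scale_ge R (fun z => c%:E * resample n f (upd1 x k.-1 z))%E _ a
   (E x k.-1 + E x k)) => //.
- by lra.
- by have := ler_norm w; have := normr_ge0 w; lra.
- exact: (nnmfZ (ltW c0)).
- split => [|p]; last by case: nF.
  apply: (measurableT_comp (proj1 nF)); apply: measurable_upd2 => //.
    exact: measurable_funM.
  by apply: measurable_funM => //; exact: measurable_funB.
- move=> p p01 pa; have /andP[p0 p1] := p01.
  rewrite (HR _ (upd2 x k.-1 (p * (E x k.-1 + E x k)) ((1 - p) * (E x k.-1 + E x k)))); last 2 first.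
  + exact: ltnW.
  + move=> j jk; have jN : (j < N)%N by exact: ltn_trans kN.
    by rewrite E_upd1// E_upd2// prednK//; case: eqP => // _; rewrite ltn_eqF.
  apply: Hc => //; first by apply: ready_x' => //; lra.
  by rewrite energy_exch// k0.
Qed.

(** The edges ring in the same order as in [sweep_energy]: each exchange fixes the site on its left
    for good, and the right bath fixes the last site. *)
Lemma sweep_minor w n : (0 < n <= N)%N -> exists2 c, 0 < c & forall x, ready n x ->
  energy x <= w -> forall f, nnmf f -> (c%:E * resample n f x <= iter n Q f x)%E.
Proof.
have l0 : 0 < lam N K by exact: lam_gt0.
have rp := r0_gt0 K1 a0.
have HQ := Qop_markov N0 TL0 TR0 K1.
have rl0 : 0 < r0 / lam N K by rewrite divr_gt0.
elim: n => [//|[_ _|n IH /= nN]].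
  have [c c0 Hc] := bath_minor w.
  exists (r0 / lam N K * c); first by rewrite mulr_gt0.
  move=> x rx ew f nf; rewrite EFinM -muleA.
  apply: (@le_trans _ _ ((r0 / lam N K)%:E * move N f x)%E).
    by apply: lee_wpmul2l; [rewrite lee_fin ltW|exact: Hc].
  have [Dx h1 _] := rx; rewrite subn1 in h1.
  apply: (Q_move_ge N0 TL0 TR0 K1 Dx (leqnn N) nf).
  by rewrite (ltW rp)/=; apply: r0_le; [rewrite site_in|rewrite siteS ltnn].
have [|c c0 Hc] := IH; first exact: ltnW.
have nN' : (0 < n.+1 < N)%N by [].
exists (r0 / lam N K * (a / (2 * `|w| + 1) * c)).
  by rewrite !mulr_gt0 ?invr_gt0//; have := normr_ge0 w; lra.
move=> x rx ew f nf; rewrite (EFinM (r0 / lam N K)) -muleA.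
apply: (@le_trans _ _ ((r0 / lam N K)%:E * move (N - n.+1)%N (iter n.+1 Q f) x)%E).
  by apply: lee_wpmul2l; [rewrite lee_fin ltW|exact: (exch_minor nN' c0 Hc)].
have [Dx _ _] := rx; have [re _] := ready_edge TL TR K N0 a0 nN' rx.
apply: (Q_move_ge N0 TL0 TR0 K1 Dx (leq_subr _ _)).
  exact: (markov_nn (markov_iter n.+1 HQ)).
by rewrite (ltW rp).
Qed.

End minorization.

(** * The Lyapunov function *)

Section lyapunov.
Context {R : realType} {N : nat}.
Variables (TL TR K : R).
Hypotheses (N0 : (0 < N)%N) (TL0 : 0 < TL) (TR0 : 0 < TR) (K1 : 1 <= K).
Variable th : R.
Hypothesis th01 : 0 < th <= 1 / 4.
Local Notation X := (N.-tuple R).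
Local Notation orthant := (@orthant R N).
Local Notation Q := (@Qop R N TL TR K).
Local Notation P := (iter N (@Qop R N TL TR K)).
Local Notation energy := (@energy R N TL TR).
Local Notation lenergy := (@lenergy R N TL TR th).
Local Notation alpha := (@alpha R th).
Local Notation C := (@Cbath R TL TR).
Implicit Types (x : X).

Lemma lenergy_nnmf : nnmf (EFin \o lenergy).
Proof. by apply: nnmf_EFin; [exact: measurable_lenergy|exact: lenergy_ge0]. Qed.

(** Only the first of the [N] steps keeps its gain; the later ones contribute just [b] each. *)
Lemma iter_lenergy_drift : exists c b, [/\ 0 < c, 0 <= b & forall x, orthant x ->
  (P (EFin \o lenergy) x <= (lenergy x - c * lenergy x `^ alpha + b)%:E)%E].
Proof.
have [c [b [c0 b0 Hd]]] := lenergy_drift N0 TL0 TR0 K1 th01.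
have HQ := Qop_markov N0 TL0 TR0 K1.
have nv := lenergy_nnmf.
have key n x : orthant x -> (iter n.+1 Q (EFin \o lenergy) x <=
    (lenergy x - c * lenergy x `^ alpha + n.+1%:R * b)%:E)%E.
  elim: n x => [|n IH] x Dx; first by rewrite mul1r; exact: Hd.
  rewrite [iter _ _ _]/=.
  have HL := markov_on HQ Dx.
  have nb : 0 <= n.+1%:R * b by rewrite mulr_ge0.
  apply: (@le_trans _ _ (Q (fun x' => (EFin \o lenergy) x' + (n.+1%:R * b)%:E)%E x)).
    apply: (posfun_le HL); [exact: (markov_nn (markov_iter n.+1 HQ))| |].
      by apply: nnmfD => //; exact: nnmf_cst.
    move=> x' Dx'; apply: (le_trans (IH x' Dx')); rewrite -EFinD lee_fin.
    by have := mulr_ge0 (ltW c0) (powR_ge0 (lenergy x') alpha); lra.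
  rewrite (posfunD HL nv (nnmf_cst nb)) (posfun_cst HL nb).
  apply: (le_trans (leeD2r _ (Hd x Dx))).
  by rewrite -EFinD lee_fin -(natr1 n.+1); lra.
exists c, (N%:R * b); split => //; first by rewrite mulr_ge0.
by move=> x Dx; have := key N.-1 x Dx; rewrite prednK.
Qed.

(** A single site is a block with weight [mu 0 = 1], so its cost is one of the terms of
    [lenergy]. *)
Lemma E_ge_of_lenergy x r j : orthant x -> (j < N)%N -> lenergy x <= r ->
  r `^ ((th - 1)^-1) <= E x j.
Proof.
move=> Dx jN vr.
have [t0 t4] := andP th01.
have Ej := (orthantP x).1 Dx j jN.
have i1 : (j.+1 < N.+2)%N by exact: ltnW.
have i2 : (j.+2 < N.+2)%N by [].
have e0 : (th - 1)^-1 <= 0 by rewrite invr_le0; lra.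
have p0 : 0 < E x j `^ (th - 1) by exact: powR_gt0.
have Ev : E x j `^ (th - 1) <= r.
  apply: le_trans vr; rewrite /lenergy.
  rewrite (bigD1 (Ordinal i1, Ordinal i2))//= ; last by rewrite /isblk /=.
  rewrite subSnn/= invr1 mul1r /blk big_nat1 siteS jN lerDl.
  apply: sumr_ge0 => I _; apply: mulr_ge0; last exact: powR_ge0.
  by rewrite invr_ge0; case/andP: (mu_bounds (N := N) th01 (I.2 - I.1).-1) => /ltW.
have -> : E x j = (E x j `^ (th - 1)) `^ (th - 1)^-1.
  by rewrite powRK ?(ltW Ej)// lt_eqF//; lra.
exact: powR_anti.
Qed.

Lemma ready_of_lenergy r : exists a, [/\ 0 < a, a <= TR &
  forall x, orthant x -> lenergy x <= r -> ready a N x].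
Proof.
have TR0' := TR0.
pose r' := Num.max r 1.
have r0 : 0 < r' by rewrite lt_max ltr01 orbT.
pose e := Num.min (r' `^ ((th - 1)^-1)) TR.
have e0 : 0 < e by rewrite lt_min powR_gt0.
(* Half, because [ready] asks for [2 * a] at all sites but the first. *)
exists (e / 2); split; [by rewrite divr_gt0| |move=> x Dx vr].
  have : e <= TR by rewrite ge_min lexx orbT.
  by lra.
have vr' : lenergy x <= r' by rewrite le_max vr.
have h j : (j < N)%N -> e <= E x j.
  by move=> jN; rewrite /e ge_min (E_ge_of_lenergy Dx jN vr').
split => //; first by rewrite subnn; have := h _ N0; lra.
by move=> j /andP[_ jN]; have := h _ jN; lra.
Qed.

Definition beta : R := alpha / (1 + th).

Lemma alpha_bounds : 0 < alpha <= 1.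
Proof.
have [t0 t4] := andP th01.
have h1 : 0 < 1 - th by lra.
have h2 : 0 < 1 / 2 - th by lra.
by rewrite /alpha divr_gt0// ler_pdivrMr// (mul1r (1 - th)); lra.
Qed.

Lemma beta_bounds : 0 < beta < 1.
Proof.
have [t0 t4] := andP th01; have /andP[a0 a1] := alpha_bounds.
have h1 : 0 < 1 + th by lra.
by rewrite /beta divr_gt0// ltr_pdivrMr// (mul1r (1 + th)); lra.
Qed.

(** The cases are the two sides of the crossover [W = v^(1 + th)]. Below it [u] is at most
    [3 * v^(1 + th)], whose power [beta] is of order [v^alpha]; above it [u <= 3 * W], and
    [W^(beta - 1)] is bounded by its value at the crossover. *)
Lemma beta_pow_le (u v W : R) : 1 <= v -> 0 <= W -> 0 <= u <= v + 2 * W ->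
  u `^ beta <= 3 * (v `^ alpha + W * v `^ (alpha - (1 + th))).
Proof.
move=> v1 W0 /andP[u0 uv].
have [t0 t4] := andP th01; have /andP[a0 a1] := alpha_bounds; have /andP[b0 b1] := beta_bounds.
have v0 : 0 < v by lra.
have ba : (1 + th) * beta = alpha by rewrite /beta; field; lra.
have ge1 z : 1 <= z -> z `^ beta <= z by move=> z1; exact/ler1_powR/ltW.
have p1 := powR_ge0 v alpha; have p2 := powR_ge0 v (alpha - (1 + th)).
have q1 := mulr_ge0 W0 p2.
have [Wv|vW] := leP W (v `^ (1 + th)).
  have vv : v <= v `^ (1 + th) by rewrite le1r_powR//; lra.
  apply: (@le_trans _ _ ((3 * v `^ (1 + th)) `^ beta)).
    by apply: ge0_ler_powR; rewrite ?nnegrE; lra.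
  rewrite powRM ?powR_ge0// -powRrM ba.
  have := ge1 3 ltac:(lra); nra.
have vW' : v <= W.
  by apply: le_trans (ltW vW); rewrite le1r_powR//; lra.
apply: (@le_trans _ _ ((3 * W) `^ beta)).
  by apply: ge0_ler_powR; rewrite ?nnegrE; lra.
rewrite powRM//.
have Wp : 0 < W by lra.
have hW : W `^ beta <= W * v `^ (alpha - (1 + th)).
  have -> : W `^ beta = W * W `^ (beta - 1) by rewrite mulr_powRB1.
  rewrite ler_pM2l//.
  have -> : alpha - (1 + th) = (1 + th) * (beta - 1) by rewrite mulrBr ba; ring.
  rewrite powRrM; apply: powR_anti; [lra|exact: powR_gt0|exact: ltW].
have := ge1 3 ltac:(lra); have := powR_ge0 W beta; nra.
Qed.

(* The tangent of the convex function [z |-> z `^ (- th)] at [z = 1 + v0]. *)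
Lemma powR_tangent (v v0 : R) : 0 <= v -> 0 <= v0 ->
  (1 + v0) `^ (- th) - th * (1 + v0) `^ (- (1 + th)) * (v - v0) <= (1 + v) `^ (- th).
Proof.
move=> v_ge0 v0_ge0; have [t0 t4] := andP th01.
have z0 : 0 < 1 + v by lra.
have w0 : 0 < 1 + v0 by lra.
have -> : (1 + v0) `^ (- (1 + th)) = (1 + v0) `^ (- th) / (1 + v0).
  rewrite -[(1 + v0)^-1]powR_inv1 ?(ltW w0)// -powRD; first by congr (_ `^ _); lra.
  by apply/implyP => _; rewrite gt_eqF.
have -> : (1 + v) `^ (- th) = (1 + v0) `^ (- th) * ((1 + v) / (1 + v0)) `^ (- th).
  by rewrite -powRM ?(ltW w0) ?divr_ge0 ?(ltW z0) ?(ltW w0)//; congr (_ `^ _); rewrite mulrC divfK// gt_eqF.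
have wp := powR_gt0 (- th) w0.
have -> : (1 + v0) `^ (- th) - th * ((1 + v0) `^ (- th) / (1 + v0)) * (v - v0) =
  (1 + v0) `^ (- th) * (1 - th * ((1 + v) / (1 + v0) - 1)) by field; lra.
rewrite ler_pM2l//.
set z := (1 + v) / (1 + v0).
have zp : 0 < z by rewrite divr_gt0.
rewrite /powR gt_eqF//; apply: le_trans (expR_ge1Dx _).
rewrite mulNr lerD2l lerN2 ler_pM2l//.
have := @le_ln1Dx R (z - 1); rewrite addrCA subrr addr0; apply; lra.
Qed.

Lemma small_set_minor r w : exists delta, exists2 rho : (X -> \bar R) -> \bar R,
  0 < delta < 1 /\ posfun orthant rho &
  forall x, orthant x -> lenergy x <= r -> energy x <= w ->
    forall f, nnmf f -> (delta%:E * rho f <= P f x)%E.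
Proof.
have [a [a0 aTR Ha]] := ready_of_lenergy r.
have [|c c0 Hc] := sweep_minor N0 TL0 TR0 K1 a0 aTR w (n := N).
  by rewrite N0 leqnn.
(* Any point of the orthant serves, by [resample_eq]. *)
pose x0 : X := [tuple 1 | i < N].
have Dx0 : orthant x0 by move=> i; rewrite tnth_mktuple.
exists (Num.min c (1 / 2)), (resample a N ^~ x0).
  split; last exact: (markov_on (resample_markov a0 N)).
  by rewrite lt_min c0 gt_min; apply/andP; split; [lra|apply/orP; right; lra].
move=> x Dx vr ew f nf.
apply: le_trans (Hc x (Ha x Dx vr) ew f nf).
rewrite (@resample_eq _ _ a N f x0 x) => [|//|j]; last by rewrite subnn.
apply: lee_wpmul2r; last by rewrite lee_fin ge_min lexx.
exact: (posfun_ge0 (markov_on (resample_markov a0 N) Dx)).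
Qed.

Lemma energy_contract r : exists2 c, 0 < c & forall x, orthant x -> lenergy x <= r ->
  (P (EFin \o energy) x <= (energy x + N%:R * C - c * energy x)%:E)%E.
Proof.
have [a [a0 aTR Ha]] := ready_of_lenergy r.
have [|c c0 Hc] := sweep_energy N0 TL0 TR0 K1 a0 aTR (n := N).
  by rewrite N0 leqnn.
exists c => // x Dx vr; have := Hc x (Ha x Dx vr).
by rewrite subnn (energyE TL0 TR0 Dx).
Qed.

End lyapunov.

Section subgeometric_rate.
Context {R : realType} {N : nat}.
Variables (TL TR K : R).
Hypotheses (N0 : (0 < N)%N) (TL0 : 0 < TL) (TR0 : 0 < TR) (K1 : 1 <= K).
Variable th : R.
Hypothesis th01 : 0 < th <= 1 / 4.
Local Notation X := (N.-tuple R).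
Local Notation orthant := (@orthant R N).
Local Notation Q := (@Qop R N TL TR K).
Local Notation P := (iter N (@Qop R N TL TR K)).
Local Notation energy := (@energy R N TL TR).
Local Notation lenergy := (@lenergy R N TL TR th).
Local Notation alpha := (@alpha R th).
Local Notation beta := (@beta R th).
Local Notation C := (@Cbath R TL TR).
Implicit Types (x : X).

Definition weight x : R := 1 - (1 + lenergy x) `^ (- th).

Lemma weight01 x : 0 <= weight x <= 1.
Proof.
have [t0 t4] := andP th01; have v0 := lenergy_ge0 TL TR th01 x.
rewrite /weight gerBl powR_ge0 andbT subr_ge0 -[leRHS](powRr0 (1 + lenergy x)).
by apply: ler_powR; lra.
Qed.

Lemma measurable_weight : measurable_fun setT weight.
Proof.
apply: measurable_funB => //; apply: (measurableT_comp (measurable_powR _)).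
by apply: measurable_funD => //; exact: measurable_lenergy.
Qed.

Lemma weight_nnmf : nnmf (EFin \o weight).
Proof.
by apply: nnmf_EFin => [|x]; [exact: measurable_weight|case/andP: (weight01 x)].
Qed.

(** The derivative of [v -> 1 - (1 + v)^(-th)]. *)
Definition wslope (v : R) : R := th * (1 + v) `^ (- (1 + th)).

Lemma wslope_bounds v : 0 <= v -> 0 <= wslope v <= 1.
Proof.
move=> v0; have [t0 t4] := andP th01.
have : (1 + v) `^ (- (1 + th)) <= 1.
  by rewrite -[leRHS](powRr0 (1 + v)); apply: ler_powR; lra.
by have := powR_ge0 (1 + v) (- (1 + th)); rewrite /wslope; nra.
Qed.

Lemma wslope_ge v : 1 <= v -> th / 4 * v `^ (- (1 + th)) <= wslope v.
Proof.
move=> v1; have [t0 t4] := andP th01.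
rewrite /wslope -mulrA ler_pM2l//.
apply: (@le_trans _ _ ((2 * v) `^ (- (1 + th)))); last first.
  by apply: powR_anti; lra.
rewrite powRM; [|lra|lra]; rewrite ler_wpM2r ?powR_ge0//.
apply: (@le_trans _ _ (2 `^ (- 2))); last by apply: ler_powR; lra.
by rewrite powRN powR_mulrn; lra.
Qed.

(** Jensen's inequality for a concave function, obtained by integrating its tangent line at
    [lenergy x]. *)
Lemma iter_weight_le x u : orthant x -> (P (EFin \o lenergy) x <= u%:E)%E ->
  (P (EFin \o weight) x <= (weight x + wslope (lenergy x) * (u - lenergy x))%:E)%E.
Proof.
move=> Dx Pu.
have HL := markov_on (markov_iter N (Qop_markov N0 TL0 TR0 K1)) Dx.
have v0 := lenergy_ge0 TL TR th01 x.
have nv := lenergy_nnmf TL TR th01 (N:=N).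
have /andP[D0 D1] := wslope_bounds v0.
have Ht v : 0 <= v -> (1 + lenergy x) `^ (- th) -
    wslope (lenergy x) * (v - lenergy x) <= (1 + v) `^ (- th).
  by move=> v_ge0; exact: (powR_tangent th01 v_ge0 v0).
move: (wslope (lenergy x)) D0 D1 Ht => D D0 D1 Ht.
have [k kE] : exists k, k = 1 - (1 + lenergy x) `^ (- th) - D * lenergy x by eexists.
(* [k] is the value at 0 of the tangent line, which lies above the function there, and the function
   vanishes at 0. *)
have k0 : 0 <= k.
  by have := Ht 0 (lexx 0); rewrite addr0 powR1 sub0r mulrN opprK kE -addrA -opprD subr_ge0.
apply: (@le_trans _ _ (P (fun y => D%:E * (EFin \o lenergy) y + k%:E)%E x)).
  apply: (posfun_le HL); [exact: weight_nnmf| |].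
    by apply: nnmfD; [exact: nnmfZ|exact: nnmf_cst].
  move=> y _; rewrite /= -EFinM -EFinD lee_fin /weight kE.
  have := Ht _ (lenergy_ge0 TL TR th01 y); rewrite mulrBr.
  move: (_ `^ _) (_ `^ _) (D * _) (D * _) => p1 p2 p3 p4; lra.
rewrite (posfunD HL (nnmfZ D0 nv) (nnmf_cst k0)) (posfun_cst HL k0) (posfunZ HL D0 nv).
apply: (@le_trans _ _ (D%:E * u%:E + k%:E)%E).
  by apply: leeD2r; apply: lee_wpmul2l => //; rewrite lee_fin.
by rewrite -EFinM -EFinD lee_fin kE /weight mulrBr; move: (_ `^ _) (D * _) (D * _) => p1 p2 p3; lra.
Qed.

(* The last term gains a negative multiple of
   [energy x * lenergy x `^ (alpha - (1 + th))] in
   the region where [lenergy] is large and the total energy itself need not contract. *)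
Definition lyap (kap : R) x : R := lenergy x + energy x + kap * (energy x * weight x).

Lemma lyap_bounds kap x : 0 <= kap <= 1 ->
  lenergy x + energy x <= lyap kap x <= lenergy x + 2 * energy x.
Proof.
move=> /andP[k0 k1]; have /andP[w0 w1] := weight01 x.
have e0 := energy_ge0 TL TR x.
have h1 : 0 <= energy x * weight x by rewrite mulr_ge0.
have h2 : energy x * weight x <= energy x by rewrite ler_piMr.
have h3 : kap * (energy x * weight x) <= energy x * weight x by rewrite ler_piMl.
have h4 := mulr_ge0 k0 h1.
by rewrite /lyap; apply/andP; split; lra.
Qed.

Lemma measurable_lyap kap : measurable_fun setT (lyap kap).
Proof.
apply: measurable_funD.
  by apply: measurable_funD; [exact: measurable_lenergy|exact: measurable_energy].
apply: measurable_funM => //; apply: measurable_funM; first exact: measurable_energy.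
exact: measurable_weight.
Qed.

Lemma iter_lyap_le kap x u e : 0 <= kap <= 1 -> orthant x ->
  (P (EFin \o lenergy) x <= u%:E)%E -> (P (EFin \o energy) x <= e%:E)%E ->
  (P (EFin \o lyap kap) x <= (u + e +
     kap * (energy x * (weight x + wslope (lenergy x) * (u - lenergy x)) + N%:R * C))%:E)%E.
Proof.
move=> /andP[k0 k1] Dx Pu Pe.
have HL := markov_on (markov_iter N (Qop_markov N0 TL0 TR0 K1)) Dx.
have e0 := energy_ge0 TL TR.
have nv := lenergy_nnmf TL TR th01 (N:=N).
have ne := energy_nnmf TL TR (N:=N).
have nw := weight_nnmf.
have newt : nnmf (fun y : X => (energy y)%:E * (EFin \o weight) y)%E.
  split; last by move=> z; rewrite mule_ge0 ?lee_fin ?e0//; case/andP: (weight01 z).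
  apply: emeasurable_funM; last by case: nw.
  by apply/measurable_EFinP; exact: measurable_energy.
rewrite (_ : EFin \o lyap kap = fun y => ((EFin \o lenergy) y + (EFin \o energy) y +
   kap%:E * ((energy y)%:E * (EFin \o weight) y))%E); last first.
  by apply/funext => y; rewrite /= /lyap !EFinD !EFinM.
rewrite (posfunD HL (nnmfD nv ne) (nnmfZ k0 newt)) (posfunD HL nv ne) (posfunZ HL k0 newt).
rewrite EFinD; apply: leeD; first by rewrite EFinD leeD.
rewrite EFinM; apply: lee_wpmul2l; first by rewrite lee_fin.
apply: (le_trans (iter_energy_mul_le N0 TL0 TR0 K1 N Dx nw _)).
  by move=> y; rewrite lee_fin; case/andP: (weight01 y).
rewrite EFinD; apply: leeD2r; rewrite [leRHS]EFinM; apply: lee_wpmul2l; first by rewrite lee_fin.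
exact: iter_weight_le.
Qed.

(** Where [lenergy <= r], the product term may grow, but by at most [kap * b * W] plus a constant;
    [kap] is chosen so that this is at most half of what the contraction of the energy gains. Where
    [lenergy > r], the energy need not contract and the product term supplies the decrease in
    [W]. *)
Lemma lyap_drift : exists kap c b, [/\ 0 <= kap <= 1, 0 < c, 0 <= b &
  forall x, orthant x ->
    (P (EFin \o lyap kap) x <= (lyap kap x - c * lyap kap x `^ beta + b)%:E)%E].
Proof.
have [t0 t4] := andP th01.
have /andP[a0 a1] := alpha_bounds th01; have /andP[be0 be1] := beta_bounds th01.
have [c [b [c0 b0 Hd]]] := iter_lenergy_drift N0 TL0 TR0 K1 th01.
(* Beyond [r], half of [c * v^alpha] pays for [b]. *)
pose r := Num.max 1 ((2 * b / c) `^ alpha^-1).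
have r1 : 1 <= r by rewrite le_max lexx.
have bc0 : 0 <= 2 * b / c by rewrite divr_ge0 ?(ltW c0)// mulr_ge0.
have hr v : r < v -> 2 * b <= c * v `^ alpha.
  move=> rv; rewrite [leRHS]mulrC -ler_pdivrMr//.
  have -> : 2 * b / c = ((2 * b / c) `^ alpha^-1) `^ alpha.
    by rewrite -powRrM mulVf ?gt_eqF// powRr1.
  apply: ge0_ler_powR; rewrite ?nnegrE ?powR_ge0 ?(ltW a0)//; first lra.
  by apply: le_trans (ltW rv); rewrite /r le_max lexx orbT.
have [c3 c30 He] := energy_contract N0 TL0 TR0 K1 th01 r.
pose NC := N%:R * C.
have NC0 : 0 <= NC by rewrite mulr_ge0// Cbath_ge0.
have b21 : 0 < 2 * b + 1 by lra.
pose kap := Num.min 1 (c3 / (2 * b + 1)).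
have kap0 : 0 < kap by rewrite lt_min ltr01 divr_gt0.
have kap1 : kap <= 1 by rewrite ge_min lexx.
have kapb : kap * (2 * b + 1) <= c3 by rewrite -ler_pdivlMr// ge_min lexx orbT.
pose c1 := kap * (th * c).
have tc : 0 < th * c by exact: mulr_gt0.
have c10 : 0 < c1 by exact: mulr_gt0.
have c1c : c1 <= c.
  by rewrite /c1 -[leRHS]mul1r -[leRHS]mul1r; apply: ler_pM; rewrite ?(ltW tc) ?(ltW kap0)//; nra.
(* 24 is the 8 from the decrease of the product term times the 3 of [beta_pow_le]; [c3 / 4] is for
   the region where the energy contracts, since [lyap] may contain [2 * W]. *)
pose c2 := Num.min (c1 / 24) (c3 / 4).
have c20 : 0 < c2 by rewrite lt_min !divr_gt0.
have c21 : c2 <= c1 / 24 by rewrite ge_min lexx.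
have c23 : c2 <= c3 / 4 by rewrite ge_min lexx orbT.
exists kap, c2, (b + 2 * NC + c3 * (1 + r)).
split => //; first by rewrite (ltW kap0).
  by have := mulr_ge0 (ltW c30) (le_trans ler01 r1); lra.
move=> x Dx.
have v0 := lenergy_ge0 TL TR th01 x; have W0 := energy_ge0 TL TR x.
have /andP[w0 w1] := weight01 x.
have kap01 : 0 <= kap <= 1 by rewrite (ltW kap0).
have /andP[Vlo Vhi] := lyap_bounds x kap01.
have /andP[D0 D1] := wslope_bounds v0.
set v := lenergy x in v0 Vlo Vhi D0 D1 *; set W := energy x in W0 Vlo Vhi *.
set D := wslope v in D0 D1 *.
have Hv : (P (EFin \o lenergy) x <= (v - c * v `^ alpha + b)%:E)%E by exact: Hd.
have Vp := powR_ge0 (lyap kap x) beta.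
have EV : lyap kap x = v + W + kap * (W * weight x) by [].
have [vr|vr] := leP v r.
  have HE : (P (EFin \o energy) x <= (W + NC - c3 * W)%:E)%E by exact: He.
  apply: (le_trans (iter_lyap_le kap01 Dx Hv HE)); rewrite lee_fin -/v -/W -/D -/NC.
  have Vb : lyap kap x `^ beta <= 1 + r + 2 * W.
    have V0 : 0 <= lyap kap x by lra.
    apply: (@le_trans _ _ (1 + lyap kap x)); last by lra.
    have [V1|V1] := leP (lyap kap x) 1.
      have : lyap kap x `^ beta <= 1 `^ beta.
        by apply: ge0_ler_powR; rewrite ?nnegrE//; exact: ltW.
      by rewrite powR1; lra.
    have : lyap kap x `^ beta <= lyap kap x by apply: ler1_powR; exact: ltW.
    by lra.
  have pa := powR_ge0 v alpha.
  have cp := mulr_ge0 (ltW c0) pa.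
  have h1 : W * (D * (v - c * v `^ alpha + b - v)) <= W * b.
    apply: ler_wpM2l => //; apply: (@le_trans _ _ (D * b)); last by rewrite ler_piMl.
    by apply: ler_wpM2l => //; lra.
  have h2 : kap * (W * (D * (v - c * v `^ alpha + b - v))) <= W * (c3 / 2).
    apply: (@le_trans _ _ (kap * (W * b))); first by rewrite ler_pM2l.
    by rewrite mulrCA; apply: ler_wpM2l => //; lra.
  have h3 : c2 * lyap kap x `^ beta <= c3 / 4 * (1 + r + 2 * W).
    by apply: ler_pM => //; exact: ltW.
  have h4 : kap * NC <= NC by rewrite ler_piMl.
  have h5 : 0 <= c3 * (1 + r) by rewrite mulr_ge0 ?(ltW c30)//; lra.
  have := mulr_ge0 (ltW c30) W0.
  rewrite {1}EV !mulrDr; rewrite !mulrDr in h2 h3 h5.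
  lra.
have v1 : 1 <= v by lra.
have cv := hr _ vr.
have HE : (P (EFin \o energy) x <= (W + NC)%:E)%E.
  exact: iter_energy_le.
apply: (le_trans (iter_lyap_le kap01 Dx Hv HE)); rewrite lee_fin -/v -/W -/D -/NC.
have p1 := powR_ge0 v alpha; have p2 := powR_ge0 v (alpha - (1 + th)).
have q2 := mulr_ge0 W0 p2.
have Vb : lyap kap x `^ beta <= 3 * (v `^ alpha + W * v `^ (alpha - (1 + th))).
  by apply: (beta_pow_le th01 v1 W0); rewrite Vhi andbT; lra.
have h1 : th * c / 8 * v `^ (alpha - (1 + th)) <= D * (c * v `^ alpha - b).
  apply: (@le_trans _ _ (th / 4 * v `^ (- (1 + th)) * (c * v `^ alpha / 2))).
    rewrite powRD; last by apply/implyP => _; rewrite gt_eqF//; lra.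
    by rewrite le_eqVlt; apply/orP; left; apply/eqP; field.
  apply: ler_pM; [| |exact: wslope_ge|lra].
    by apply: mulr_ge0; [lra|exact: powR_ge0].
  by have := mulr_ge0 (ltW c0) p1; lra.
have h2 : c1 / 8 * (W * v `^ (alpha - (1 + th))) <= kap * (W * (D * (c * v `^ alpha - b))).
  have -> : c1 / 8 * (W * v `^ (alpha - (1 + th))) =
    kap * (W * (th * c / 8 * v `^ (alpha - (1 + th)))) by rewrite /c1; field.
  by rewrite ler_pM2l// ler_wpM2l.
have h3 : c2 * lyap kap x `^ beta <=
    c1 / 24 * (3 * (v `^ alpha + W * v `^ (alpha - (1 + th)))).
  by apply: ler_pM => //; exact: ltW.
have h4 : kap * NC <= NC by rewrite ler_piMl.
have h5 : 0 <= c3 * (1 + r) by rewrite mulr_ge0 ?(ltW c30)//; lra.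
have h6 : c1 / 8 * v `^ alpha <= c * v `^ alpha by rewrite ler_wpM2r//; lra.
have -> : kap * (W * (weight x + D * (v - c * v `^ alpha + b - v)) + NC) =
  kap * (W * weight x) + kap * NC - kap * (W * (D * (c * v `^ alpha - b))) by ring.
rewrite {1}EV; lra.
Qed.

Definition rate_exponent : R := (1 - beta)^-1.

Lemma iter_le1 n (f : X -> \bar R) x : nnmf f -> (forall x, (f x <= 1%:E)%E) ->
  (iter n Q f x <= 1%:E)%E.
Proof.
move=> nf f1; have HT := markov_T (markov_iter n (Qop_markov N0 TL0 TR0 K1)) x.
exact: (posfun_le_cst HT).
Qed.

Lemma iter_unit n (g : X -> R) : measurable_fun setT g -> (forall x, 0 <= g x <= 1) ->
  nnmf (iter n Q (EFin \o g)) /\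
  iter n Q (EFin \o g) = EFin \o (fun z => fine (iter n Q (EFin \o g) z)).
Proof.
move=> mg g01.
have ng : nnmf (EFin \o g) by apply: nnmf_EFin => // x; case/andP: (g01 x).
have nn := markov_nn (markov_iter n (Qop_markov N0 TL0 TR0 K1)) ng.
split => //; apply/funext => z; rewrite /= fineK// ge0_fin_numE; last by case: nn.
apply: (le_lt_trans (iter_le1 n z ng _)); last by rewrite ltry.
by move=> x; rewrite lee_fin; case/andP: (g01 x).
Qed.

Lemma iter_unit01 n (g : X -> R) x : measurable_fun setT g -> (forall x, 0 <= g x <= 1) ->
  0 <= fine (iter n Q (EFin \o g) x) <= 1.
Proof.
move=> mg g01; have [nn E] := iter_unit n mg g01.
have ng : nnmf (EFin \o g) by apply: nnmf_EFin => // z; case/andP: (g01 z).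
rewrite -!lee_fin -[(fine _)%:E]/((EFin \o (fun z => fine (iter n Q (EFin \o g) z))) x) -E.
apply/andP; split; first by case: nn.
by apply: iter_le1 => // z; rewrite lee_fin; case/andP: (g01 z).
Qed.

Lemma block_rate_le n : (n %/ N).+1%:R `^ (- rate_exponent) <=
  N%:R `^ rate_exponent * n.+1%:R `^ (- rate_exponent) :> R.
Proof.
have q0 : 0 < rate_exponent by have /andP[_ b1] := beta_bounds th01; rewrite invr_gt0 subr_gt0.
set k := (n %/ N)%N.
have kn : n.+1%:R <= N%:R * k.+1%:R :> R.
  by rewrite -natrM ler_nat mulnC; exact: ltn_ceil.
have N1 : 0 < N%:R :> R by rewrite ltr0n.
have k1 : 0 < k.+1%:R :> R by rewrite ltr0n.
have n1 : 0 < n.+1%:R :> R by rewrite ltr0n.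
have -> : k.+1%:R `^ (- rate_exponent) =
    N%:R `^ rate_exponent * (N%:R * k.+1%:R : R) `^ (- rate_exponent).
  rewrite powRM ?(ltW N1) ?(ltW k1)// mulrA -powRD ?subrr ?powRr0 ?mul1r//.
  by apply/implyP => _; rewrite gt_eqF.
rewrite ler_pM2l ?powR_gt0//; apply: powR_anti => //.
by rewrite oppr_le0 ltW.
Qed.

(** Write [n = k * N + m] and apply the rate for [P = Q^N] to [Q^m g], which again has values in
    [0, 1]. *)
Lemma Qop_osc : exists A C1, [/\ 1 <= A, 0 < C1 &
  forall g : X -> R, measurable_fun setT g -> (forall x, 0 <= g x <= 1) ->
  forall n x y, orthant x -> orthant y ->
  fine (iter n Q (EFin \o g) x) <= fine (iter n Q (EFin \o g) y) +
    C1 * n.+1%:R `^ (- rate_exponent) *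
      (A + (lenergy x + 2 * energy x) + (lenergy y + 2 * energy y))].
Proof.
have HQ := Qop_markov N0 TL0 TR0 K1.
have HP := markov_iter N HQ.
have bb := beta_bounds th01; have /andP[be0 be1] := bb.
have [kap [c [b [kap01 c0 b0 Hd]]]] := lyap_drift.
have V0 x : 0 <= lyap kap x.
  have /andP[h _] := lyap_bounds x kap01.
  by have := lenergy_ge0 TL TR th01 x; have := energy_ge0 TL TR x; lra.
have small r : exists delta, exists2 rho : (X -> \bar R) -> \bar R,
    0 < delta < 1 /\ posfun orthant rho &
    forall x, orthant x -> lyap kap x <= r -> forall f, nnmf f -> (delta%:E * rho f <= P f x)%E.
  have [delta [rho h1 h2]] := small_set_minor N0 TL0 TR0 K1 th01 r r.
  exists delta, rho => // x Dx Vr.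
  have /andP[h _] := lyap_bounds x kap01.
  apply: h2 => //.
    by have := energy_ge0 TL TR x; lra.
  by have := lenergy_ge0 TL TR th01 x; lra.
have [A [C1 [A1 C10 Hosc]]] := subgeometric_osc HP (measurable_lyap kap) V0 c0 b0 bb Hd small.
exists A, (C1 * N%:R `^ rate_exponent); split => //.
  by rewrite mulr_gt0// powR_gt0// ltr0n.
move=> g mg g01 n x y Dx Dy.
set m := (n %% N)%N; set k := (n %/ N)%N.
have [ng gE] := iter_unit m mg g01.
have -> : iter n Q (EFin \o g) = iter k P (EFin \o (fun z => fine (iter m Q (EFin \o g) z))).
  by rewrite -gE -iterM -iterD {1}(divn_eq n N).
have h01 z : 0 <= fine (iter m Q (EFin \o g) z) <= 1 by exact: iter_unit01.
have mh : measurable_fun setT (fun z => fine (iter m Q (EFin \o g) z)).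
  by apply/measurable_EFinP; rewrite -gE; case: ng.
apply: (le_trans (Hosc _ mh h01 k x y Dx Dy)); rewrite lerD2l.
have /andP[_ hx] := lyap_bounds x kap01; have /andP[_ hy] := lyap_bounds y kap01.
have Vx := V0 x; have Vy := V0 y.
have A0 : 0 <= A := le_trans ler01 A1.
apply: ler_pM.
- by apply: mulr_ge0; [exact: ltW|exact: powR_ge0].
- exact: addr_ge0 (addr_ge0 A0 Vx) Vy.
- rewrite -mulrA ler_pM2l; last exact: C10.
  exact: block_rate_le.
- exact: lerD (lerD (lexx A) hx) hy.
Qed.

End subgeometric_rate.

(** * Continuous time *)

Section poisson.
Context {R : realType}.
Implicit Types (s q : R).

Definition poisson_wt s n : R := expR (- s) * s ^+ n / n`!%:R.

Lemma poisson_wt_ge0 s n : 0 <= s -> 0 <= poisson_wt s n.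
Proof. by move=> s0; rewrite /poisson_wt mulr_ge0 ?invr_ge0// mulr_ge0 ?expR_ge0// exprn_ge0. Qed.

Lemma poisson_wt_sum_le1 s M : 0 <= s -> \sum_(0 <= n < M) poisson_wt s n <= 1.
Proof.
move=> s0.
have h : \sum_(0 <= n < M) s ^+ n / n`!%:R <= expR s.
  have := @nondecreasing_cvgn_le R (series (exp_coeff s)) _ (is_cvg_series_exp_coeff s) M.
  rewrite /series /exp_coeff /=; apply.
  apply/nondecreasing_seqP => n; rewrite /series /= big_nat_recr//= lerDl.
  by rewrite divr_ge0// exprn_ge0.
rewrite (eq_bigr (fun n => expR (- s) * (s ^+ n / n`!%:R))); last first.
  by move=> n _; rewrite /poisson_wt mulrA.
rewrite -mulr_sumr -[leRHS](@expRxMexpNx_1 R s) mulrC.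
by rewrite ler_wpM2r// expR_ge0.
Qed.

(** The factors [s / (n + 1)] and [s / (n + 2)] shift a Poisson weight by two, so the sum of the
    left sides is at most 1. *)
Lemma poisson_wt_shift2 s n :
  poisson_wt s n * (s ^+ 2 / (n.+1%:R * n.+2%:R)) = poisson_wt s n.+2.
Proof.
have -> : poisson_wt s n.+2 = expR (- s) * (s ^+ n * s ^+ 2) / (n.+2%:R * (n.+1%:R * n`!%:R)).
  by rewrite /poisson_wt !factS !natrM -exprD addn2.
have f0 : n`!%:R != 0 :> R by rewrite pnatr_eq0 -lt0n fact_gt0.
have n1 : n.+1%:R != 0 :> R by rewrite pnatr_eq0.
have n2 : n.+2%:R != 0 :> R by rewrite pnatr_eq0.
rewrite /poisson_wt; move: (n.+1%:R) (n.+2%:R) (n`!%:R) (expR _) f0 n1 n2 => a b c e f0 n1 n2.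
by field; rewrite f0 n1 n2.
Qed.

(** This is where [q <= 2] enters: for [n + 1 < s], [(s / (n + 1))^q] is at most [(s / (n + 1))^2],
    and [n + 2 <= 2 * (n + 1)] brings this to the form summed by [poisson_wt_shift2]. *)
Lemma powR_poisson_le s q n : 0 < s -> 0 <= q <= 2 ->
  n.+1%:R `^ (- q) <= s `^ (- q) * (1 + 2 * (s ^+ 2 / (n.+1%:R * n.+2%:R))).
Proof.
move=> s0 /andP[q0 q2].
have n1 : 0 < n.+1%:R :> R by rewrite ltr0n.
have n2 : 0 < n.+2%:R :> R by rewrite ltr0n.
have sq0 := powR_gt0 (- q) s0.
have e0 : 0 <= s ^+ 2 / (n.+1%:R * n.+2%:R) by rewrite divr_ge0 ?sqr_ge0// ltW// mulr_gt0.
have [sn|ns] := leP s n.+1%:R.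
  apply: (@le_trans _ _ (s `^ (- q))); first by apply: powR_anti => //; rewrite oppr_le0.
  by rewrite ler_peMr ?(ltW sq0)// lerDl mulr_ge0.
have -> : n.+1%:R `^ (- q) = s `^ (- q) * (s / n.+1%:R) `^ q.
  rewrite -[in RHS](invrK n.+1%:R) -[in RHS]powR_inv1 ?invr_ge0 ?(ltW n1)//.
  rewrite powR_inv1 ?invr_ge0 ?(ltW n1)// invrK.
  rewrite powRM ?(ltW s0) ?invr_ge0 ?(ltW n1)// mulrA -powRD ?addNr ?powRr0 ?mul1r.
    by rewrite -[(n.+1%:R)^-1]powR_inv1 ?(ltW n1)// -powRrM mulN1r.
  by apply/implyP => _; rewrite gt_eqF.
rewrite ler_pM2l//.
have r1 : 1 <= s / n.+1%:R by rewrite ler_pdivlMr// mul1r ltW.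
apply: (@le_trans _ _ ((s / n.+1%:R) `^ 2)); first exact: ler_powR.
rewrite powR_mulrn; last by rewrite (le_trans ler01).
apply: (@le_trans _ _ (2 * (s ^+ 2 / (n.+1%:R * n.+2%:R)))); last by rewrite lerDr.
have -> : 2 * (s ^+ 2 / (n.+1%:R * n.+2%:R)) = (s / n.+1%:R) ^+ 2 * (2 * (n.+1%:R / n.+2%:R)).
  by field; rewrite !gt_eqF.
rewrite ler_peMr ?sqr_ge0// mulrA ler_pdivlMr// mul1r -(natr1 n.+1).
have : 1 <= n.+1%:R :> R by rewrite ler1n.
move: (n.+1%:R) => z z1; lra.
Qed.

Lemma nneseries_le_cst (u : nat -> R) (c : R) : (forall n, 0 <= u n) ->
  (forall M, \sum_(0 <= n < M) u n <= c) -> (\sum_(n <oo) (u n)%:E <= c%:E)%E.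
Proof.
move=> u0 Hc; apply: lime_le; first by apply: is_cvg_nneseries => n _ _; rewrite lee_fin.
by apply: nearW => M; rewrite sumEFin lee_fin.
Qed.

Lemma poisson_sum_le1 s : 0 <= s -> (\sum_(n <oo) (poisson_wt s n)%:E <= 1%:E)%E.
Proof.
by move=> s0; apply: nneseries_le_cst => M; [exact: poisson_wt_ge0|exact: poisson_wt_sum_le1].
Qed.

Lemma poisson_powR_le s q : 0 < s -> 0 <= q <= 2 ->
  (\sum_(n <oo) (poisson_wt s n * n.+1%:R `^ (- q))%:E <= (3 * s `^ (- q))%:E)%E.
Proof.
move=> s0 q02; have s0' := ltW s0.
apply: nneseries_le_cst => [n|M]; first by rewrite mulr_ge0 ?poisson_wt_ge0 ?powR_ge0.
have p0 := powR_ge0 s (- q).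
apply: (@le_trans _ _ (\sum_(0 <= n < M)
    (s `^ (- q) * poisson_wt s n + s `^ (- q) * (2 * poisson_wt s n.+2)))).
  apply: ler_sum => n _; apply: (@le_trans _ _ (poisson_wt s n * (s `^ (- q) *
      (1 + 2 * (s ^+ 2 / (n.+1%:R * n.+2%:R)))))).
    by rewrite ler_wpM2l ?poisson_wt_ge0// powR_poisson_le.
  rewrite -poisson_wt_shift2 le_eqVlt; apply/orP; left; apply/eqP.
  by move: (s ^+ 2 / _) => z; ring.
rewrite big_split/= -!mulr_sumr.
have h1 := poisson_wt_sum_le1 M s0'.
have h2 : \sum_(0 <= n < M) poisson_wt s n.+2 <= 1.
  apply: le_trans (poisson_wt_sum_le1 M.+2 s0').
  by rewrite big_nat_recl// big_nat_recl// addrA lerDr addr_ge0// poisson_wt_ge0.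
have -> : 3 * s `^ (- q) = s `^ (- q) * 1 + s `^ (- q) * (2 * 1) by ring.
by apply: lerD; rewrite ler_wpM2l// ler_wpM2l.
Qed.

End poisson.

(** * From oscillations to differences of integrals *)

Section gap.
Context {d : measure_display} {X : measurableType d} {R : realType}.
Variables (D : set X) (L1 L2 : (X -> \bar R) -> \bar R) (F U : X -> R) (A eps u1 u2 : R).
Hypotheses (H1 : posfun D L1) (H2 : posfun D L2).
Hypotheses (mF : measurable_fun setT F) (F01 : forall x, 0 <= F x <= 1).
Hypotheses (mU : measurable_fun setT U) (U0 : forall x, 0 <= U x).
Hypotheses (A0 : 0 <= A) (eps0 : 0 <= eps) (u10 : 0 <= u1).
Hypotheses (Lu1 : (L1 (EFin \o U) <= u1%:E)%E) (Lu2 : (L2 (EFin \o U) <= u2%:E)%E).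
Hypothesis osc : forall x y, D x -> D y -> F x <= F y + eps * (A + U x + U y).

(** Integrate [osc] in [x] against [L1], then the result in [y] against [L2]; as [F <= 1], the first
    integral is a real number and can be a constant in the second. *)
Lemma posfun_gap : (L1 (EFin \o F) <= L2 (EFin \o F) + (eps * (A + u1 + u2))%:E)%E.
Proof.
have F0 x : 0 <= F x by case/andP: (F01 x).
have nF : nnmf (EFin \o F) by exact: nnmf_EFin.
have nU : nnmf (EFin \o U) by exact: nnmf_EFin.
have step y : D y -> (L1 (EFin \o F) <= (F y + eps * (A + u1 + U y))%:E)%E.
  move=> Dy; have k0 : 0 <= F y + eps * (A + U y).
    exact: addr_ge0 (F0 y) (mulr_ge0 eps0 (addr_ge0 A0 (U0 y))).
  apply: (@le_trans _ _ (L1 (fun x => eps%:E * (EFin \o U) x + (F y + eps * (A + U y))%:E)%E)).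
    apply: (posfun_le H1 nF); first by apply: nnmfD; [exact: nnmfZ|exact: nnmf_cst].
    move=> x Dx; rewrite /= -EFinM -EFinD lee_fin; apply: (le_trans (osc Dx Dy)).
    by rewrite le_eqVlt; apply/orP; left; apply/eqP; ring.
  rewrite (posfunD H1 (nnmfZ eps0 nU) (nnmf_cst k0)) (posfunZ H1 eps0 nU) (posfun_cst H1 k0).
  rewrite (_ : F y + eps * (A + u1 + U y) = eps * u1 + (F y + eps * (A + U y))); last by ring.
  by rewrite [leRHS]EFinD EFinM leeD2r// lee_wpmul2l.
have a0 : (0 <= L1 (EFin \o F))%E by exact: (posfun_ge0 H1 nF).
have a1 : (L1 (EFin \o F) <= 1%:E)%E.
  by apply: (posfun_le_cst H1 nF) => // x _; rewrite lee_fin; case/andP: (F01 x).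
have := posfun_fin H1 nF a1; move: (L1 (EFin \o F)) a0 step {a1} => a + + afin.
rewrite -(fineK afin) lee_fin; move: (fine a) => {}a {afin} a0 step.
have k0 : 0 <= eps * (A + u1) by exact: mulr_ge0 eps0 (addr_ge0 A0 u10).
rewrite -(posfun_cst H2 a0).
apply: (@le_trans _ _ (L2 (fun x => ((EFin \o F) x + eps%:E * (EFin \o U) x) +
    (eps * (A + u1))%:E)%E)).
  apply: (posfun_le H2 (nnmf_cst a0)).
    by apply: nnmfD; [apply: nnmfD => //; exact: nnmfZ|exact: nnmf_cst].
  move=> y Dy; apply: (le_trans (step y Dy)); rewrite /= -EFinM -!EFinD lee_fin.
  by rewrite le_eqVlt; apply/orP; left; apply/eqP; ring.
rewrite (posfunD H2 (nnmfD nF (nnmfZ eps0 nU)) (nnmf_cst k0)).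
rewrite (posfunD H2 nF (nnmfZ eps0 nU)) (posfunZ H2 eps0 nU) (posfun_cst H2 k0).
rewrite (_ : eps * (A + u1 + u2) = eps * u2 + eps * (A + u1)); last by ring.
by rewrite [(eps * u2 + _)%:E]EFinD addeA leeD2r// leeD2l// EFinM lee_wpmul2l.
Qed.

End gap.

Lemma ae_posfun d (X : measurableType d) (R : realType) (mu : probability X R) (D : set X) :
  {ae mu, forall x, D x} -> posfun D (fun f => \int[mu]_x f x)%E.
Proof.
move=> aeD; split => [f [_ f0]|f g [mf f0] [mg g0]|k f k0 [mf f0]||f g [mf f0] [mg g0] fg].
- exact: integral_ge0.
- exact: ge0_integralD.
- exact: ge0_integralZl_EFin.
- transitivity (1%:E * mu [set: X])%E; first exact: (integral_cst mu measurableT 1%:E).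
  by rewrite probability_setT mule1.
- apply: ae_ge0_le_integral => //; apply: filterS aeD => x Dx _; exact: fg.
Qed.

Section semigroup.
Context {R : realType} {N : nat}.
Variables (TL TR K : R).
Hypotheses (N0 : (0 < N)%N) (TL0 : 0 < TL) (TR0 : 0 < TR) (K1 : 1 <= K).
Variable th : R.
Hypothesis th01 : 0 < th <= 1 / 4.
Local Notation X := (N.-tuple R).
Local Notation orthant := (@orthant R N).
Local Notation Q := (@Qop R N TL TR K).
Local Notation Pt := (@Pt R N TL TR K).
Local Notation energy := (@energy R N TL TR).
Local Notation lenergy := (@lenergy R N TL TR th).
Local Notation q := (@rate_exponent R th).
Implicit Types (x : X) (g : X -> R).

(** Bounds [lyap kap] for every [kap] in [0, 1]. *)
Definition moment x : R := lenergy x + 2 * energy x.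

Lemma moment_ge0 x : 0 <= moment x.
Proof. exact: addr_ge0 (lenergy_ge0 TL TR th01 x) (mulr_ge0 (ler0n R 2) (energy_ge0 TL TR x)). Qed.

Lemma measurable_moment : measurable_fun setT moment.
Proof.
apply: measurable_funD; first exact: measurable_lenergy.
by apply: measurable_funM => //; exact: measurable_energy.
Qed.

(** [q = (1 - th^2) / (1 / 2 + th - th^2)]. The lower bound is the rate aimed at, the upper one is
    what the Poisson average asks for. *)
Lemma rate_exponent_bounds : 2 - 4 * th < q <= 2.
Proof.
have [t0 t4] := andP th01.
have h1 : 0 < 1 / 2 + th - th ^+ 2 by nra.
have h2 : 0 < 1 - th ^+ 2 by nra.
have h3 : 1 - th != 0 by rewrite gt_eqF// subr_gt0; lra.
have h4 : 1 + th != 0 by rewrite gt_eqF//; lra.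
have -> : q = (1 - th ^+ 2) / (1 / 2 + th - th ^+ 2).
  rewrite /rate_exponent /beta /alpha -[RHS]invf_div; congr (_^-1).
  by field; rewrite h3 h4 gt_eqF.
by rewrite ltr_pdivlMr// ler_pdivrMr//; apply/andP; split; nra.
Qed.

Section observable.
Variables (t : R) (g : X -> R).
Hypotheses (t0 : 0 <= t) (mg : measurable_fun setT g) (g01 : forall x, 0 <= g x <= 1).
Let h n x : R := fine (iter n Q (EFin \o g) x).

Let s0 : 0 <= lam N K * t. Proof. by rewrite mulr_ge0// ltW// lam_gt0. Qed.
Let h01 n x : 0 <= h n x <= 1. Proof. exact: iter_unit01. Qed.

Let mh n : measurable_fun setT (h n).
Proof.
have [nn E] := iter_unit N0 TL0 TR0 K1 n mg g01.
by apply/measurable_EFinP; rewrite -[EFin \o _]E; case: nn.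
Qed.

Lemma PtE x : Pt t (EFin \o g) x = (\sum_(n <oo) (poisson_wt (lam N K * t) n * h n x)%:E)%E.
Proof.
apply: eq_eseriesr => n _; have [_ E] := iter_unit N0 TL0 TR0 K1 n mg g01.
by rewrite E /= -EFinM.
Qed.

Let wh0 n x : 0 <= poisson_wt (lam N K * t) n * h n x.
Proof. by rewrite mulr_ge0 ?poisson_wt_ge0//; case/andP: (h01 n x). Qed.

Lemma Pt_ge0 x : (0 <= Pt t (EFin \o g) x)%E.
Proof. by rewrite PtE; apply: nneseries_ge0 => n _ _; rewrite lee_fin. Qed.

Lemma Pt_le1 x : (Pt t (EFin \o g) x <= 1%:E)%E.
Proof.
rewrite PtE; apply: le_trans (poisson_sum_le1 s0).
apply: lee_nneseries => n _; rewrite lee_fin//.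
by rewrite ler_piMr ?poisson_wt_ge0//; case/andP: (h01 n x).
Qed.

Lemma measurable_Pt : measurable_fun setT (Pt t (EFin \o g)).
Proof.
rewrite (_ : Pt t _ = fun x => (\sum_(n <oo) (poisson_wt (lam N K * t) n * h n x)%:E)%E);
  last by apply/funext => x; exact: PtE.
apply: (ge0_emeasurable_sum (P := xpredT)) => [n x _ _|n _]; first by rewrite lee_fin.
by apply/measurable_EFinP; exact: measurable_funM.
Qed.

Lemma PtK x : (fine (Pt t (EFin \o g) x))%:E = Pt t (EFin \o g) x.
Proof. by rewrite fineK// ge0_fin_numE ?Pt_ge0// (le_lt_trans (Pt_le1 x))// ltry. Qed.

Lemma finePt01 x : 0 <= fine (Pt t (EFin \o g) x) <= 1.
Proof. by rewrite -!lee_fin PtK Pt_ge0 Pt_le1. Qed.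

Lemma measurable_finePt : measurable_fun setT (fun x => fine (Pt t (EFin \o g) x)).
Proof.
apply/measurable_EFinP.
have -> : EFin \o (fun x => fine (Pt t (EFin \o g) x)) = Pt t (EFin \o g).
  by apply/funext => x; exact: PtK.
exact: measurable_Pt.
Qed.

End observable.

Lemma Pt_osc : exists A C2, [/\ 0 <= A, 0 < C2 &
  forall t g, 0 < t -> measurable_fun setT g -> (forall x, 0 <= g x <= 1) ->
  forall x y, orthant x -> orthant y ->
  fine (Pt t (EFin \o g) x) <= fine (Pt t (EFin \o g) y) +
    C2 * t `^ (- q) * (A + moment x + moment y)].
Proof.
have [A [C1 [A1 C10 Hosc]]] := Qop_osc N0 TL0 TR0 K1 th01.
have l0 : 0 < lam N K by exact: lam_gt0.
have A0 : 0 <= A by exact: le_trans A1.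
exists A, (3 * C1 * lam N K `^ (- q)); split => //.
  by apply: mulr_gt0; [exact: mulr_gt0|exact: powR_gt0].
move=> t g t0 mg g01 x y Dx Dy; have t0' := ltW t0.
have s0 : 0 < lam N K * t by exact: mulr_gt0.
have q02 : 0 <= q <= 2.
  have /andP[q0 q2] := rate_exponent_bounds; have [_ t4] := andP th01.
  by rewrite q2 andbT; lra.
have L0 : 0 <= C1 * (A + moment x + moment y).
  by apply: mulr_ge0; [exact: ltW|exact: addr_ge0 (addr_ge0 A0 (moment_ge0 x)) (moment_ge0 y)].
set L := C1 * (A + moment x + moment y) in L0.
rewrite -lee_fin EFinD !PtK// !PtE//.
have h0 n z : 0 <= fine (iter n Q (EFin \o g) z).
  by have /andP[] := iter_unit01 N0 TL0 TR0 K1 n z mg g01.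
have w0 n : 0 <= poisson_wt (lam N K * t) n by exact: poisson_wt_ge0 (ltW s0).
have p0 n : 0 <= n.+1%:R `^ (- q) :> R by exact: powR_ge0.
apply: (@le_trans _ _ (\sum_(n <oo) ((poisson_wt (lam N K * t) n *
     fine (iter n Q (EFin \o g) y))%:E +
     L%:E * (poisson_wt (lam N K * t) n * n.+1%:R `^ (- q))%:E))%E).
  apply: lee_nneseries => [n _ _|n _]; first by rewrite lee_fin; exact: mulr_ge0.
  rewrite -EFinM -EFinD lee_fin.
  have := ler_wpM2l (w0 n) (Hosc g mg g01 n x y Dx Dy).
  rewrite mulrDr => /le_trans; apply; rewrite lerD2l.
  by rewrite le_eqVlt; apply/orP; left; apply/eqP; rewrite /L /moment; ring.
rewrite nneseriesD; last 2 first.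
- by move=> n _ _; rewrite lee_fin; exact: mulr_ge0.
- by move=> n _ _; rewrite -EFinM lee_fin; apply: mulr_ge0 => //; exact: mulr_ge0.
rewrite leeD2l// nneseriesZl; last by move=> n _; rewrite lee_fin; exact: mulr_ge0.
apply: (le_trans (lee_wpmul2l _ (poisson_powR_le s0 q02))); first by rewrite lee_fin.
rewrite -EFinM lee_fin powRM ?(ltW l0)//.
by rewrite le_eqVlt; apply/orP; left; apply/eqP; rewrite /L; ring.
Qed.

End semigroup.

(** * Integrability under the measures of [M_eta] *)

Section moments.
Context {R : realType} {N : nat}.
Variables (TL TR : R).
Hypotheses (N0 : (0 < N)%N) (TL0 : 0 < TL) (TR0 : 0 < TR).
Variable th : R.
Hypothesis th01 : 0 < th <= 1 / 4.
Local Notation X := (N.-tuple R).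
Local Notation orthant := (@orthant R N).
Local Notation energy := (@energy R N TL TR).
Local Notation lenergy := (@lenergy R N TL TR th).
Local Notation moment := (@moment R N TL TR th).
Implicit Types (x : X).

Lemma negpow_ge0 (s e : R) : (0 <= negpow s e)%E.
Proof. by rewrite /negpow; case: ifP => // _; rewrite lee_fin powR_ge0. Qed.

Lemma measurable_negpow (e : R) : measurable_fun setT (fun s : measurableTypeR R => negpow s e).
Proof.
apply: measurable_fun_ifT => //; first exact: measurable_fun_ltr.
by apply/measurable_EFinP; exact: measurable_powR.
Qed.

Lemma Vfun_ge0 x : (0 <= Vfun th x)%E.
Proof. by rewrite /Vfun; apply: sume_ge0 => m _; apply: sume_ge0 => i _; exact: negpow_ge0. Qed.

Lemma measurable_Vfun : measurable_fun setT (@Vfun R N th).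
Proof.
apply: emeasurable_sum => m; apply: emeasurable_sum => i.
apply: (measurableT_comp (measurable_negpow _)).
by apply: measurable_sum => j; exact: measurable_E.
Qed.

(** A term with [m = 1]: there [a_m] is 1, so the exponent is exactly [th - 1]. *)
Lemma negpow_le_Vfun x j : (j < N)%N -> (negpow (E x j) (th - 1) <= Vfun th x)%E.
Proof.
move=> jN; rewrite /Vfun big_ltn//.
have -> : a_m R N 1 * th - 1 = th - 1 by rewrite /a_m/= expn0 subrr mul0r subr0 mul1r.
rewrite subn1 addn1 prednK// big_mkord (bigD1 (Ordinal jN))//= big_nat1 addn0 -addeA.
rewrite leeDl// adde_ge0//; apply: sume_ge0 => i _; first exact: negpow_ge0.
by apply: sume_ge0 => k _; exact: negpow_ge0.
Qed.

Lemma energy_Wfun x : energy x = `|Wfun x|.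
Proof.
rewrite /energy /blk big_add1/= big_mkord /Wfun; congr `| _ |; apply: eq_bigr => i _.
by rewrite siteS ltn_ord E_tnth.
Qed.

Lemma measurable_Wfun : measurable_fun setT (@Wfun R N).
Proof.
rewrite (_ : @Wfun R N = fun x => \sum_(i < N) E x i); last first.
  by apply/funext => x; apply: eq_bigr => i _; rewrite E_tnth.
by apply: measurable_sum => i; exact: measurable_E.
Qed.

(** A block has at least the energy of its first site and the exponent is negative, so its cost is
    at most that of a single site, which [Vfun] controls. *)
Lemma moment_le : exists2 c, 0 <= c & forall x, orthant x ->
  ((moment x)%:E <= c%:E * ((energy x)%:E + Vfun th x))%E.
Proof.
have [t0 t4] := andP th01.
have /andP[mN0 mN1] := mu_bounds (N := N) th01 N.
have M1 := Mpairs_ge1 (R := R) (N := N).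
set b := @Mpairs R N * (@mu R N th N)^-1.
have b0 : 0 < b by rewrite mulr_gt0 ?invr_gt0//; exact: lt_le_trans M1.
exists (2 + b); first by rewrite addr_ge0// ltW.
move=> x Dx; have e0 := energy_ge0 TL TR x.
have := Vfun_ge0 x; case EV : (Vfun th x) => [v| |]//; last first.
  by move=> _; rewrite addey// mulry gtr0_sg ?mul1e ?leey// addr_gt0.
rewrite lee_fin => v0; rewrite -EFinD -EFinM lee_fin.
have hE j : (j < N)%N -> E x j `^ (th - 1) <= v.
  move=> jN; have := negpow_le_Vfun x jN; rewrite EV /negpow.
  by rewrite (orthantP x).1// lee_fin.
have hl : lenergy x <= b * v.
  rewrite /b -mulrA sum_pairs_cst /lenergy big_mkcond.
  apply: ler_sum => -[[a aN] [c cN]] _; rewrite /isblk /=.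
  case: ifP => [/andP[a0 ac]|_]; last by rewrite mulr_ge0// invr_ge0 ltW.
  have /andP[mb0 mb1] := mu_bounds (N := N) th01 (c - a).-1.
  apply: ler_pM; rewrite ?powR_ge0 ?invr_ge0 ?(ltW mb0)//.
    by rewrite lef_pV2 ?posrE//; apply: mu_anti => //; exact: blk_len_le.
  have a1N : (a.-1 < N)%N by rewrite -ltnS prednK// -ltnS (leq_ltn_trans ac).
  apply: le_trans (hE _ a1N).
  have sE : site TL TR x a = E x a.-1 by rewrite -[in LHS](prednK a0) siteS a1N.
  rewrite -sE; apply: powR_anti; [lra|exact: site_gt0|].
  by apply: site_le_blk => //; rewrite leqnn.
have be : 0 <= b * energy x by rewrite mulr_ge0// ltW.
rewrite /moment mulrDr !mulrDl; lra.
Qed.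

Lemma measurable_Rplus : measurable (@Rplus_orthant R N).
Proof.
rewrite (_ : @Rplus_orthant R N = \bigcap_k [set x : X | 0 <= E x k]); last first.
  apply/seteqP; split => x.
    move=> h k _ /=; have [kN|kN] := ltnP k N; last by rewrite /E nth_default// size_tuple.
    by rewrite (E_tnth _ (Ordinal kN)).
  by move=> h i; rewrite -E_tnth; exact: (h i I).
apply: bigcapT_measurable => k.
rewrite (_ : [set x | _] = (fun x : X => E x k) @^-1` `[0, +oo[%classic); last first.
  by apply/seteqP; split => x /=; rewrite in_itv/= andbT.
rewrite -[X in measurable X]setTI; exact: measurable_E.
Qed.

(** [Vfun] is infinite as soon as one energy is 0, so a finite integral puts the measure on the open
    orthant. On the closed orthant [energy] and [Wfun] coincide. *)
Lemma M_eta_moment (m : probability X R) : M_eta th m ->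
  {ae m, forall x, orthant x} /\
  exists2 u, 0 <= u & (\int[m]_x (moment x)%:E <= u%:E)%E.
Proof.
move=> [m0 mF].
have aeR : {ae m, forall x, @Rplus_orthant R N x}.
  exists (~` @Rplus_orthant R N); split => //; exact: measurableC measurable_Rplus.
pose F x : \bar R := ((energy x)%:E + Vfun th x)%E.
have F0 x : (0 <= F x)%E by rewrite adde_ge0 ?lee_fin ?energy_ge0// Vfun_ge0.
have mF' : measurable_fun setT F.
  apply: emeasurable_funD; last exact: measurable_Vfun.
  by apply/measurable_EFinP; exact: measurable_energy.
have FE : (\int[m]_x ((Wfun x)%:E + Vfun th x) = \int[m]_x F x)%E.
  apply: ae_eq_integral => //.
    apply: emeasurable_funD; last exact: measurable_Vfun.
    by apply/measurable_EFinP; exact: measurable_Wfun.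
  apply: filterS aeR => x Rx _; rewrite /F energy_Wfun ger0_norm//.
  by apply: sumr_ge0 => i _; exact: Rx.
rewrite FE in mF.
have iF : m.-integrable setT F.
  apply/integrableP; split => //.
  by under eq_integral => x _ do rewrite gee0_abs//.
have aeO : {ae m, forall x, orthant x}.
  apply: filterS2 aeR (integrable_ae measurableT iF) => x Rx /(_ I) Fx i.
  rewrite lt_neqAle Rx andbT; apply/negP => /eqP xi0.
  have := negpow_le_Vfun x (ltn_ord i).
  rewrite E_tnth -xi0 /negpow ltxx leye_eq => /eqP Voo.
  by move: Fx; rewrite /F Voo addey.
split => //.
have [c c0 Hc] := moment_le.
have HL := ae_posfun aeO.
have nm : nnmf (EFin \o moment).
  by apply: nnmf_EFin; [exact: measurable_moment|exact: moment_ge0].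
have fF : (\int[m]_x F x)%E \is a fin_num by exact: integrable_fin_num.
exists (c * fine (\int[m]_x F x)).
  by rewrite mulr_ge0// fine_ge0// integral_ge0.
rewrite EFinM fineK// -(posfunZ HL c0 (conj mF' F0)).
apply: (posfun_le HL nm) => [|x Dx]; last exact: Hc.
by apply: nnmfZ.
Qed.

End moments.

Lemma cvg_powR_pinfty (R : realType) (c e : R) (f : R -> R) : 0 < e ->
  (forall t, 0 < t -> 0 <= f t <= c * t `^ (- e)) -> f t @[t --> +oo] --> 0.
Proof.
move=> e0 Hf.
pose c' := `|c| + 1.
have c0 : 0 < c' by have := normr_ge0 c; rewrite /c'; lra.
apply/cvgrPdist_le => eps eps0.
have ce0 : 0 < c' / eps by exact: divr_gt0.
near=> t.
have t0 : 0 < t by near: t; exact: nbhs_pinfty_gt.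
have tT : (c' / eps) `^ e^-1 <= t by near: t; exact: nbhs_pinfty_ge.
have /andP[f0 fc] := Hf t t0.
rewrite sub0r normrN ger0_norm//; apply: (le_trans fc).
apply: (@le_trans _ _ (c' * t `^ (- e))).
  by rewrite ler_wpM2r ?powR_ge0//; have := ler_norm c; rewrite /c'; lra.
apply: (@le_trans _ _ (c' * ((c' / eps) `^ e^-1) `^ (- e))).
  by rewrite ler_pM2l//; apply: powR_anti => //; [rewrite oppr_le0 ltW|exact: powR_gt0].
rewrite -powRrM mulrN mulVf ?gt_eqF// powR_inv1 ?(ltW ce0)// invf_div mulrCA mulfV ?mulr1//.
by rewrite gt_eqF.
Unshelve. all: end_near. Qed.

Section total_variation.
Context {R : realType} {N : nat}.
Variables (TL TR K : R).
Hypotheses (N0 : (0 < N)%N) (TL0 : 0 < TL) (TR0 : 0 < TR) (K1 : 1 <= K).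
Variable th : R.
Hypothesis th01 : 0 < th <= 1 / 4.
Local Notation X := (N.-tuple R).
Local Notation q := (@rate_exponent R th).

Lemma TVdist_le (m n : probability X R) : M_eta th m -> M_eta th n -> exists2 C, 0 <= C &
  forall t, 0 < t -> 0 <= TVdist TL TR K m n t <= C * t `^ (- q).
Proof.
move=> /(M_eta_moment N0 TL0 TR0 th01)[aem [u1 u10 Hu1]].
move=> /(M_eta_moment N0 TL0 TR0 th01)[aen [u2 u20 Hu2]].
have [A [C2 [A0 C20 Hosc]]] := Pt_osc N0 TL0 TR0 K1 th01.
have L0 : 0 <= C2 * (A + u1 + u2) by rewrite mulr_ge0 ?(ltW C20)// addr_ge0// addr_ge0.
exists (C2 * (A + u1 + u2)) => // t t0; have t0' := ltW t0.
set eps := C2 * t `^ (- q).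
have eps0 : 0 <= eps by rewrite mulr_ge0 ?powR_ge0// ltW.
rewrite (_ : C2 * (A + u1 + u2) * t `^ (- q) = eps * (A + u1 + u2)); last by rewrite /eps; ring.
rewrite /TVdist; set S := [set _ | _ in _].
have gapB (B : set X) : measurable B ->
    (`|(muPt TL TR K m t B - muPt TL TR K n t B)%E|%E <= (eps * (A + u1 + u2))%:E)%E.
  move=> mB; have g01 x : 0 <= (\1_B x : R) <= 1.
    by rewrite /indic; case: (x \in B); rewrite ?lexx ?ler01.
  have mg : measurable_fun setT (\1_B : X -> R) by exact: measurable_indic.
  have mF := measurable_finePt N0 TL0 TR0 K1 t0' mg g01.
  have F01 := finePt01 N0 TL0 TR0 K1 t0' mg g01.
  have osc := Hosc t \1_B t0 mg g01.
  have mom := measurable_moment TL TR th (N := N).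
  have mom0 := moment_ge0 TL TR th01 (N := N).
  have HF x := PtK N0 TL0 TR0 K1 t0' mg g01 x.
  have mE (k : probability X R) : muPt TL TR K k t B =
      (\int[k]_x (EFin \o (fun x => fine (Pt TL TR K t (EFin \o \1_B) x))) x)%E.
    by apply: eq_integral => x _; rewrite /= HF.
  have H1 := ae_posfun aem; have H2 := ae_posfun aen.
  have g1 := posfun_gap H1 H2 mF F01 mom mom0 A0 eps0 u10 Hu1 Hu2 osc.
  have g2 := posfun_gap H2 H1 mF F01 mom mom0 A0 eps0 u20 Hu2 Hu1 osc.
  rewrite -!mE in g1 g2.
  have fin (k : probability X R) : muPt TL TR K k t B \is a fin_num.
    have HT : posfun setT (fun f => \int[k]_x f x)%E by apply: ae_posfun; exact: aeW.
    rewrite mE; apply: (posfun_fin HT); last first.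
      apply: (posfun_le_cst HT (k := 1)) => // [|x _]; last first.
        by rewrite lee_fin; case/andP: (F01 x).
      by apply: nnmf_EFin => // x; case/andP: (F01 x).
    by apply: nnmf_EFin => // x; case/andP: (F01 x).
  have g3 : (eps * (A + u2 + u1) = eps * (A + u1 + u2))%R by rewrite addrAC.
  rewrite g3 in g2.
  move: (fin m) (fin n) g1 g2; move: (muPt _ _ _ m t B) (muPt _ _ _ n t B) => [a| |] [b| |]// _ _.
  rewrite -!EFinD !lee_fin => g1 g2.
  rewrite ler_norml; apply/andP; split; lra.
have Sle : (ereal_sup S <= (eps * (A + u1 + u2))%:E)%E.
  by apply: ge_ereal_sup => _ [B mB <-]; exact: gapB.
(* The upper bound, and a member of the set coming from [set0], make the supremum a real number;
   [fine] would send an infinite one to 0. *)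
have S0 : (0 <= ereal_sup S)%E.
  apply: (@le_trans _ _ `|(muPt TL TR K m t set0 - muPt TL TR K n t set0)%E|%E) => //.
  by apply: ereal_sup_ubound; exists set0.
have Sfin : ereal_sup S \is a fin_num.
  by rewrite ge0_fin_numE// (le_lt_trans Sle)// ltry.
by rewrite -!lee_fin fineK// S0.
Qed.

End total_variation.

Theorem theorem1 (R : realType) (N : nat) (TL TR : R) :
  (1 <= N)%N -> 0 < TL -> 0 < TR ->
  exists K0 : R, forall K : R, K0 <= K ->
  forall gamma : R, 0 < gamma ->
  exists eta : R, 0 < eta /\
  forall mu nu : probability (N.-tuple R) R,
    M_eta eta mu -> M_eta eta nu ->
    (fun t : R => t `^ (2 - gamma) * TVdist TL TR K mu nu t) @ +oo --> 0.
Proof.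
(* [K >= 1] keeps the cap off the rates at energies up to 1. *)
move=> N0 TL0 TR0; exists 1 => K K1 gamma gamma0.
(* [4 * th <= gamma] gives [q > 2 - 4 * th >= 2 - gamma]; the minimum with 1 gives [th <= 1 / 4]. *)
pose th := Num.min gamma 1 / 4.
have th01 : 0 < th <= 1 / 4.
  by rewrite /th divr_gt0 ?lt_min ?gamma0 ?ltr01//= ler_pM2r ?invr_gt0// ge_min lexx orbT.
have thg : 4 * th <= gamma by rewrite /th mulrC divfK// ge_min lexx.
exists th; split; first by case/andP: th01.
move=> mu nu Hmu Hnu.
have [C C0 HC] := TVdist_le N0 TL0 TR0 K1 th01 Hmu Hnu.
have /andP[q0 q2] := rate_exponent_bounds th01.
set q := rate_exponent th in q0 q2 HC.
apply: (@cvg_powR_pinfty _ C (q - (2 - gamma))) => [|t t0]; first by lra.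
have /andP[h1 h2] := HC t t0.
rewrite mulr_ge0 ?powR_ge0//=.
rewrite (_ : - (q - (2 - gamma)) = (2 - gamma) + - q); last by ring.
rewrite (@powRD _ t (2 - gamma) (- q)); last by apply/implyP => _; rewrite gt_eqF.
by rewrite mulrCA ler_wpM2l// powR_ge0.
Qed.
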